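(* Let $\mu$ be an $x_2$ slice singular Borel probability measure on $[0,1)^2$, let $\mathcal{V}_\mu:L^2(\mu)\to H^2(\mathbb{D}^2)$ be its Normalized Cauchy Transform, and let $\widetilde{B}(z_2)$ be the associated analytic operator acting isometrically on $\mathcal{H}(b)(z_2)$. Then $$\mathrm{Im}(\mathcal{V}_\mu)=\mathcal{H}(\widetilde{B}).$$
   Context: ''Singular'' means singular with respect to Lebesgue measure on $[0,1)$; inner products are linear in the first slot. For a Borel probability measure $\mu$ on $[0,1)^2$, $\mu_1$ is its marginal (push-forward under $(x_1,x_2)\mapsto x_1$) and $\{\gamma^{x_1}\}$ its slice measures: the $\mu_1$-a.e. unique Borel probability measures on $[0,1)$ with $\int f\,d\mu=\int\int f(x_1,x_2)\,d\gamma^{x_1}(x_2)\,d\mu_1(x_1)$ (Rokhlin disintegration). $\mu$ is $x_2$ slice singular if $\mu_1$ is singular and $\gamma^{x_1}$ is singular for $\mu_1$-a.e. $x_1$. Auxiliary sequence of a Borel probability measure $\nu$ on $[0,1)$: with $e_n(x)=e^{2\pi inx}$, $g_0=e_0$, $g_n=e_n-\sum_{k=0}^{n-1}\langle e_n,e_k\rangle_{L^2(\nu)}g_k$. Let $\{g_{n_1}\}$ be the auxiliary sequence of $\mu_1$ and $\{g_{n_2}^{x_1}\}$ that of $\gamma^{x_1}$. Normalized Cauchy Transform: $\mathcal{V}_\mu(f)=\sum_{n_2=0}^\infty\sum_{n_1=0}^\infty\langle f,g_{n_2}^{x_1}(x_2)g_{n_1}(x_1)\rangle_{L^2(\mu)}z_1^{n_1}z_2^{n_2}$,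 an isometry from $L^2(\mu)$ into $H^2(\mathbb{D}^2)$. One-variable objects: for a singular Borel probability measure $\nu$ on $[0,1)$, its inner function $b$ (with $b(0)=0$) is determined by $\frac{1+b(w)}{1-b(w)}=\int_0^1\frac{1+we^{-2\pi ix}}{1-we^{-2\pi ix}}\,d\nu(x)$, $w\in\mathbb{D}$; $\mathcal{H}(b)=[bH^2(\mathbb{D})]^\perp\subseteq H^2(\mathbb{D})$; and $V_\nu:L^2(\nu)\to\mathcal{H}(b)$, $[V_\nu f](w)=\frac{\int_0^1 f(x)(1-we^{-2\pi ix})^{-1}d\nu(x)}{\int_0^1(1-we^{-2\pi ix})^{-1}d\nu(x)}$, is unitary. Below $b=b(z_1)$ is the inner function of $\mu_1$ (in the variable $z_1$). For a Hilbert space $H$, $H(w)=\{\sum_{n\ge0}h_nw^n:h_n\in H,\ \sum\|h_n\|^2<\infty\}$ with $\langle\sum h_nw^n,\sum k_nw^n\rangle=\sum\langle h_n,k_n\rangle$. An analytic operator $A(w)=\sum A_nw^n$ ($A_n\in B(H)$, convergence in operator norm for $w\in\mathbb{D}$) acts on power series by $A(w)\sum h_nw^n=\sum_n\big(\sum_{k=0}^nA_kh_{n-k}\big)w^n$. The space $\mathcal{H}(b)(z_2)$ is regarded as a closed subspace of $H^2(\mathbb{D}^2)$. Let $S$ be the unitary $f\mapsto e^{2\pi ix_2}f$ on $L^2(\mu)$, and regard $L^2(\mu_1)\subseteq L^2(\mu)$ as the functions of $x_1$ alone. By a lemma of de Branges there is a unique analytic operator $B(w)=\sum_nB_nw^n$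 on $L^2(\mu_1)$, $w\in\mathbb{D}$, with $\langle(1+wS^* )(1-wS^* )^{-1}a,c\rangle_{L^2(\mu)}=\langle(1+B(w))(1-B(w))^{-1}a,c\rangle_{L^2(\mu_1)}$ for all $a,c\in L^2(\mu_1)$ (and $\|B(w)\|\le|w|$). $B(w)$ is multiplication by $b^{x_1}(w)$, where $b^{x_1}$ is the inner function of $\gamma^{x_1}$, and $B$ acts isometrically on $L^2(\mu_1)(w)$. Define $\widetilde{B}(z_2)=\sum_{n}V_{\mu_1}B_nV_{\mu_1}^*z_2^n$, acting isometrically on $\mathcal{H}(b)(z_2)$ by power series multiplication, and $\mathcal{H}(\widetilde{B})=[\widetilde{B}(z_2)\,\mathcal{H}(b)(z_2)]^\perp$, the orthogonal complement being taken in $\mathcal{H}(b)(z_2)$. *)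

(* Defs.v *)
From HB Require Import structures.
From mathcomp Require Import all_boot all_order all_algebra.
From mathcomp Require Import all_classical all_reals all_analysis.
From mathcomp Require Import measurable_realfun.
From mathcomp Require Export complex.

Set Implicit Arguments.
Unset Strict Implicit.
Unset Printing Implicit Defensive.
Import Order.TTheory GRing.Theory Num.Theory.
Import numFieldNormedType.Exports.

Local Open Scope classical_set_scope.
Local Open Scope ring_scope.

(* Throughout, [xget] selects an object that exists and is unique (for
   operators: unique up to equality of elements, see [heq]) in the situations
   where it is used; its default value is then irrelevant. *)

Section complex_analysis.
Context {R : realType}.

(* e^{it} *)
Definition cexpi (t : R) : R[i] := Complex (cos t) (sin t).

Definition csum_to (u : nat -> R[i]) (l : R[i]) : Prop :=
  (series (fun n => complex.Re (u n)) @ \oo --> complex.Re l) /\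
  (series (fun n => complex.Im (u n)) @ \oo --> complex.Im l).

Definition csum (u : nat -> R[i]) : R[i] :=
  Complex (limn (series (fun n => complex.Re (u n))))
          (limn (series (fun n => complex.Im (u n)))).

Definition cintegral d (T : measurableType d) (nu : {measure set T -> \bar R})
    (f : T -> R[i]) : R[i] :=
  Complex (\int[nu]_x complex.Re (f x)) (\int[nu]_x complex.Im (f x)).

Definition pseries_eval (a : nat -> R[i]) (w : R[i]) : R[i] :=
  csum (fun n => a n * w ^+ n).

(* The Taylor coefficients at 0 of a function analytic on the unit disc *)
Definition taylor (F : R[i] -> R[i]) : nat -> R[i]^o :=
  xget (fun=> 0) [set a : nat -> R[i]^o | forall w : R[i], `|w| < 1 ->
    csum_to (fun n => (a n : R[i]) * w ^+ n) (F w)].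

End complex_analysis.

(* A Hilbert space is presented by representatives: the members [hset] of an
   ambient vector space, with an inner product linear in the first slot.
   Members at distance 0, such as a.e. equal functions in L^2, stand for the
   same element, so equality of elements is [heq] rather than [=]. *)
Record hilbert (R : realType) := Hilbert {
  hvec : lmodType R[i];
  hset : set hvec;
  hdot : hvec -> hvec -> R[i] }.
Arguments hset {R} h _.
Arguments hdot {R} h _ _.

Section hilbert.
Context {R : realType}.
Implicit Types H K : hilbert R.

Definition hnorm H (f : hvec H) : R := Num.sqrt (complex.Re (hdot H f f)).
Arguments hnorm : clear implicits.

Definition heq H (f g : hvec H) : Prop := hnorm H (f - g) = 0.
Arguments heq : clear implicits.

Definition orthocomplement H (A : set (hvec H)) : set (hvec H) :=
  [set h | hset H h /\ forall k, A k -> hdot H h k = 0].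

Definition subhilbert H (A : set (hvec H)) : hilbert R :=
  @Hilbert R (hvec H) A (hdot H).

Definition bounded_operator H K (T : hvec H -> hvec K) : Prop :=
  [/\ forall f, hset H f -> hset K (T f),
      forall (a : R[i]) f g, hset H f -> hset H g ->
        heq K (T (a *: f + g)) (a *: T f + T g) &
      exists M : R, forall f, hset H f -> hnorm K (T f) <= M * hnorm H f].

Definition adjoint H K (T : hvec H -> hvec K) : hvec K -> hvec H :=
  xget (fun=> 0) [set T' : hvec K -> hvec H | forall k, hset K k ->
    hset H (T' k) /\ forall h, hset H h -> hdot K (T h) k = hdot H h (T' k)].

Definition inverse_operator H (T T' : hvec H -> hvec H) : Prop :=
  bounded_operator T' /\
  forall h, hset H h -> heq H (T (T' h)) h /\ heq H (T' (T h)) h.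

Definition invertible_operator H (T : hvec H -> hvec H) : Prop :=
  exists T', inverse_operator T T'.

Definition operator_inv H (T : hvec H -> hvec H) : hvec H -> hvec H :=
  xget (fun=> 0) [set T' | inverse_operator T T'].

(* T = \sum_n w^n A_n, with convergence in operator norm *)
Definition operator_sum_to H (A : nat -> hvec H -> hvec H) (w : R[i])
    (T : hvec H -> hvec H) : Prop :=
  bounded_operator T /\
  forall e : R, 0 < e -> \forall N \near \oo, forall h, hset H h ->
    hnorm H (\sum_(n < N) w ^+ n *: A n h - T h) <= e * hnorm H h.

Definition analytic_operator H (A : nat -> hvec H -> hvec H) : Prop :=
  (forall n, bounded_operator (A n)) /\
  forall w : R[i], `|w| < 1 -> exists T, operator_sum_to A w T.

Definition operator_eval H (A : nat -> hvec H -> hvec H) (w : R[i]) :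
    hvec H -> hvec H :=
  xget (fun=> 0) [set T | operator_sum_to A w T].

(* H(w): the power series \sum_n h_n w^n is the sequence h of its
   coefficients. *)
Definition power_space H : hilbert R :=
  @Hilbert R (nat -> hvec H)
    [set h | (forall n, hset H (h n)) /\
             (\sum_(0 <= n <oo) ((hnorm H (h n)) ^+ 2)%:E < +oo)%E]
    (fun h k => csum (fun n => hdot H (h n) (k n))).

Definition operator_mul H (A : nat -> hvec H -> hvec H)
    (h : hvec (power_space H)) : hvec (power_space H) :=
  fun n => \sum_(k < n.+1) A k (h (n - k)%N).

Definition scalars : hilbert R :=
  @Hilbert R R[i]^o setT (fun z z' => (z : R[i]) * (z'^*)%C).

Definition H2 : hilbert R := power_space scalars.

(* H^2(D^2) as H^2(D)(z_2): [c n2 n1] is the coefficient of z1^n1 z2^n2. *)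
Definition H2D2 : hilbert R := power_space H2.

Definition L2 d (T : measurableType d) (nu : {measure set T -> \bar R}) :
    hilbert R :=
  @Hilbert R (T -> R[i]^o)
    [set f : T -> R[i]^o |
      [/\ measurable_fun setT (fun x => complex.Re (f x : R[i])),
          measurable_fun setT (fun x => complex.Im (f x : R[i])) &
          (\int[nu]_x ((complex.Re (f x : R[i])) ^+ 2 +
                       (complex.Im (f x : R[i])) ^+ 2)%:E < +oo)%E]]
    (fun f g => cintegral nu (fun x => (f x : R[i]) * ((g x)^*)%C)).

End hilbert.
Arguments H2 : clear implicits.
Arguments H2D2 : clear implicits.
Arguments orthocomplement {R} H A.
Arguments subhilbert {R} H A.
Arguments adjoint {R} H K T.
Arguments operator_inv {R} H T.

(* Borel measures on [0,1) and [0,1)^2 are Borel measures on R and R^2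
   carried by these sets. *)
Section one_variable.
Context {R : realType}.
Local Notation RB := (measurableTypeR R).
Implicit Type nu : {measure set RB -> \bar R}.

Definition singular nu : Prop :=
  exists N : set RB, [/\ measurable N, lebesgue_measure N = 0%E &
                         nu (~` N) = 0%E].

Definition char_e (n : nat) : RB -> R[i]^o :=
  fun x => cexpi (2 * pi * n%:R * x).

(* g_0, ..., g_(n-1); see [auxiliaryE] for the recurrence. *)
Fixpoint auxiliary_prefix nu (n : nat) : seq (RB -> R[i]^o) :=
  if n is m.+1 then
    let s := auxiliary_prefix nu m in
    rcons s (char_e m - \sum_(k < m)
      hdot (L2 nu) (char_e m) (char_e k) *: nth 0 s k)
  else [::].

Definition auxiliary nu (n : nat) : RB -> R[i]^o :=
  nth 0 (auxiliary_prefix nu n.+1) n.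

Lemma size_auxiliary_prefix nu n : size (auxiliary_prefix nu n) = n.
Proof. by elim: n => //= n IHn; rewrite size_rcons IHn. Qed.

Lemma nth_auxiliary_prefix nu n k : (k < n)%N ->
  nth 0 (auxiliary_prefix nu n) k = auxiliary nu k.
Proof.
elim: n => // n IHn; rewrite ltnS leq_eqVlt => /predU1P[->//|kn].
by rewrite /= nth_rcons size_auxiliary_prefix kn IHn.
Qed.

Lemma auxiliaryE nu n :
  auxiliary nu n = char_e n - \sum_(k < n)
    hdot (L2 nu) (char_e n) (char_e k) *: auxiliary nu k.
Proof.
rewrite {1}/auxiliary /= nth_rcons size_auxiliary_prefix ltnn eqxx.
by congr (_ - _); apply: eq_bigr => k _; rewrite nth_auxiliary_prefix.
Qed.

Definition cauchy_kernel (w : R[i]) (x : R) : R[i] :=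
  (1 - w * cexpi (- (2 * pi * x)))^-1.

Definition herglotz nu (w : R[i]) : R[i] :=
  cintegral nu (fun x : RB =>
    (1 + w * cexpi (- (2 * pi * x))) / (1 - w * cexpi (- (2 * pi * x)))).

Definition inner_function nu (w : R[i]) : R[i] :=
  xget 0 [set z : R[i] | 1 - z != 0 /\ (1 + z) / (1 - z) = herglotz nu w].

Definition mulH2 (b : R[i] -> R[i]) (f : hvec (H2 R)) : hvec (H2 R) :=
  taylor (fun w => b w * pseries_eval f w).

(* The space H(b) of the inner function b of nu *)
Definition Hb nu : hilbert R :=
  subhilbert (H2 R)
    (orthocomplement (H2 R) (mulH2 (inner_function nu) @` hset (H2 R))).

Definition V1 nu (f : hvec (L2 nu)) : hvec (Hb nu) :=
  taylor (fun w => cintegral nu (fun x => (f x : R[i]) * cauchy_kernel w x) /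
                   cintegral nu (cauchy_kernel w)).

End one_variable.
Arguments V1 {R} nu f.

Section two_variables.
Context {R : realType}.
Local Notation RB := (measurableTypeR R).

HB.instance Definition _ :=
  isMeasurableFun.Build _ _ (RB * RB)%type RB fst measurable_fst.

Implicit Types (mu : probability (RB * RB)%type R) (gamma : R.-pker RB ~> RB).

Definition unit_interval : set RB := `[0, 1[%classic.

Definition on_unit_square mu : Prop :=
  mu (unit_interval `*` unit_interval) = 1%E.

Definition marginal1 mu : probability RB R := distribution mu fst.

(* gamma is a version of the disintegration of mu along x_1. *)
Definition slice_measures mu gamma : Prop :=
  {ae marginal1 mu, forall x1, gamma x1 unit_interval = 1%E} /\
  forall f : RB * RB -> \bar R, measurable_fun setT f ->
    (forall x, (0 <= f x)%E) ->
    (\int[mu]_x f x =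
     \int[marginal1 mu]_x1 \int[gamma x1]_x2 f (x1, x2))%E.

Definition slice_singular mu gamma : Prop :=
  singular (marginal1 mu) /\
  {ae marginal1 mu, forall x1, singular (gamma x1)}.

(* The Normalized Cauchy Transform *)
Definition NCT mu gamma (f : hvec (L2 mu)) : hvec (H2D2 R) :=
  fun n2 n1 => hdot (L2 mu) f
    (fun x => (auxiliary (gamma x.1) n2 x.2 : R[i]) *
              auxiliary (marginal1 mu) n1 x.1).

(* The unitary S *)
Definition mul_e2 mu (f : hvec (L2 mu)) : hvec (L2 mu) :=
  fun x => cexpi (2 * pi * x.2) * (f x : R[i]).

(* The inclusion of L^2(mu_1) in L^2(mu) *)
Definition embed1 mu (a : hvec (L2 (marginal1 mu))) : hvec (L2 mu) :=
  fun x => a x.1.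

Definition deBranges_operator mu
    (B : nat -> hvec (L2 (marginal1 mu)) -> hvec (L2 (marginal1 mu))) : Prop :=
  let H := L2 mu in
  let H1 := L2 (marginal1 mu) in
  let Sstar := adjoint H H (@mul_e2 mu) in
  analytic_operator B /\
  forall w : R[i], `|w| < 1 ->
    let Bw := operator_eval B w in
    @invertible_operator R H1 (fun f => f - Bw f) /\
    forall a c, hset H1 a -> hset H1 c ->
      let u := operator_inv H (fun f => f - w *: Sstar f) (embed1 a) in
      let v := operator_inv H1 (fun f => f - Bw f) a in
      hdot H (u + w *: Sstar u) (embed1 c) = hdot H1 (v + Bw v) c.

Definition tilde mu
    (B : nat -> hvec (L2 (marginal1 mu)) -> hvec (L2 (marginal1 mu))) (n : nat) :
    hvec (Hb (marginal1 mu)) -> hvec (Hb (marginal1 mu)) :=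
  let mu1 := marginal1 mu in
  fun h => V1 mu1 (B n (adjoint (L2 mu1) (Hb mu1) (V1 mu1) h)).

(* The complement is taken in H(b)(z_2), whose ambient vector space of double
   sequences is that of H^2(D^2). *)
Definition HBtilde mu
    (Btilde : nat -> hvec (Hb (marginal1 mu)) -> hvec (Hb (marginal1 mu))) :
    set (hvec (H2D2 R)) :=
  let Hbz2 := power_space (Hb (marginal1 mu)) in
  orthocomplement Hbz2 (operator_mul Btilde @` hset Hbz2).

End two_variables.
Arguments NCT {R} mu gamma f.
Arguments deBranges_operator {R} mu B.
Arguments tilde {R} mu B n _.
Arguments HBtilde {R} mu Btilde _.

(* Main.v *)
(* Put T f = e^{-2 pi i x} (f - int f) on L^2(nu). The one-variable transform is
   V f = (int T^n f dnu)_n = (<f, g_n>)_n, and multiplication by the inner function b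
   is realised by the same dynamics driven by an input: if X_0 = 0 and
   X_{n+1} = T X_n + l_n e^{-2 pi i x}, then int X_n dnu is the n-th coefficient of b l.
   Since |T f|^2 = |f|^2 - |int f|^2, summing along a trajectory gives
   sum_{n<N} (V f)_n conj((b l)_n) = - <T^N f, X_N>, so Im V is orthogonal to b H^2 as soon
   as T^N -> 0 strongly. The latter holds for singular nu: the Herglotz formula gives
   1 - |b|^2 <= 4 P[nu] for the Poisson integral P[nu], which is small near the circle off a
   set of small measure; so b has norm 1 in H^2, that is T^N e^{-2 pi i x} -> 0, and this
   spreads to all trigonometric polynomials and, by density, to L^2(nu).
   In two variables all this is done in the slices gamma^{x_1}. The coefficient of z_2^n in
   the transform of f is V_{mu_1} applied to x_1 |-> <f(x_1, .), g_n^{x_1}>, and comparing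
   resolvents shows that B_n is multiplication by the n-th coefficient of b^{x_1}; integrating
   the slice identity over x_1 proves orthogonality. Conversely, if h = sum_n V_{mu_1}(l_n) z_2^n
   is in H(B~), the Bessel inequality makes f = sum_n l_n(x_1) g_n^{x_1}(x_2) converge in
   L^2(mu), and the Gram matrix of the g_n^{x_1}, which is the identity minus products of
   coefficients of b^{x_1}, reduces the equality of h with the transform of f to the
   orthogonality of h to B~. *)
From HB Require Import structures.
From mathcomp Require Import all_boot all_order all_algebra.
From mathcomp Require Import all_classical all_reals all_analysis measurable_realfun ring lra.
Require Import Defs.
Set Implicit Arguments.
Unset Strict Implicit.
Unset Printing Implicit Defensive.
Import Order.TTheory GRing.Theory Num.Theory.
Import numFieldNormedType.Exports ComplexField.Normc.
Local Open Scope classical_set_scope.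
Local Open Scope ring_scope.

(** T is the adjoint of g |-> e g - int e g, whose iterates on 1 are the auxiliary functions; this
    is why <f, g_n> = int T^n f. The input makes the system conservative, so that Bessel's
    inequality, the contractivity of multiplication by [b] and the Gram matrix all come from one
    identity. Singularity enters only through the decay of the states. Two obstacles shape the
    two-variable part. The disintegration is given for nonnegative functions, and slices are square
    integrable and stable only for almost every x_1; a slice identity can be integrated only
    together with joint measurability and an integrable majorant. Moreover adjoints, inverses and
    the B_n are determined only up to null sets, whereas the theorem equates sets of coefficient
    arrays. The coefficients <f, g_n> do not see null sets, so the comparison is made on them. *)

Local Notation cabs := normc.
Local Notation Re := complex.Re.
Local Notation Im := complex.Im.

(** * Complex numbers and limits *)

Section modulus.
Context {R : realType}.
Implicit Types (z w : R[i]) (x y : R).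

Lemma cabsE z : `|z| = (cabs z)%:C%C.
Proof. by []. Qed.

Lemma cabs_lt1 z : (`|z| < 1) = (cabs z < 1).
Proof. by rewrite cabsE -ltcR. Qed.

Lemma cabs_ge0 z : 0 <= cabs z.
Proof. by case: z => a b; rewrite /= sqrtr_ge0. Qed.

Lemma cabs_sqr z : cabs z ^+ 2 = Re z ^+ 2 + Im z ^+ 2.
Proof. by case: z => a b /=; rewrite sqr_sqrtr// addr_ge0// sqr_ge0. Qed.

Lemma cabsJ z : cabs (z^*)%C = cabs z.
Proof. by case: z => a b /=; rewrite sqrrN. Qed.

Lemma mulCJ z : z * (z^*)%C = ((cabs z ^+ 2)%:C)%C.
Proof. by rewrite cabs_sqr; case: z => a b; simpc; rewrite [b * a]mulrC addNr !expr2. Qed.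

Lemma cabs_re z : `|Re z| <= cabs z.
Proof.
by rewrite -sqrtr_sqr; case: z => a b /=; rewrite ler_sqrt ?addr_ge0 ?sqr_ge0// lerDl sqr_ge0.
Qed.

Lemma cabs_im z : `|Im z| <= cabs z.
Proof.
by rewrite -sqrtr_sqr; case: z => a b /=; rewrite ler_sqrt ?addr_ge0 ?sqr_ge0// lerDr sqr_ge0.
Qed.

Lemma cabs_le_reim z : cabs z <= `|Re z| + `|Im z|.
Proof.
rewrite -(@ler_pXn2r _ 2)// ?nnegrE ?cabs_ge0 ?addr_ge0//.
rewrite cabs_sqr sqrrD !real_normK ?num_real// lerD2r lerDl.
by rewrite mulrn_wge0 ?mulr_ge0.
Qed.

Lemma cabs_real x : cabs (x%:C)%C = `|x|.
Proof. by rewrite /= expr0n/= addr0 sqrtr_sqr. Qed.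

Lemma cabsX z n : cabs (z ^+ n) = cabs z ^+ n.
Proof.
elim: n => [|n ih]; first by rewrite !expr0 normc1.
by rewrite !exprS normcM ih.
Qed.

Lemma cabs_sum (I : Type) (s : seq I) (P : pred I) (F : I -> R[i]) :
  cabs (\sum_(i <- s | P i) F i) <= \sum_(i <- s | P i) cabs (F i).
Proof.
elim/big_rec2 : _ => [|i y z _ h]; first by rewrite normc0.
by apply: le_trans (le_normcD _ _) _; rewrite lerD2l.
Qed.

Lemma cabs_subC z w : cabs (z - w) = cabs (w - z).
Proof. by rewrite -normcN opprB. Qed.

Lemma cabs_leB z w : cabs z - cabs w <= cabs (z - w).
Proof. by rewrite lerBlDr -{1}(subrK w z) le_normcD. Qed.

Lemma cReD z w : Re (z + w) = Re z + Re w. Proof. by case: z; case: w. Qed.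
Lemma cImD z w : Im (z + w) = Im z + Im w. Proof. by case: z; case: w. Qed.
Lemma cReN z : Re (- z) = - Re z. Proof. by case: z. Qed.
Lemma cImN z : Im (- z) = - Im z. Proof. by case: z. Qed.
Lemma cReB z w : Re (z - w) = Re z - Re w. Proof. by case: z; case: w. Qed.
Lemma cImB z w : Im (z - w) = Im z - Im w. Proof. by case: z; case: w. Qed.
Lemma cReM z w : Re (z * w) = Re z * Re w - Im z * Im w.
Proof. by case: z; case: w. Qed.
Lemma cImM z w : Im (z * w) = Re z * Im w + Im z * Re w.
Proof. by case: z => a b; case: w => c d /=; rewrite [b * c]mulrC. Qed.
Lemma cReJ z : Re (z^*)%C = Re z. Proof. by case: z. Qed.
Lemma cImJ z : Im (z^*)%C = - Im z. Proof. by case: z. Qed.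
Lemma cJD z w : ((z + w)^*)%C = (z^*)%C + (w^*)%C. Proof. exact: rmorphD. Qed.
Lemma cJM z w : ((z * w)^*)%C = (z^*)%C * (w^*)%C. Proof. exact: rmorphM. Qed.
Lemma cJB z w : ((z - w)^*)%C = (z^*)%C - (w^*)%C. Proof. exact: rmorphB. Qed.
Lemma cJN z : ((- z)^*)%C = - (z^*)%C. Proof. exact: rmorphN. Qed.
Lemma cRe_sum (I : Type) (s : seq I) (P : pred I) (F : I -> R[i]) :
  Re (\sum_(i <- s | P i) F i) = \sum_(i <- s | P i) Re (F i).
Proof. by apply: (big_morph _ cReD). Qed.

Lemma cIm_sum (I : Type) (s : seq I) (P : pred I) (F : I -> R[i]) :
  Im (\sum_(i <- s | P i) F i) = \sum_(i <- s | P i) Im (F i).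
Proof. by apply: (big_morph _ cImD). Qed.

Lemma complex_ext z w : Re z = Re w -> Im z = Im w -> z = w.
Proof. by case: z => a b; case: w => c d /= -> ->. Qed.

End modulus.

Section exponential.
Context {R : realType}.
Implicit Types x y : R.

Lemma cexpiD x y : cexpi (x + y) = cexpi x * cexpi y.
Proof. by rewrite /cexpi cosD sinD; apply: complex_ext => //=; ring. Qed.

Lemma cexpi0 : cexpi 0 = 1 :> R[i].
Proof. by rewrite /cexpi cos0 sin0. Qed.

Lemma cexpiJ x : ((cexpi x)^*)%C = cexpi (- x).
Proof. by rewrite /cexpi cosN sinN. Qed.

Lemma cabs_cexpi x : cabs (cexpi x) = 1.
Proof. by rewrite /= cos2Dsin2 sqrtr1. Qed.

Lemma cexpiNK x : cexpi (- x) * cexpi x = 1.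
Proof. by rewrite -cexpiD addNr cexpi0. Qed.

Lemma cexpiKN x : cexpi x * cexpi (- x) = 1.
Proof. by rewrite -cexpiD subrr cexpi0. Qed.

Lemma cexpi_period x : cexpi (x + 2 * pi) = cexpi x.
Proof. by rewrite /cexpi mulr_natl cosD2pi sinD2pi. Qed.

End exponential.

Section complex_limits.
Context {R : realType}.
Implicit Types (s t : nat -> R[i]) (l z : R[i]).

(** Convergence is encoded by the real sequence of moduli, so that squeeze arguments for real
    sequences apply; [ccvgP] translates to the componentwise form of [csum_to]. *)
Definition ccvg s l := (fun n => cabs (s n - l)) @ \oo --> (0 : R).

Lemma ccvgP s l : ccvg s l <->
  ((fun n => Re (s n)) @ \oo --> Re l) /\ ((fun n => Im (s n)) @ \oo --> Im l).
Proof.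
split => [h|[h1 h2]].
- split.
  + apply/cvgrPdist_lt => e e0; move/cvgrPdist_lt : h => /(_ _ e0).
    apply: filterS => n /=; rewrite sub0r normrN ger0_norm ?cabs_ge0//.
    by apply: le_lt_trans; rewrite distrC -cReB cabs_re.
  + apply/cvgrPdist_lt => e e0; move/cvgrPdist_lt : h => /(_ _ e0).
    apply: filterS => n /=; rewrite sub0r normrN ger0_norm ?cabs_ge0//.
    by apply: le_lt_trans; rewrite distrC -cImB cabs_im.
- have d0 (f : nat -> R) a : f @ \oo --> a -> (fun n => `|f n - a|) @ \oo --> 0.
    move=> fa; have -> : 0 = `|a - a| by rewrite subrr normr0.
    by apply: cvg_norm; apply: cvgB => //; exact: cvg_cst.
  have h3 : (fun n => `|Re (s n) - Re l| + `|Im (s n) - Im l|) @ \oo --> (0 : R).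
    by rewrite -(addr0 0); apply: cvgD; exact: d0.
  apply: squeeze_cvgr h3; last exact: cvg_cst.
  apply: nearW => n; rewrite cabs_ge0/=.
  by apply: le_trans (cabs_le_reim _) _; rewrite cReB cImB.
Qed.

Lemma csum_toP (u : nat -> R[i]) l :
  csum_to u l <-> ccvg (fun n => \sum_(k < n) u k) l.
Proof.
rewrite ccvgP /csum_to.
have -> : series (fun n => Re (u n)) = (fun n => Re (\sum_(k < n) u k)).
  by apply/funext => n; rewrite /series/= cRe_sum big_mkord.
have -> : series (fun n => Im (u n)) = (fun n => Im (\sum_(k < n) u k)).
  by apply/funext => n; rewrite /series/= cIm_sum big_mkord.
by [].
Qed.

Lemma csum_unique (u : nat -> R[i]) l : csum_to u l -> csum u = l.
Proof.
case=> h1 h2; rewrite /csum; case: l h1 h2 => a b /= h1 h2.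
by congr Complex; apply/cvg_lim.
Qed.

Lemma ccvg_unique s l l' : ccvg s l -> ccvg s l' -> l = l'.
Proof.
move=> /ccvgP[h1 h2] /ccvgP[h3 h4].
by apply: complex_ext; [exact: (cvg_unique _ h1 h3)|exact: (cvg_unique _ h2 h4)].
Qed.

Lemma ccvg_squeeze s l (e : nat -> R) :
  (forall n, cabs (s n - l) <= e n) -> e @ \oo --> 0 -> ccvg s l.
Proof.
move=> h he; apply: squeeze_cvgr he; last exact: cvg_cst.
by apply: nearW => n; rewrite cabs_ge0 h.
Qed.

Lemma ccvg_cst z : ccvg (fun=> z) z.
Proof.
apply: (@ccvg_squeeze _ _ (fun=> 0)); last exact: cvg_cst.
by move=> n; rewrite subrr normc0.
Qed.

Lemma ccvgD s t l z : ccvg s l -> ccvg t z -> ccvg (fun n => s n + t n) (l + z).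
Proof.
move=> hs ht; apply: (@ccvg_squeeze _ _ (fun n => cabs (s n - l) + cabs (t n - z))).
  by move=> n; rewrite opprD addrACA le_normcD.
by rewrite -(addr0 0); exact: cvgD.
Qed.

Lemma ccvgZ s l z : ccvg s l -> ccvg (fun n => z * s n) (z * l).
Proof.
move=> hs; apply: (@ccvg_squeeze _ _ (fun n => cabs z * cabs (s n - l))).
  by move=> n; rewrite -mulrBr normcM.
by rewrite -(mulr0 (cabs z)); apply: cvgM => //; exact: cvg_cst.
Qed.

Lemma ccvg_sum (I : Type) (r : seq I) (f : I -> nat -> R[i]) (l : I -> R[i]) :
  (forall i, ccvg (f i) (l i)) -> ccvg (fun n => \sum_(i <- r) f i n) (\sum_(i <- r) l i).
Proof.
move=> h; elim: r => [|i r ih].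
  rewrite big_nil; under eq_fun do rewrite big_nil; exact: ccvg_cst.
by rewrite big_cons; under eq_fun do rewrite big_cons; exact: ccvgD.
Qed.

Lemma ccvgN s l : ccvg s l -> ccvg (fun n => - s n) (- l).
Proof. by move=> /(@ccvgZ _ _ (-1)); rewrite mulN1r; under eq_fun do rewrite mulN1r. Qed.

Lemma ccvgS s l : ccvg (fun n => s n.+1) l <-> ccvg s l.
Proof.
by rewrite /ccvg (cvg_shiftS (fun n => cabs (s n - l))).
Qed.

Lemma cvg_geometric_le (q M : R) : 0 <= q -> q < 1 -> (fun n => M * q ^+ n) @ \oo --> 0.
Proof.
move=> q0 q1; rewrite -(mulr0 M); apply: cvgM; first exact: cvg_cst.
by apply: cvg_expr; rewrite ger0_norm.
Qed.

End complex_limits.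

(** The partial sums are constant from [n.+1] on. This extracts the contribution of the identity in
    the Gram matrix of the auxiliary functions. *)
Lemma ccvg_sum_delta (R : realType) (u : nat -> R[i]) n :
  ccvg (fun N => \sum_(m < N) (m == n :> nat)%:R * u m) (u n).
Proof.
have e : \forall N \near \oo, \sum_(m < N) (m == n :> nat)%:R * u m = u n.
  exists n.+1 => // N /= nN; rewrite (bigD1 (Ordinal nN))//= eqxx mul1r big1 ?addr0// => k kn.
  by rewrite (_ : (k == n :> nat) = false) ?mul0r//; apply: contraNF kn => /eqP kn; apply/eqP/val_inj.
by apply/ccvgP; split; apply: cvg_near_cst; apply: filterS e => N ->.
Qed.

(** * Inner product spaces *)

(** The record [hilbert] carries no axioms; these are the ones used below, restricted to members.
    The form is only semidefinite because members at distance 0 may differ; completeness is proved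
    separately for L^2. *)
Record prehilbert (R : realType) (H : hilbert R) : Prop := PreHilbert {
  ph0 : hset H 0;
  phL : forall (a : R[i]) f g, hset H f -> hset H g -> hset H (a *: f + g);
  ph_dotL : forall (a : R[i]) f g h, hset H f -> hset H g -> hset H h ->
    hdot H (a *: f + g) h = a * hdot H f h + hdot H g h;
  ph_dotJ : forall f g, hset H f -> hset H g -> hdot H g f = ((hdot H f g)^*)%C;
  ph_ge0 : forall f, hset H f -> 0 <= Re (hdot H f f) }.

Section prehilbert_theory.
Context {R : realType} (H : hilbert R) (PH : prehilbert H).
Implicit Types (f g h : hvec H) (a : R[i]).

Definition sqn f : R := Re (hdot H f f).

Lemma hsetZ a f : hset H f -> hset H (a *: f).
Proof. by move=> hf; rewrite -[_ *: _]addr0; apply: (phL PH) => //; exact: ph0. Qed.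

Lemma hsetD f g : hset H f -> hset H g -> hset H (f + g).
Proof. by move=> hf hg; rewrite -[f]scale1r; exact: (phL PH). Qed.

Lemma hsetN f : hset H f -> hset H (- f).
Proof. by move=> hf; rewrite -scaleN1r; exact: hsetZ. Qed.

Lemma hsetB f g : hset H f -> hset H g -> hset H (f - g).
Proof. by move=> hf hg; apply: hsetD => //; exact: hsetN. Qed.

Lemma hset_sum (I : Type) (s : seq I) (P : pred I) (F : I -> hvec H) :
  (forall i, P i -> hset H (F i)) -> hset H (\sum_(i <- s | P i) F i).
Proof. by move=> hF; elim/big_ind : _ => //; [exact: ph0|exact: hsetD]. Qed.

Lemma hdot0l g : hset H g -> hdot H 0 g = 0.
Proof.
move=> hg; have := ph_dotL PH (1 : R[i]) (ph0 PH) (ph0 PH) hg.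
by rewrite scale1r addr0 mul1r => /eqP; rewrite -subr_eq0 opprD addNKr oppr_eq0 => /eqP.
Qed.

Lemma hdotZl a f g : hset H f -> hset H g -> hdot H (a *: f) g = a * hdot H f g.
Proof.
move=> hf hg; have := ph_dotL PH a hf (ph0 PH) hg.
by rewrite addr0 hdot0l// addr0.
Qed.

Lemma hdotDl f g h : hset H f -> hset H g -> hset H h ->
  hdot H (f + g) h = hdot H f h + hdot H g h.
Proof. by move=> hf hg hh; have := ph_dotL PH 1 hf hg hh; rewrite scale1r mul1r. Qed.

Lemma hdotNl f g : hset H f -> hset H g -> hdot H (- f) g = - hdot H f g.
Proof. by move=> hf hg; rewrite -scaleN1r hdotZl// mulN1r. Qed.

Lemma hdotBl f g h : hset H f -> hset H g -> hset H h ->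
  hdot H (f - g) h = hdot H f h - hdot H g h.
Proof. by move=> hf hg hh; rewrite hdotDl ?hdotNl//; exact: hsetN. Qed.

Lemma hdot_suml (I : Type) (s : seq I) (P : pred I) (F : I -> hvec H) g :
  (forall i, P i -> hset H (F i)) -> hset H g ->
  hdot H (\sum_(i <- s | P i) F i) g = \sum_(i <- s | P i) hdot H (F i) g.
Proof.
move=> hF hg; elim: s => [|i s ih]; first by rewrite !big_nil hdot0l.
rewrite !big_cons; case: ifPn => // Pi; rewrite hdotDl// ?ih//; first exact: hF.
exact: hset_sum.
Qed.

Lemma hdot0r g : hset H g -> hdot H g 0 = 0.
Proof. by move=> hg; rewrite (ph_dotJ PH (ph0 PH) hg) hdot0l// conjc0. Qed.

Lemma hdotZr a f g : hset H f -> hset H g -> hdot H f (a *: g) = (a^*)%C * hdot H f g.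
Proof.
move=> hf hg; rewrite (ph_dotJ PH (hsetZ a hg) hf) hdotZl// cJM.
by rewrite -(ph_dotJ PH hg hf).
Qed.

Lemma hdotDr f g h : hset H f -> hset H g -> hset H h ->
  hdot H h (f + g) = hdot H h f + hdot H h g.
Proof.
move=> hf hg hh; rewrite (ph_dotJ PH (hsetD hf hg) hh) hdotDl// cJD.
by rewrite -(ph_dotJ PH hf hh) -(ph_dotJ PH hg hh).
Qed.

Lemma hdotNr f g : hset H f -> hset H g -> hdot H f (- g) = - hdot H f g.
Proof. by move=> hf hg; rewrite -scaleN1r hdotZr// rmorphN rmorph1 mulN1r. Qed.

Lemma hdot_sumr (I : Type) (s : seq I) (P : pred I) (F : I -> hvec H) g :
  (forall i, P i -> hset H (F i)) -> hset H g ->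
  hdot H g (\sum_(i <- s | P i) F i) = \sum_(i <- s | P i) hdot H g (F i).
Proof.
move=> hF hg; elim: s => [|i s ih]; first by rewrite !big_nil hdot0r.
rewrite !big_cons; case: ifPn => // Pi; rewrite hdotDr// ?ih//; first exact: hF.
exact: hset_sum.
Qed.

Lemma sqn_ge0 f : hset H f -> 0 <= sqn f. Proof. exact: ph_ge0. Qed.

Lemma hdot_self f : hset H f -> hdot H f f = ((sqn f)%:C)%C.
Proof.
move=> hf; apply: complex_ext => //=.
by have /(congr1 (@complex.Im R)) := ph_dotJ PH hf hf; rewrite cImJ => ?; lra.
Qed.

Lemma sqnZ a f : hset H f -> sqn (a *: f) = cabs a ^+ 2 * sqn f.
Proof.
move=> hf; rewrite /sqn hdotZl ?hdotZr//; last exact: hsetZ.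
by rewrite mulrA mulCJ cReM/= mul0r subr0.
Qed.

Lemma sqnD f g : hset H f -> hset H g ->
  sqn (f + g) = sqn f + sqn g + Re (hdot H f g) *+ 2.
Proof.
move=> hf hg; rewrite /sqn hdotDl ?hdotDr ?cReD//; last exact: hsetD.
by rewrite (ph_dotJ PH hf hg) cReJ; ring.
Qed.

Lemma sqnN f : hset H f -> sqn (- f) = sqn f.
Proof. by move=> hf; rewrite -scaleN1r sqnZ// normcN normc1 expr1n mul1r. Qed.

Lemma sqnB f g : hset H f -> hset H g ->
  sqn (f - g) = sqn f + sqn g - Re (hdot H f g) *+ 2.
Proof. by move=> hf hg; rewrite sqnD ?hdotNr ?sqnN// ?cReN ?mulNrn//; exact: hsetN. Qed.

Lemma cauchy_schwarz f g : hset H f -> hset H g ->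
  cabs (hdot H f g) ^+ 2 <= sqn f * sqn g.
Proof.
move=> hf hg; set c := hdot H f g.
(* Nonnegativity of the squared norm of t conj(c) f - g; the factor conj(c) makes the cross term
   real. *)
have key (t : R) : 0 <= t ^+ 2 * cabs c ^+ 2 * sqn f + sqn g - t * cabs c ^+ 2 *+ 2.
  have := sqn_ge0 (hsetB (hsetZ ((t%:C)%C * (c^*)%C) hf) hg).
  rewrite sqnB ?sqnZ//; last exact: hsetZ.
  rewrite hdotZl// -/c normcM exprMn cabs_real cabsJ real_normK ?num_real//.
  by rewrite -mulrA [(c^*)%C * c]mulrC mulCJ cReM/= mul0r subr0.
have c0 := sqr_ge0 (cabs c); have f0 := sqn_ge0 hf; have g0 := sqn_ge0 hg.
have [fp|] := ltP 0 (sqn f).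
  have := key (sqn f)^-1.
  have -> : (sqn f)^-1 ^+ 2 * cabs c ^+ 2 * sqn f + sqn g - (sqn f)^-1 * cabs c ^+ 2 *+ 2
     = (sqn f * sqn g - cabs c ^+ 2) / sqn f by field; rewrite gt_eqF.
  by rewrite pmulr_lge0 ?invr_gt0// subr_ge0.
move=> f1; have f2 : sqn f = 0 by lra.
rewrite f2 mul0r; have [//|cp] := leP (cabs c ^+ 2) 0.
(* Since [sqn f = 0], this [t] satisfies t |c|^2 = sqn g + 1, and [key] would give 2 (sqn g + 1) <=
   sqn g. *)
have := key (sqn g / cabs c ^+ 2 + (cabs c ^+ 2)^-1).
rewrite f2 mulr0 add0r mulrDl mulVf ?gt_eqF// divfK ?gt_eqF// mulr2n; lra.
Qed.

Lemma hnormE f : @hnorm _ H f = Num.sqrt (sqn f). Proof. by []. Qed.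

Lemma hnorm_ge0 f : 0 <= @hnorm _ H f. Proof. exact: sqrtr_ge0. Qed.

Lemma hnorm_sqr f : hset H f -> @hnorm _ H f ^+ 2 = sqn f.
Proof. by move=> hf; rewrite hnormE sqr_sqrtr// sqn_ge0. Qed.

Lemma cauchy_schwarz_norm f g : hset H f -> hset H g ->
  cabs (hdot H f g) <= @hnorm _ H f * @hnorm _ H g.
Proof.
move=> hf hg; rewrite -(@ler_pXn2r _ 2)// ?nnegrE ?cabs_ge0 ?mulr_ge0 ?hnorm_ge0//.
by rewrite exprMn !hnorm_sqr// cauchy_schwarz.
Qed.

Lemma hnormD f g : hset H f -> hset H g -> @hnorm _ H (f + g) <= @hnorm _ H f + @hnorm _ H g.
Proof.
have key (a b c s : R) : c <= s -> a + b + c *+ 2 <= a + s *+ 2 + b.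
  by move=> cs; rewrite addrAC lerD2r lerD2l lerMn2r.
move=> hf hg; rewrite -(@ler_pXn2r _ 2)// ?nnegrE ?addr_ge0 ?hnorm_ge0//.
rewrite hnorm_sqr ?sqnD ?sqrrD ?hnorm_sqr//; last exact: hsetD.
have := cauchy_schwarz_norm hf hg; have := cabs_re (hdot H f g).
have := ler_norm (Re (hdot H f g)) => h1 h2 h3.
have h4 := le_trans h1 (le_trans h2 h3).
exact: key h4.
Qed.

Lemma hnormN f : hset H f -> @hnorm _ H (- f) = @hnorm _ H f.
Proof. by move=> hf; rewrite hnormE sqnN. Qed.

Lemma sqn_eq0 f : hset H f -> @hnorm _ H f = 0 <-> sqn f = 0.
Proof.
move=> hf; rewrite hnormE; split; last by move->; rewrite sqrtr0.
by move/eqP; rewrite sqrtr_eq0 => h; apply/eqP; rewrite eq_le h sqn_ge0.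
Qed.

Lemma heq_dotl f g h : hset H f -> hset H g -> hset H h -> @heq _ H f g ->
  hdot H f h = hdot H g h.
Proof.
move=> hf hg hh fg; apply/eqP; rewrite -subr_eq0 -hdotBl//.
have := cauchy_schwarz_norm (hsetB hf hg) hh; rewrite [@hnorm _ H (f - g)]fg mul0r => h0.
by apply/eqP/eq0_normc/eqP; rewrite eq_le h0 cabs_ge0.
Qed.

(** Adjoints and inverses selected by [xget] are known only through inner products; this converts
    such knowledge into [heq]. *)
Lemma heq_of_dot f g : hset H f -> hset H g ->
  (forall h, hset H h -> hdot H f h = hdot H g h) -> @heq _ H f g.
Proof.
move=> hf hg h; rewrite /heq sqn_eq0; last exact: hsetB.
by rewrite /sqn hdotBl ?h ?subrr//; exact: hsetB.
Qed.

(** The cross term is controlled by the nonnegativity of the squared norm of [a *: f - g]. *)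
Lemma sqn_lin_le (a : R[i]) f g : hset H f -> hset H g ->
  sqn (a *: f + g) <= (cabs a ^+ 2 * sqn f + sqn g) *+ 2.
Proof.
have key (x y z : R) : 0 <= x + y - z *+ 2 -> x + y + z *+ 2 <= (x + y) *+ 2.
  by rewrite subr_ge0 => h; rewrite [leRHS]mulr2n lerD2l.
move=> hf hg; apply: le_trans (_ : _ <= (sqn (a *: f) + sqn g) *+ 2) _; last by rewrite sqnZ.
have haf := hsetZ a hf; rewrite sqnD//; apply: key; rewrite -sqnB//.
by apply: sqn_ge0; exact: hsetB.
Qed.

End prehilbert_theory.
Arguments sqn {R} H f.

Lemma hdot_cvg (R : realType) (H : hilbert R) (PH : prehilbert H) (S : nat -> hvec H) f g :
  (forall N, hset H (S N)) -> hset H f -> hset H g ->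
  (fun N => sqn H (S N - f)) @ \oo --> 0 -> ccvg (fun N => hdot H (S N) g) (hdot H f g).
Proof.
move=> hS hf hg Sf; apply: (@ccvg_squeeze _ _ _ (fun N => Num.sqrt (sqn H (S N - f)) * @hnorm _ H g)).
  by move=> N; rewrite -(hdotBl PH)// -hnormE; apply: (cauchy_schwarz_norm PH) => //; exact: hsetB.
rewrite -(mul0r (@hnorm _ H g)); apply: cvgM; last exact: cvg_cst.
by rewrite -(sqrtr0 R); apply: (continuous_cvg _ (@sqrt_continuous R 0)).
Qed.

(** * Complex integrals and square-integrable functions *)

Lemma sqr_le_double (R : realType) (u v w : R) : 0 <= u -> 0 <= v -> 0 <= w -> w <= u + v ->
  w ^+ 2 <= (u ^+ 2 + v ^+ 2) *+ 2.
Proof.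
move=> u0 v0 w0 h; apply: (@le_trans _ _ ((u + v) ^+ 2)).
  by rewrite ler_pXn2r// nnegrE addr_ge0.
by have := sqr_ge0 (u - v); rewrite sqrrB sqrrD; lra.
Qed.

Lemma cabs_lin_sqr (R : realType) (a z w : R[i]) :
  cabs (a * z + w) ^+ 2 <= (cabs a ^+ 2 * cabs z ^+ 2 + cabs w ^+ 2) *+ 2.
Proof.
rewrite -exprMn; apply: sqr_le_double; rewrite ?mulr_ge0 ?cabs_ge0//.
by rewrite -normcM le_normcD.
Qed.

Section complex_measurability.
Context {R : realType} d (T : measurableType d).
Implicit Types f g : T -> R[i].

Definition cmeas f := measurable_fun setT (fun x => Re (f x)) /\
  measurable_fun setT (fun x => Im (f x)).

Lemma cmeas_cst (z : R[i]) : cmeas (fun=> z).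
Proof. by split; exact: measurable_cst. Qed.

Lemma cmeasD f g : cmeas f -> cmeas g -> cmeas (fun x => f x + g x).
Proof.
move=> [f1 f2] [g1 g2]; split.
  by under eq_fun do rewrite cReD; exact: measurable_funD.
by under eq_fun do rewrite cImD; exact: measurable_funD.
Qed.

Lemma cmeasM f g : cmeas f -> cmeas g -> cmeas (fun x => f x * g x).
Proof.
move=> [f1 f2] [g1 g2]; split.
  under eq_fun do rewrite cReM.
  by apply: measurable_funB; exact: measurable_funM.
under eq_fun do rewrite cImM.
by apply: measurable_funD; exact: measurable_funM.
Qed.

Lemma cmeasJ f : cmeas f -> cmeas (fun x => ((f x)^*)%C).
Proof.
move=> [f1 f2]; split; first by under eq_fun do rewrite cReJ.
by under eq_fun do rewrite cImJ; exact: measurableT_comp.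
Qed.

Lemma cmeasN f : cmeas f -> cmeas (fun x => - f x).
Proof.
move=> [f1 f2]; split.
  by under eq_fun do rewrite cReN; exact: measurableT_comp.
by under eq_fun do rewrite cImN; exact: measurableT_comp.
Qed.

Lemma cmeasB f g : cmeas f -> cmeas g -> cmeas (fun x => f x - g x).
Proof. by move=> hf hg; apply: cmeasD => //; exact: cmeasN. Qed.

Lemma cmeas_sum (I : Type) (s : seq I) (F : I -> T -> R[i]) :
  (forall i, cmeas (F i)) -> cmeas (fun x => \sum_(i <- s) F i x).
Proof.
move=> hF; elim: s => [|i s ih].
  by under eq_fun do rewrite big_nil; exact: cmeas_cst.
by under eq_fun do rewrite big_cons; exact: cmeasD.
Qed.

Lemma measurable_cabs f : cmeas f -> measurable_fun setT (fun x => cabs (f x)).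
Proof.
move=> [f1 f2].
have -> : (fun x => cabs (f x)) = (fun x => Num.sqrt (Re (f x) ^+ 2 + Im (f x) ^+ 2)).
  by apply/funext => x; case: (f x).
apply: measurableT_comp; first by apply: continuous_measurable_fun; exact: sqrt_continuous.
by apply: measurable_funD; exact: measurable_funX.
Qed.

Lemma measurable_cabs2 f : cmeas f -> measurable_fun setT (fun x => (cabs (f x) ^+ 2)%:E).
Proof. by move=> hf; apply/measurable_EFinP; apply: measurable_funX; exact: measurable_cabs. Qed.

Lemma cmeasV f : cmeas f -> cmeas (fun x => (f x)^-1).
Proof.
move=> hf; have -> : (fun x => (f x)^-1) = (fun x => ((cabs (f x) ^- 2)%:C)%C * ((f x)^*)%C).
  apply/funext => x; have [->|fx0] := eqVneq (f x) 0.
    by rewrite invr0 conjc0 mulr0.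
  apply: (mulfI fx0); rewrite mulfV// mulrCA mulCJ -[RHS]rmorphM mulVf ?rmorph1//.
  by apply: contra fx0; rewrite sqrf_eq0 => /eqP /eq0_normc ->.
apply: cmeasM; last exact: cmeasJ.
split; last exact: measurable_cst.
have -> : (fun x => Re (((cabs (f x) ^- 2)%:C)%C)) = (fun x => (cabs (f x) ^+ 2) `^ (-1)).
  by apply/funext => x /=; rewrite powR_inv1// sqr_ge0.
rewrite -[X in measurable_fun _ X]/((@powR R ^~ (-1)) \o (fun x => cabs (f x) ^+ 2)).
apply: measurableT_comp; first exact: measurable_powR.
by apply: measurable_funX; exact: measurable_cabs.
Qed.

Lemma cmeas_cexpi (h : T -> R) : measurable_fun setT h -> cmeas (fun x => cexpi (h x)).
Proof.
move=> mh; split.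
  by apply: (measurableT_comp _ mh); apply: continuous_measurable_fun; exact: continuous_cos.
by apply: (measurableT_comp _ mh); apply: continuous_measurable_fun; exact: continuous_sin.
Qed.

End complex_measurability.

Lemma cmeas_comp (R : realType) d (T : measurableType d) d' (T' : measurableType d')
    (p : T' -> T) (f : T -> R[i]) :
  measurable_fun setT p -> cmeas f -> cmeas (fun x => f (p x)).
Proof. by move=> mp [f1 f2]; split; [exact: (measurableT_comp f1)|exact: (measurableT_comp f2)]. Qed.

Section complex_integral.
Context {R : realType} d (T : measurableType d) (nu : {measure set T -> \bar R}).
Implicit Types f g : T -> R[i].

Definition cintg f := nu.-integrable setT (fun x => (Re (f x))%:E) /\
  nu.-integrable setT (fun x => (Im (f x))%:E).

Lemma cintg_cmeas f : cintg f -> cmeas f.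
Proof. by case=> /(measurable_int nu)/measurable_EFinP ? /(measurable_int nu)/measurable_EFinP. Qed.

Lemma cintg_le f (g : T -> R) : cmeas f -> (forall x, cabs (f x) <= g x) ->
  nu.-integrable setT (EFin \o g) -> cintg f.
Proof.
move=> [f1 f2] fg ig; split; (apply: le_integrable ig => //; [exact/measurable_EFinP|]) => x _;
  rewrite /= lee_fin; (apply: le_trans (le_trans (fg x) (ler_norm _))); [exact: cabs_re|exact: cabs_im].
Qed.

Lemma cintgD f g : cintg f -> cintg g -> cintg (fun x => f x + g x).
Proof.
move=> [f1 f2] [g1 g2]; split.
  by under eq_fun do rewrite cReD EFinD; exact: integrableD.
by under eq_fun do rewrite cImD EFinD; exact: integrableD.
Qed.

Lemma cintgZ (a : R[i]) f : cintg f -> cintg (fun x => a * f x).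
Proof.
move=> [f1 f2]; split.
  under eq_fun do rewrite cReM EFinB !EFinM.
  by apply: integrableB => //; exact: integrableZl.
under eq_fun do rewrite cImM EFinD !EFinM.
by apply: integrableD => //; exact: integrableZl.
Qed.

Lemma cintg0 : cintg (fun=> 0).
Proof. by split; exact: integrable0. Qed.

Lemma cintg_sum (I : Type) (s : seq I) (F : I -> T -> R[i]) :
  (forall i, cintg (F i)) -> cintg (fun x => \sum_(i <- s) F i x).
Proof.
move=> hF; elim: s => [|i s ih].
  by under eq_fun do rewrite big_nil; exact: cintg0.
by under eq_fun do rewrite big_cons; exact: cintgD.
Qed.

Lemma cintegralD f g : cintg f -> cintg g ->
  cintegral nu (fun x => f x + g x) = cintegral nu f + cintegral nu g.
Proof.
move=> [f1 f2] [g1 g2]; apply: complex_ext; rewrite ?cReD ?cImD /=.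
  by rewrite -RintegralD//; apply: eq_Rintegral => x _; rewrite cReD.
by rewrite -RintegralD//; apply: eq_Rintegral => x _; rewrite cImD.
Qed.

Lemma cintegralZ (a : R[i]) f : cintg f ->
  cintegral nu (fun x => a * f x) = a * cintegral nu f.
Proof.
move=> [f1 f2]; apply: complex_ext; rewrite ?cReM ?cImM /=.
  rewrite -RintegralZl// -[X in _ - X]RintegralZl// -RintegralB//; last 2 first.
  - exact: (integrableZl _ _ f1).
  - exact: (integrableZl _ _ f2).
  by apply: eq_Rintegral => x _; rewrite cReM.
rewrite -RintegralZl// -[X in _ + X]RintegralZl// -RintegralD//; last 2 first.
- exact: (integrableZl _ _ f2).
- exact: (integrableZl _ _ f1).
by apply: eq_Rintegral => x _; rewrite cImM.
Qed.

Lemma cintegral0 : cintegral nu (fun=> 0) = 0.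
Proof. by rewrite /cintegral/= !Rintegral_cst// !mul0r. Qed.

Lemma cintgN f : cintg f -> cintg (fun x => - f x).
Proof. by move=> hf; under eq_fun do rewrite -mulN1r; exact: cintgZ. Qed.

Lemma cintegralN f : cintg f -> cintegral nu (fun x => - f x) = - cintegral nu f.
Proof. by move=> hf; under eq_fun do rewrite -mulN1r; rewrite cintegralZ// mulN1r. Qed.

Lemma cintegralB f g : cintg f -> cintg g ->
  cintegral nu (fun x => f x - g x) = cintegral nu f - cintegral nu g.
Proof. by move=> hf hg; rewrite cintegralD// ?cintegralN//; exact: cintgN. Qed.

Lemma cintegral_sum (I : Type) (s : seq I) (F : I -> T -> R[i]) :
  (forall i, cintg (F i)) ->
  cintegral nu (fun x => \sum_(i <- s) F i x) = \sum_(i <- s) cintegral nu (F i).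
Proof.
move=> hF; elim: s => [|i s ih].
  by rewrite big_nil; under eq_fun do rewrite big_nil; exact: cintegral0.
rewrite big_cons -ih; under eq_fun do rewrite big_cons.
by rewrite cintegralD//; exact: cintg_sum.
Qed.

Lemma cintegralJ f : cintg f -> cintegral nu (fun x => ((f x)^*)%C) = ((cintegral nu f)^*)%C.
Proof.
move=> [f1 f2]; apply: complex_ext; rewrite ?cReJ ?cImJ /=.
  by apply: eq_Rintegral => x _; rewrite cReJ.
rewrite -mulN1r -RintegralZl//; apply: eq_Rintegral => x _.
by rewrite cImJ mulN1r.
Qed.

Lemma ae_eq_cintegral f g : cmeas f -> cmeas g -> {ae nu, forall x, f x = g x} ->
  cintegral nu f = cintegral nu g.
Proof.
move=> [f1 f2] [g1 g2] fg; rewrite /cintegral; congr Complex; congr fine;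
  apply: ae_eq_integral => //; try exact/measurable_EFinP.
  by apply: filterS fg => x /= ->.
by apply: filterS fg => x /= ->.
Qed.

End complex_integral.

Section L2_space.
Context {R : realType} d (T : measurableType d) (nu : {measure set T -> \bar R}).
Implicit Types f g : T -> R[i]^o.
Local Notation H := (L2 nu).

Lemma L2P f : hset H f <-> cmeas f /\ (\int[nu]_x (cabs (f x) ^+ 2)%:E < +oo)%E.
Proof.
rewrite /= /cmeas (eq_integral (fun x => (Re (f x) ^+ 2 + Im (f x) ^+ 2)%:E) (fun x => (cabs (f x) ^+ 2)%:E)); last first.
  by move=> x _; rewrite cabs_sqr.
by split=> [[? ? ?]|[[? ?] ?]].
Qed.

Lemma L2_dotE f g : hdot H f g = cintegral nu (fun x => (f x : R[i]) * ((g x)^*)%C).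
Proof. by []. Qed.

Lemma L2_cmeas f : hset H f -> cmeas f. Proof. by case/L2P. Qed.

Lemma L2_integrable f : hset H f -> nu.-integrable setT (fun x => (cabs (f x) ^+ 2)%:E).
Proof.
case/L2P => mf fi; apply/integrableP; split; first exact: measurable_cabs2.
apply: le_lt_trans fi; rewrite le_eqVlt; apply/orP; left; apply/eqP.
by apply: eq_integral => x _ /=; rewrite ger0_norm ?sqr_ge0.
Qed.

Lemma integrable_L2 f : cmeas f -> nu.-integrable setT (fun x => (cabs (f x) ^+ 2)%:E) ->
  hset H f.
Proof. by move=> mf fi; apply/L2P; split => //; exact: integrable_lty. Qed.

Lemma L2_le f (g : T -> R) : cmeas f -> (forall x, cabs (f x) ^+ 2 <= g x) ->
  nu.-integrable setT (EFin \o g) -> hset H f.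
Proof.
move=> mf fg ig; apply: integrable_L2 => //; apply: le_integrable ig => //.
  exact: measurable_cabs2.
move=> x _ /=; rewrite lee_fin ger0_norm ?sqr_ge0//.
by apply: le_trans (fg x) _; exact: ler_norm.
Qed.

Lemma L2_mulJ f g : hset H f -> hset H g -> cintg nu (fun x => (f x : R[i]) * ((g x)^*)%C).
Proof.
move=> hf hg; apply: (@cintg_le _ _ _ _ _ (fun x => cabs (f x) ^+ 2 + cabs (g x) ^+ 2)).
- by apply: cmeasM; [exact: L2_cmeas|apply: cmeasJ; exact: L2_cmeas].
- move=> x; rewrite normcM cabsJ.
  have := sqr_ge0 (cabs (f x) - cabs (g x)); rewrite sqrrB.
  have := mulr_ge0 (cabs_ge0 (f x)) (cabs_ge0 (g x)).
  by lra.
- under [X in integrable _ _ X]eq_fun do rewrite /= EFinD.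
  by apply: integrableD => //; exact: L2_integrable.
Qed.

Lemma prehilbert_L2 : prehilbert H.
Proof.
have lin (a : R[i]) f g : hset H f -> hset H g -> hset H (a *: f + g).
  move=> hf hg; apply: (@L2_le _ (fun x => 2 * (cabs a ^+ 2 * cabs (f x) ^+ 2 + cabs (g x) ^+ 2))).
  - apply: cmeasD; last exact: L2_cmeas.
    by apply: cmeasM; [exact: cmeas_cst|exact: L2_cmeas].
  - by move=> x; rewrite mulr_natl; exact: (@cabs_lin_sqr R a (f x) (g x)).
  - have : nu.-integrable setT (fun x => 2%:E * ((cabs a ^+ 2)%:E * (cabs (f x) ^+ 2)%:E + (cabs (g x) ^+ 2)%:E))%E.
      by apply: integrableZl => //; apply: integrableD => //;
        [apply: integrableZl => //|]; exact: L2_integrable.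
    by apply: eq_integrable.
split => //.
- apply/L2P; split; first exact: cmeas_cst.
  rewrite (eq_integral (cst 0%E)) ?integral0// => x _.
  by rewrite normc0 expr0n.
- move=> a f g h hf hg hh.
  rewrite -cintegralZ -?cintegralD; [|exact: cintgZ (L2_mulJ hf hh)|exact: L2_mulJ|exact: L2_mulJ].
  by congr cintegral; apply/funext => x; rewrite mulrA -mulrDl.
- move=> f g hf hg; rewrite -cintegralJ; last exact: L2_mulJ.
  by congr cintegral; apply/funext => x; rewrite cJM conjcK mulrC.
- move=> f hf /=; apply: Rintegral_ge0 => x _.
  by rewrite mulCJ /= sqr_ge0.
Qed.

Lemma sqn_L2 f : hset H f -> ((sqn H f)%:E = \int[nu]_x (cabs (f x) ^+ 2)%:E)%E.
Proof.
move=> hf; rewrite /sqn /= /Rintegral.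
under [in RHS]eq_integral do rewrite -[cabs _ ^+ 2]/(Re (((cabs _ ^+ 2)%:C)%C)) -mulCJ.
rewrite fineK//; apply: integrable_fin_num => //.
by have [] := L2_mulJ hf hf.
Qed.

Lemma heq_L2 f g : hset H f -> hset H g -> @heq _ H f g <-> {ae nu, forall x, f x = g x}.
Proof.
move=> hf hg; have hfg := hsetB prehilbert_L2 hf hg.
rewrite /heq sqn_eq0//; last exact: prehilbert_L2.
have m2 := measurable_cabs2 (L2_cmeas hfg).
split=> [h|h].
- have h0 : (\int[nu]_x `|(cabs ((f - g) x) ^+ 2)%:E| = 0)%E.
    rewrite -[RHS](congr1 EFin h) sqn_L2//; apply: eq_integral => x _.
    by rewrite gee0_abs// lee_fin sqr_ge0.
  have /(ae_eq_integral_abs nu measurableT m2) := h0.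
  apply: filterS => x /(_ I) [/eqP].
  rewrite sqrf_eq0 => /eqP /eq0_normc /eqP.
  by rewrite subr_eq0 => /eqP.
- apply: EFin_inj; rewrite sqn_L2// -[RHS](integral0 nu setT).
  apply: ae_eq_integral => //; apply: filterS h => x /= fg _.
  by change (((cabs ((f x : R[i]) - g x)) ^+ 2)%:E = 0%E); rewrite fg subrr normc0 expr0n.
Qed.

Lemma L2_ae_sqn f g : hset H f -> hset H g -> (forall x, cabs (f x) <= cabs (g x)) ->
  sqn H f <= sqn H g.
Proof.
move=> hf hg fg; rewrite -lee_fin !sqn_L2//; apply: ge0_le_integral => //.
- by move=> x _; rewrite lee_fin sqr_ge0.
- by apply: measurable_cabs2; exact: L2_cmeas.
- by apply: measurable_cabs2; exact: L2_cmeas.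
- by move=> x _; rewrite lee_fin ler_pXn2r ?nnegrE ?cabs_ge0.
Qed.

Lemma L2_bounded_mul (c : T -> R[i]) (M : R) f : cmeas c -> (forall x, cabs (c x) <= M) ->
  hset H f -> hset H (fun x => c x * (f x : R[i])) /\
  sqn H (fun x => c x * (f x : R[i])) <= M ^+ 2 * sqn H f.
Proof.
move=> mc cM hf; have hcf : hset H (fun x => c x * (f x : R[i])).
  apply: (@L2_le _ (fun x => M ^+ 2 * cabs (f x) ^+ 2)).
  - by apply: cmeasM => //; exact: L2_cmeas.
  - move=> x; rewrite normcM exprMn ler_wpM2r ?sqr_ge0//.
    by rewrite ler_pXn2r ?nnegrE ?cabs_ge0// (le_trans _ (cM x))// cabs_ge0.
  - by under [X in integrable _ _ X]eq_fun do rewrite /= EFinM; apply: integrableZl => //; exact: L2_integrable.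
split => //; rewrite -lee_fin EFinM !sqn_L2// -ge0_integralZl//; last 3 first.
- by apply: measurable_cabs2; exact: L2_cmeas.
- by move=> x _; rewrite lee_fin sqr_ge0.
- by rewrite lee_fin sqr_ge0.
apply: ge0_le_integral => //.
- by move=> x _; rewrite lee_fin sqr_ge0.
- by apply: measurable_cabs2; exact: L2_cmeas.
- by apply: measurable_funeM; apply: measurable_cabs2; exact: L2_cmeas.
- move=> x _; rewrite -EFinM lee_fin normcM exprMn ler_wpM2r ?sqr_ge0//.
  by rewrite ler_pXn2r ?nnegrE ?cabs_ge0// (le_trans _ (cM x))// cabs_ge0.
Qed.

End L2_space.

Section L2_probability.
Context {R : realType} d (T : measurableType d) (nu : {measure set T -> \bar R}).
Hypothesis nu1 : nu setT = 1%E.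
Local Notation H := (L2 nu).

Lemma integrable_cst1 (k : R) : nu.-integrable setT (EFin \o cst k).
Proof.
apply/integrableP; split; first exact/measurable_EFinP.
by rewrite /= integral_cst//= nu1 mule1 ltry.
Qed.

Lemma L2_bounded (f : T -> R[i]^o) (M : R) : cmeas f -> (forall x, cabs (f x) <= M) ->
  hset H f.
Proof.
move=> mf fM; apply: (@L2_le _ _ _ _ _ (cst (M ^+ 2))) => //; last exact: integrable_cst1.
by move=> x; rewrite ler_pXn2r ?nnegrE ?cabs_ge0// (le_trans _ (fM x))// cabs_ge0.
Qed.

Lemma L2_cst (z : R[i]) : hset H (fun=> z).
Proof. by apply: (@L2_bounded _ (cabs z)) => //; exact: cmeas_cst. Qed.

Lemma L2_cintg f : hset H f -> cintg nu f.
Proof.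
move=> hf; have := L2_mulJ hf (L2_cst 1).
by rewrite (_ : (fun x => _) = f)//; apply/funext => x; exact: (etrans (congr1 ( *%R (f x : R[i])) (conjc1 R)) (mulr1 _)).
Qed.

Lemma hdot_cst1 (f : T -> R[i]^o) : hdot H f (fun=> 1) = cintegral nu f.
Proof. by rewrite /=; congr cintegral; apply/funext => x; exact: (etrans (congr1 ( *%R (f x : R[i])) (conjc1 R)) (mulr1 _)). Qed.

Lemma cintegral_cst (z : R[i]) : cintegral nu (fun=> z) = z.
Proof. by case: z => a b; rewrite /cintegral/= !Rintegral_cst// nu1 !mulr1. Qed.

Lemma sqn_bounded (f : T -> R[i]^o) (M : R) : cmeas f -> (forall x, cabs (f x) <= M) ->
  sqn H f <= M ^+ 2.
Proof.
move=> mf fM; have h1 : hset H (fun=> 1 : R[i]^o) by exact: L2_cst.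
have [hf1 hf2] := L2_bounded_mul mf fM h1.
move: hf2; under [X in sqn _ X]eq_fun do rewrite mulr1.
move/le_trans; apply; rewrite /sqn hdot_cst1 cintegral_cst /= mulr1//.
Qed.

End L2_probability.

(** * Nonnegative series and completeness of L^2 *)

Section real_series.
Context {R : realType}.
Implicit Types s : nat -> R.

Lemma nneseries_partial_le s n : (forall k, 0 <= s k) ->
  (\sum_(0 <= k <oo) (s k)%:E < +oo)%E ->
  \sum_(k < n) s k <= fine (\sum_(0 <= k <oo) (s k)%:E)%E.
Proof.
move=> s0 sy; rewrite -lee_fin fineK; last first.
  by rewrite ge0_fin_numE// nneseries_ge0// => k _ _; rewrite lee_fin.
rewrite -sumEFin -(big_mkord xpredT (fun k => (s k)%:E)).
by apply: nneseries_lim_ge => k _ _; rewrite lee_fin.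
Qed.

Lemma nneseries_bounded_lty s (K : R) : (forall k, 0 <= s k) ->
  (forall n, \sum_(k < n) s k <= K) -> (\sum_(0 <= k <oo) (s k)%:E < +oo)%E.
Proof.
move=> s0 sK; apply: (@le_lt_trans _ _ K%:E); last exact: ltry.
apply: lime_le; first by apply: is_cvg_nneseries => k _ _; rewrite lee_fin.
by apply: nearW => n; rewrite sumEFin lee_fin big_mkord.
Qed.

Lemma cvg_series_nneseries s : (forall k, 0 <= s k) ->
  (\sum_(0 <= k <oo) (s k)%:E < +oo)%E -> cvgn (fun n => \sum_(k < n) s k).
Proof.
move=> s0 sy; apply: nondecreasing_is_cvgn.
  apply/nondecreasing_seqP => n; rewrite big_ord_recr/= lerDl//.
exists (fine (\sum_(0 <= k <oo) (s k)%:E)%E) => _ [n _ <-].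
exact: nneseries_partial_le.
Qed.

Lemma sum_ord_diff (V : zmodType) (v : nat -> V) m n : (m <= n)%N ->
  \sum_(m <= i < n) v i = \sum_(k < n) v k - \sum_(k < m) v k.
Proof.
move=> mn; rewrite -!(big_mkord xpredT v) (big_cat_nat (leq0n m) mn)/=.
by rewrite addrAC subrr add0r.
Qed.

Lemma nneseries_tail s : (forall k, 0 <= s k) ->
  (\sum_(0 <= k <oo) (s k)%:E < +oo)%E ->
  forall e, 0 < e -> exists M, forall m n, (M <= m)%N -> (m <= n)%N ->
    \sum_(m <= i < n) s i <= e.
Proof.
move=> s0 sy e e0; have := cvg_series_nneseries s0 sy.
move=> /cvg_ex[l] /cvgrPdist_lt /(_ (e / 2)); rewrite divr_gt0// => /(_ isT).
case=> M _ hM; exists M => m n Mm mn; rewrite sum_ord_diff//.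
have h1 := hM m Mm; have h2 := hM n (leq_trans Mm mn); rewrite /= in h1 h2.
by move/ltr_normlP: h1 => [h1 h1']; move/ltr_normlP: h2 => [h2 h2']; lra.
Qed.

End real_series.

Section completeness.
Context {R : realType} d (T : measurableType d) (nu : {measure set T -> \bar R}).
Local Notation H := (L2 nu).
Variables (v : nat -> T -> R[i]^o) (s : nat -> R).
Hypothesis hv : forall m, hset H (v m).
Hypothesis s0 : forall m, 0 <= s m.
Hypothesis vs : forall m n, (m <= n)%N ->
  sqn H (\sum_(m <= i < n) v i) <= \sum_(m <= i < n) s i.
Hypothesis sy : (\sum_(0 <= k <oo) (s k)%:E < +oo)%E.

Let S n := \sum_(k < n) v k.

Let hS n : hset H (S n).
Proof. by apply: hset_sum => //; exact: prehilbert_L2. Qed.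

Let SB m n : (m <= n)%N -> sqn H (S n - S m) <= \sum_(m <= i < n) s i.
Proof. by move=> mn; rewrite /S -sum_ord_diff//; exact: vs. Qed.

Let tail_index : exists phi : nat -> nat, (forall k, (phi k <= phi k.+1)%N) /\
  forall k m n, (phi k <= m)%N -> (m <= n)%N -> \sum_(m <= i < n) s i <= 4^-1 ^+ k.
Proof.
have /choice[psi hpsi] : forall k : nat, exists M, forall m n, (M <= m)%N -> (m <= n)%N ->
    \sum_(m <= i < n) s i <= 4^-1 ^+ k.
  by move=> k; apply: nneseries_tail => //; rewrite exprn_gt0.
(* Cumulative sums make the thresholds monotone and keep them above [psi k]. *)
exists (fun k => \sum_(j < k.+1) psi j)%N; split.
  by move=> k; rewrite [leqRHS]big_ord_recr/= leq_addr.
move=> k m n hm; apply: hpsi; apply: leq_trans hm.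
by rewrite big_ord_recr/= leq_addl.
Qed.

(** Along [phi] the increments [D k] have squared norm at most 4^-k, so the series [G] with weights
    2^k has integral at most the sum of the 2^-k. Off the null set where [G] is infinite, the
    increments are absolutely summable and the subsequence converges. *)
Let pointwise_limit : exists (E : set T) (f : T -> R[i]^o) (phi : nat -> nat),
  [/\ measurable E /\ nu (~` E) = 0%E, cmeas f,
    forall x, E x -> ccvg (fun k => S (phi k) x : R[i]) (f x : R[i]),
    forall k, (phi k <= phi k.+1)%N &
    forall k m n, (phi k <= m)%N -> (m <= n)%N -> \sum_(m <= i < n) s i <= 4^-1 ^+ k].
Proof.
have [phi [phin phis]] := tail_index.
pose D k : T -> R[i]^o := S (phi k.+1) - S (phi k).
have hD k : hset H (D k) by apply: hsetB => //; exact: prehilbert_L2.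
have DE k x : D k x = (S (phi k.+1) x : R[i]) - S (phi k) x by [].
have sD k : sqn H (D k) <= 4^-1 ^+ k.
  by apply: le_trans (SB (phin k)) _; exact: phis.
pose G x := (\sum_(0 <= k <oo) (2 ^+ k * cabs (D k x) ^+ 2)%:E)%E.
have G0 k x : (0 <= (2 ^+ k * cabs (D k x) ^+ 2)%:E)%E.
  by rewrite lee_fin; apply: mulr_ge0; [exact: exprn_ge0|exact: sqr_ge0].
have mGk k : measurable_fun setT (fun x => (2 ^+ k * cabs (D k x) ^+ 2)%:E).
  under eq_fun do rewrite EFinM; apply: measurable_funeM.
  by apply: measurable_cabs2; exact: L2_cmeas.
have mG : measurable_fun setT G by apply: ge0_emeasurable_sum.
have iG : (\int[nu]_x G x < +oo)%E.
  rewrite integral_nneseries//; apply: (@le_lt_trans _ _ (\sum_(0 <= k <oo) (2^-1 ^+ k)%:E)%E).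
    apply: lee_nneseries => // k _; first by rewrite integral_ge0.
    under eq_integral do rewrite EFinM.
    rewrite ge0_integralZl//; last 2 first.
    - by apply: measurable_cabs2; exact: L2_cmeas.
    - by move=> x _; rewrite lee_fin sqr_ge0.
    rewrite -sqn_L2// -EFinM lee_fin; apply: (@le_trans _ _ (2 ^+ k * 4^-1 ^+ k)).
      by rewrite ler_wpM2l// exprn_ge0.
    by rewrite -exprMn le_eqVlt; apply/orP; left; apply/eqP; congr (_ ^+ _); field.
  apply: (@nneseries_bounded_lty _ _ 2) => [k|n]; first by rewrite exprn_ge0.
  have : \sum_(k < n) 2^-1 ^+ k = 2 - 2 * 2^-1 ^+ n :> R.
    elim: n => [|n ih]; first by rewrite big_ord0 expr0 mulr1 subrr.
    by rewrite big_ord_recr/= ih exprS; field.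
  by move=> ->; rewrite gerBl mulr_ge0// exprn_ge0.
pose E := [set x | (G x < +oo)%E].
have mE : measurable E.
  rewrite -[E]setTI; exact: emeasurable_fun_infty_o.
have nE : nu (~` E) = 0%E.
  have iGG : nu.-integrable setT G.
    apply/integrableP; split => //; apply: le_lt_trans iG; apply: ge0_le_integral => //.
    - by apply: measurableT_comp.
    - by move=> x _; rewrite gee0_abs// nneseries_ge0.
  have [N [mN N0 hN]] := integrable_ae measurableT iGG.
  apply/eqP; rewrite eq_le measure_ge0 andbT -N0; apply: le_measure; rewrite ?inE//.
    exact: measurableC.
  move=> x Ex; apply: hN => /= /(_ I) hG; apply: Ex.
  by rewrite /E /= ltey_eq hG.
(* Cutting off by the indicator of [E] makes the sequence converge everywhere, so that the limit is
   measurable on the whole space. *)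
pose S' k x : R[i] := ((\1_E x : R)%:C)%C * S (phi k) x.
have mS' k : cmeas (S' k).
  apply: cmeasM; last exact: L2_cmeas.
  by split; [exact: measurable_indic|exact: measurable_cst].
have S'E k x : E x -> S' k x = S (phi k) x.
  by move=> Ex; rewrite /S' indicE mem_set// mul1r.
have S'N k x : ~ E x -> S' k x = 0.
  by move=> Ex; rewrite /S' indicE memNset// mul0r.
have S'cvg x : exists z, ccvg (fun k => S' k x) z.
  have [Ex|Ex] := pselect (E x); last first.
    by exists 0; under eq_fun do rewrite S'N//; exact: ccvg_cst.
  suff h (p : R[i] -> R) : (forall z w, p (z - w) = p z - p w) ->
      (forall z, `|p z| <= cabs z) -> cvgn (fun k => p (S' k x)).
    have /cvg_ex[a ha] := h _ (@cReB R) (@cabs_re R).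
    have /cvg_ex[b hb] := h _ (@cImB R) (@cabs_im R).
    by exists (Complex a b); apply/ccvgP.
  move=> pB pn.
  have sumD : cvgn (series (fun k => `|p (D k x)|)).
    have h0 k : 0 <= `|p (D k x)| by [].
    have -> : series (fun k => `|p (D k x)|) = (fun n => \sum_(k < n) `|p (D k x)|).
      by apply/funext => n; rewrite /series/= big_mkord.
    apply: (@cvg_series_nneseries R (fun k => `|p (D k x)|) h0).
    apply: (@nneseries_bounded_lty _ _ (2 + fine (G x))) => // n.
    apply: (@le_trans _ _ (\sum_(k < n) (2^-1 ^+ k + 2 ^+ k * cabs (D k x) ^+ 2))).
      apply: ler_sum => k _; apply: le_trans (pn _) _.
      (* Divided by 2^k, this square gives 2 |D| <= 2^-k + 2^k |D|^2, and both terms are summable at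
         [x]. *)
      have := sqr_ge0 (1 - 2 ^+ k * cabs (D k x)).
      have k0 : (0 : R) < 2 ^+ k by rewrite exprn_gt0.
      have -> : 2^-1 ^+ k = (2 ^+ k)^-1 :> R by rewrite exprVn.
      rewrite -(pmulr_rge0 _ (_ : 0 < (2 ^+ k)^-1)) ?invr_gt0//.
      have -> : (2 ^+ k)^-1 * (1 - 2 ^+ k * cabs (D k x)) ^+ 2 =
         (2 ^+ k)^-1 + 2 ^+ k * cabs (D k x) ^+ 2 - 2 * cabs (D k x) by field; rewrite gt_eqF.
      by have := cabs_ge0 (D k x); lra.
    rewrite big_split/= lerD//.
      have : \sum_(k < n) 2^-1 ^+ k = 2 - 2 * 2^-1 ^+ n :> R.
        elim: n => [|n ih]; first by rewrite big_ord0 expr0 mulr1 subrr.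
        by rewrite big_ord_recr/= ih exprS; field.
      by move=> ->; rewrite gerBl mulr_ge0// exprn_ge0.
    apply: (@nneseries_partial_le _ (fun k => 2 ^+ k * cabs (D k x) ^+ 2)); last exact: Ex.
    by move=> k; rewrite -lee_fin.
  have /normed_cvg := sumD.
  have -> : series (fun k => p (D k x)) = (fun k => p (S' k x) - p (S' 0%N x)).
    apply/funext => k; rewrite /series/=; elim: k => [|k ih].
      by rewrite big_geq// subrr.
    by rewrite big_nat_recr//= ih DE pB !S'E//; ring.
  move=> hc; rewrite (_ : (fun k => p (S' k x)) =
      (fun k => p (S' k x) - p (S' 0%N x)) + (fun=> p (S' 0%N x))); last first.
    by apply/funext => k; rewrite [RHS]subrK.
  by apply: is_cvgD => //; exact: is_cvg_cst.
have /choice[f hf] := S'cvg.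
exists E, f, phi; split => //.
- split; [apply: (@measurable_fun_cvg _ _ _ _ (fun k x => Re (S' k x)))|
          apply: (@measurable_fun_cvg _ _ _ _ (fun k x => Im (S' k x)))].
  + by move=> k; have [] := mS' k.
  + by move=> x _; have /ccvgP[] := hf x.
  + by move=> k; have [] := mS' k.
  + by move=> x _; have /ccvgP[] := hf x.
- by move=> x Ex; have := hf x; under eq_fun do rewrite S'E//.
Qed.

(** Riesz-Fischer. The almost everywhere limit of a subsequence is also the limit in norm: by Fatou,
    the distance from [S n] to it is at most the lower limit of the distances from [S n] to the
    terms of the subsequence. *)
Lemma L2_series_cvg : exists f, hset H f /\
  (fun n => sqn H (\sum_(k < n) v k - f)) @ \oo --> 0.
Proof.
have [E [f [phi [[mE nE] mf fE phin phis]]]] := pointwise_limit.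
have key n k : (phi k <= n)%N ->
    (\int[nu]_x (cabs ((S n - f) x) ^+ 2)%:E <= (4^-1 ^+ k)%:E)%E.
  move=> kn.
  (* The indicator of [E] gives convergence in [j] at every point, and does not affect the integral
     of the limit because [E] has full measure. *)
  pose F j x := ((\1_E x) * cabs ((S n - S (phi j)) x) ^+ 2)%:E.
  have F0 j x : (0 <= F j x)%E by rewrite lee_fin mulr_ge0 ?sqr_ge0.
  have hSS j : hset H (S n - S (phi j)) by apply: hsetB => //; exact: prehilbert_L2.
  have mF j : measurable_fun setT (F j).
    apply/measurable_EFinP; apply: measurable_funM; first exact: measurable_indic.
    by apply: measurable_funX; apply: measurable_cabs; exact: L2_cmeas.
  have Fcvg x : E x -> F ^~ x @ \oo --> (cabs ((S n - f) x) ^+ 2)%:E.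
    move=> Ex; apply: cvg_EFin; first exact: nearW.
    rewrite (_ : fine \o F ^~ x = fun j => cabs ((S n - S (phi j)) x) ^+ 2); last first.
      by apply/funext => j; rewrite /F /= indicE mem_set// mul1r.
    have h : (fun j => cabs ((S n - S (phi j)) x)) @ \oo --> cabs ((S n - f) x).
      apply/cvgrPdist_lt => e e0; have /cvgrPdist_lt/(_ _ e0) := fE _ Ex.
      apply: filterS => j /=; rewrite sub0r normrN ger0_norm ?cabs_ge0//; apply: le_lt_trans.
      have e1 : cabs ((S n - f) x) - cabs ((S n - S (phi j)) x) <= cabs ((S (phi j) x : R[i]) - f x).
        apply: le_trans (cabs_leB _ _) _.
        rewrite le_eqVlt; apply/orP; left; apply/eqP; congr cabs.
        change (((S n x : R[i]) - f x) - ((S n x : R[i]) - S (phi j) x) = (S (phi j) x : R[i]) - f x); ring.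
      have e2 : cabs ((S n - S (phi j)) x) - cabs ((S n - f) x) <= cabs ((S (phi j) x : R[i]) - f x).
        apply: le_trans (cabs_leB _ _) _; rewrite cabs_subC.
        rewrite le_eqVlt; apply/orP; left; apply/eqP; congr cabs.
        change (((S n x : R[i]) - f x) - ((S n x : R[i]) - S (phi j) x) = (S (phi j) x : R[i]) - f x); ring.
      by rewrite ler_norml e1 andbT lerNl opprB.
    by under eq_fun do rewrite expr2; rewrite expr2; apply: cvgM.
  have Fcvg' x : F ^~ x @ \oo --> ((\1_E x) * cabs ((S n - f) x) ^+ 2)%:E.
    have [Ex|Ex] := pselect (E x); first by rewrite indicE mem_set// mul1r; exact: Fcvg.
    by rewrite /F indicE memNset// mul0r; under eq_fun do rewrite mul0r; exact: cvg_cst.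
  have mSf : cmeas ((S n - f) : T -> R[i]) by apply: cmeasB => //; exact: L2_cmeas.
  have le1 : (\int[nu]_x (cabs ((S n - f) x) ^+ 2)%:E <= \int[nu]_x limn_einf (fun j => F (j + k)%N x))%E.
    rewrite [leRHS](eq_integral (fun x => ((\1_E x) * cabs ((S n - f) x) ^+ 2)%:E)); last first.
      move=> x _; have h : (fun j => F (j + k)%N x) @ \oo --> ((\1_E x) * cabs ((S n - f) x) ^+ 2)%:E.
        by rewrite (cvg_shiftn k (F^~ x)); exact: Fcvg'.
      have hc : cvgn (fun j => F (j + k)%N x) by apply/cvg_ex; eexists; exact: h.
      by rewrite (is_cvg_limn_einfE hc); exact/cvg_lim.
    rewrite le_eqVlt; apply/orP; left; apply/eqP; apply: ae_eq_integral => //.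
    - exact: measurable_cabs2.
    - apply/measurable_EFinP; apply: measurable_funM; first exact: measurable_indic.
      by apply: measurable_funX; exact: measurable_cabs.
    - exists (~` E); split => //; first exact: measurableC.
      move=> x /= nx Ex; apply: nx => _.
      by rewrite indicE mem_set// mul1r.
  apply: le_trans le1 _.
  apply: le_trans (fatou _ measurableT (fun j => mF (j + k)%N) (fun j x _ => F0 (j + k)%N x)) _.
  have phile j : (phi k <= phi (j + k)%N)%N.
    by elim: j => // j ih; apply: leq_trans ih (phin _).
  have Fle j : (\int[nu]_x F (j + k)%N x <= (4^-1 ^+ k)%:E)%E.
    apply: (@le_trans _ _ (sqn H (S n - S (phi (j + k)%N)))%:E).
      rewrite sqn_L2//; apply: ge0_le_integral => //.
      - by apply: measurable_cabs2; exact: L2_cmeas.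
      - by move=> x _; rewrite lee_fin ler_piMl ?sqr_ge0//.
    rewrite lee_fin; have [nj|jn] := leqP n (phi (j + k)%N).
      rewrite -opprB sqnN; [|exact: prehilbert_L2|by apply: hsetB => //; exact: prehilbert_L2].
      by apply: le_trans (SB nj) _; exact: phis.
    by apply: le_trans (SB (ltnW jn)) _; apply: phis => //; exact: ltnW.
  rewrite limn_einf_lim; apply: lime_le; first exact: is_cvg_einfs.
  apply: nearW => j; apply: le_trans (Fle j); rewrite /einfs/=.
  by apply: ereal_inf_lbound; exists j => //=.
have mSf n : cmeas ((S n - f) : T -> R[i]) by apply: cmeasB => //; exact: L2_cmeas.
have hSf : hset H (S (phi 0%N) - f).
  by apply/L2P; split => //; apply: le_lt_trans (key _ 0%N (leqnn _)) _; exact: ltry.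
have hf : hset H f.
  rewrite -[f](subKr (S (phi 0%N))); apply: hsetB => //; exact: prehilbert_L2.
exists f; split => //; apply/cvgrPdist_le => e e0.
have [k _ hk] : \forall k \near \oo, 4^-1 ^+ k <= e :> R.
  have : GRing.exp (4^-1 : R) @ \oo --> 0 by apply: cvg_expr; rewrite ger0_norm// invf_lt1// ltr1n.
  move=> /cvgrPdist_le/(_ _ e0); apply: filterS => k.
  by rewrite sub0r normrN ger0_norm// exprn_ge0.
exists (phi k) => // n /= kn; have hn : hset H (S n - f) by apply: hsetB => //; exact: prehilbert_L2.
rewrite sub0r normrN ger0_norm; last by apply: sqn_ge0 => //; exact: prehilbert_L2.
apply: le_trans (hk k (leqnn k)); rewrite -lee_fin sqn_L2//; exact: key.
Qed.

End completeness.

(** * Trajectories and the one-variable transform *)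

Lemma sum_recr (V : nmodType) (F : nat -> V) n :
  \sum_(k < n.+1) F k = \sum_(k < n) F k + F n.
Proof. by rewrite big_ord_recr. Qed.

Section characters.
Context {R : realType}.
Local Notation RB := (measurableTypeR R).

Definition ebar : RB -> R[i]^o := fun x => cexpi (- (2 * pi * x)).
Definition echi : RB -> R[i]^o := fun x => cexpi (2 * pi * x).

Lemma echiK x : (echi x : R[i]) * ebar x = 1. Proof. exact: cexpiKN. Qed.
Lemma ebarK x : (ebar x : R[i]) * echi x = 1. Proof. exact: cexpiNK. Qed.
Lemma ebarJ x : ((ebar x : R[i])^*)%C = echi x. Proof. by rewrite cexpiJ opprK. Qed.
Lemma echiJ x : ((echi x : R[i])^*)%C = ebar x. Proof. by rewrite cexpiJ. Qed.
Lemma cabs_ebar x : cabs (ebar x) = 1. Proof. exact: cabs_cexpi. Qed.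
Lemma cabs_echi x : cabs (echi x) = 1. Proof. exact: cabs_cexpi. Qed.

Lemma cmeas_echi : cmeas echi.
Proof. by apply: cmeas_cexpi; exact: measurable_funM. Qed.

Lemma cmeas_ebar : cmeas ebar.
Proof.
have -> : ebar = (fun x => ((echi x : R[i])^*)%C) by apply/funext => x; rewrite echiJ.
exact: cmeasJ cmeas_echi.
Qed.

Lemma cmeas_char_e n : cmeas (char_e n : RB -> R[i]).
Proof. by apply: cmeas_cexpi; exact: measurable_funM. Qed.

Lemma char_e0 : char_e 0 = (fun=> 1) :> (RB -> R[i]^o).
Proof. by apply/funext => x; rewrite /char_e mulr0 mul0r cexpi0. Qed.

Lemma char_eS n x : (char_e n.+1 x : R[i]) = (echi x : R[i]) * char_e n x.
Proof. by rewrite /char_e /echi -cexpiD; congr cexpi; rewrite -natr1; ring. Qed.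

Lemma cabs_webar (w : R[i]) x : cabs (w * ebar x) = cabs w.
Proof. by rewrite normcM cabs_ebar mulr1. Qed.

Lemma cauchy_kernel_den (w : R[i]) x : cabs w < 1 -> 1 - w * ebar x != 0.
Proof.
move=> w1; rewrite subr_eq0; apply/eqP => h; move: w1.
by rewrite -(cabs_webar w x) -h normc1 ltxx.
Qed.

Lemma cauchy_kernel_mul (w : R[i]) x : cabs w < 1 ->
  (echi x : R[i]) * cauchy_kernel w x = echi x + w * cauchy_kernel w x.
Proof.
move=> w1; rewrite /cauchy_kernel -/(ebar x); apply: (mulIf (cauchy_kernel_den x w1)).
rewrite mulrDl -!mulrA mulVf ?cauchy_kernel_den// !mulr1 mulrBr mulr1.
by rewrite [_ * (w * _)]mulrCA [(echi x : R[i]) * _]echiK mulr1 subrK.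
Qed.

Lemma cabs_cauchy_kernel (w : R[i]) x : cabs w < 1 ->
  cabs (cauchy_kernel w x) <= (1 - cabs w)^-1.
Proof.
move=> w1; rewrite /cauchy_kernel -/(ebar x) normcV.
have h : 1 - cabs w <= cabs (1 - w * ebar x).
  by have := cabs_leB 1 (w * ebar x); rewrite normc1 cabs_webar.
by rewrite lef_pV2// posrE ?subr_gt0// (lt_le_trans _ h)// subr_gt0.
Qed.

Lemma cmeas_cauchy_kernel (w : R[i]) : cmeas (cauchy_kernel w : RB -> R[i]).
Proof.
apply: cmeasV; apply: cmeasB; first exact: cmeas_cst.
by apply: cmeasM; [exact: cmeas_cst|exact: cmeas_ebar].
Qed.

(* The right-hand side is the Poisson kernel. *)
Lemma Re_cauchy_kernel (w : R[i]) x : cabs w < 1 ->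
  2 * Re (cauchy_kernel w x) - 1 = (1 - cabs w ^+ 2) * cabs (cauchy_kernel w x) ^+ 2.
Proof.
move=> w1; have := cauchy_kernel_den x w1.
rewrite /cauchy_kernel -/(ebar x) -(cabs_webar w x); set z := w * _ => z0.
rewrite normcV exprVn.
have n0 : cabs (1 - z) ^+ 2 != 0.
  by rewrite sqrf_eq0; apply: contra z0 => /eqP/eq0_normc ->.
have -> : Re (1 - z)^-1 = Re (1 - z) / cabs (1 - z) ^+ 2.
  have -> : (1 - z)^-1 = ((cabs (1 - z) ^- 2)%:C)%C * ((1 - z)^*)%C.
    apply: (mulfI z0); rewrite mulfV// mulrCA mulCJ -[RHS]rmorphM mulVf ?rmorph1//.
  by rewrite cReM/= mul0r subr0 cReJ mulrC.
move: n0; rewrite !cabs_sqr !cReB !cImB/=; move: (Re z) (Im z) => a b; rewrite sub0r => n0.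
by field.
Qed.

(** The Poisson kernel is nonnegative. The bound survives averaging and keeps the denominators of
    [V1] and of the inner function away from 0. *)
Lemma Re_cauchy_kernel_ge (w : R[i]) x : cabs w < 1 -> 2^-1 <= Re (cauchy_kernel w x).
Proof.
move=> w1; have := Re_cauchy_kernel x w1.
have : 0 <= (1 - cabs w ^+ 2) * cabs (cauchy_kernel w x) ^+ 2.
  apply: mulr_ge0; last exact: sqr_ge0.
  by rewrite subr_ge0 exprn_ile1 ?cabs_ge0// ltW.
by move=> h1 h2; lra.
Qed.

End characters.

Section dynamics.
Context {R : realType}.
Local Notation RB := (measurableTypeR R).
Variable nu : {measure set RB -> \bar R}.

(* [V1] turns [cstep 0] into the backward shift; the input [a] is what makes the
   trajectories starting at 0 compute multiplication by the inner function. *)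
Definition cstep (a : R[i]) (f : RB -> R[i]^o) : RB -> R[i]^o :=
  fun x => (ebar x : R[i]) * (f x - cintegral nu f + a).

(** The adjoint of [cstep 0] (see [hdot_cstep0]); its iterates on the constant 1 are the auxiliary
    functions (see [auxiliary_iter]). *)
Definition pstep (f : RB -> R[i]^o) : RB -> R[i]^o :=
  fun x => (echi x : R[i]) * f x - cintegral nu (fun x => (echi x : R[i]) * f x).

Fixpoint traj (f : RB -> R[i]^o) (l : nat -> R[i]) (n : nat) : RB -> R[i]^o :=
  if n is m.+1 then cstep (l m) (traj f l m) else f.

Definition out f l n : R[i] := cintegral nu (traj f l n).

Definition coef f n := out f (fun=> 0) n.

(** The impulse response of the system: an input 1 at time 0 turns the zero state into [ebar], whose
    outputs are read from the next time on. These are the Taylor coefficients of the inner function,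
    and the value at index 0 reflects b(0) = 0. *)
Definition bcoef n : R[i] := if n is m.+1 then coef ebar m else 0.

Definition conv (l : nat -> R[i]) n := \sum_(k < n.+1) bcoef k * l (n - k)%N.

Hypothesis nu1 : nu setT = 1%E.
Local Notation H := (L2 nu).
Let PH : prehilbert H := prehilbert_L2 nu.

Lemma L2_ebar_mul f : hset H f -> hset H (fun x => (ebar x : R[i]) * f x).
Proof.
move=> hf; have [] // := L2_bounded_mul cmeas_ebar (M := 1) _ hf.
by move=> x; rewrite cabs_ebar.
Qed.

Lemma L2_echi_mul f : hset H f -> hset H (fun x => (echi x : R[i]) * f x).
Proof.
move=> hf; have [] // := L2_bounded_mul cmeas_echi (M := 1) _ hf.
by move=> x; rewrite cabs_echi.
Qed.

Lemma L2_ebar : hset H ebar.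
Proof. by apply: (L2_bounded nu1 (M := 1)); [exact: cmeas_ebar|move=> x; rewrite cabs_ebar]. Qed.

Lemma L2_addc f (z : R[i]) : hset H f -> hset H (fun x => (f x : R[i]) + z).
Proof. by move=> hf; apply: (hsetD PH) => //; exact: L2_cst. Qed.

Lemma L2_cstep a f : hset H f -> hset H (cstep a f).
Proof. by move=> hf; apply: L2_ebar_mul; do 2 apply: L2_addc. Qed.

Lemma L2_traj f l n : hset H f -> hset H (traj f l n).
Proof. by move=> hf; elim: n => //= n ih; exact: L2_cstep. Qed.

Lemma L2_pstep f : hset H f -> hset H (pstep f).
Proof. by move=> hf; apply: L2_addc; exact: L2_echi_mul. Qed.

(** Multiplication by [ebar] is unitary, so a step only replaces the mean of the state by the input;
    the centred part is orthogonal to constants. *)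
Lemma hdot_cstep a b f g : hset H f -> hset H g ->
  hdot H (cstep a f) (cstep b g) =
  hdot H f g - cintegral nu f * ((cintegral nu g)^*)%C + a * (b^*)%C.
Proof.
move=> hf hg.
have -> : hdot H (cstep a f) (cstep b g) =
    hdot H (fun x => (f x : R[i]) + (a - cintegral nu f)) (fun x => (g x : R[i]) + (b - cintegral nu g)).
  rewrite /=; congr cintegral; apply/funext => x; rewrite /cstep cJM ebarJ.
  by rewrite mulrACA [(ebar x : R[i]) * _]ebarK mul1r -!addrA ![- _ + _]addrC.
have h1 z : hset H (fun=> z) by exact: L2_cst.
have dc f' z : hset H f' -> hdot H f' (fun=> z) = (z^*)%C * cintegral nu f'.
  move=> hf'; rewrite -hdot_cst1 -hdotZr//; congr hdot; apply/funext => x.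
  exact: (esym (mulr1 (z : R[i]))).
rewrite (hdotDl PH (f := f) (g := fun=> (a - cintegral nu f)))//; last exact: L2_addc.
rewrite (hdotDr PH (f := g) (g := fun=> (b - cintegral nu g)))//.
rewrite (hdotDr PH (f := g) (g := fun=> (b - cintegral nu g)))//.
rewrite (dc f)// (dc (fun=> _))// cintegral_cst//.
rewrite (ph_dotJ PH hg (h1 _)) (dc g)// cJM conjcK !cJB; ring.
Qed.

(** Telescoping of [hdot_cstep]. Bessel's inequality, the boundedness of the states, the isometry of
    [V1] and the orthogonality of its range to the multiples of [b] are all read off from this
    balance. *)
Lemma traj_dot f g l l' N : hset H f -> hset H g ->
  \sum_(n < N) out f l n * ((out g l' n)^*)%C =
  hdot H f g - hdot H (traj f l N) (traj g l' N) + \sum_(n < N) l n * ((l' n)^*)%C.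
Proof.
move=> hf hg; elim: N => [|N ih]; first by rewrite !big_ord0 subrr addr0.
rewrite (sum_recr (fun n => out f l n * ((out g l' n)^*)%C)) (sum_recr (fun n => l n * ((l' n)^*)%C)) ih.
rewrite -[traj f l N.+1]/(cstep (l N) (traj f l N)) -[traj g l' N.+1]/(cstep (l' N) (traj g l' N)).
rewrite hdot_cstep; try exact: L2_traj.
rewrite -/(out f l N) -/(out g l' N); ring.
Qed.

Lemma traj_sqn f l N : hset H f ->
  \sum_(n < N) cabs (out f l n) ^+ 2 =
  sqn H f - sqn H (traj f l N) + \sum_(n < N) cabs (l n) ^+ 2.
Proof.
move=> hf; have := @traj_dot f f l l N hf hf.
rewrite !hdot_self//; last exact: L2_traj.
under eq_bigr do rewrite mulCJ; under [in RHS]eq_bigr do rewrite mulCJ.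
rewrite -!rmorph_sum -rmorphB -rmorphD => /(congr1 (@complex.Re R)) //.
Qed.

Lemma bessel_coef f N : hset H f -> \sum_(n < N) cabs (coef f n) ^+ 2 <= sqn H f.
Proof.
move=> hf; rewrite traj_sqn// big1 ?addr0; last by move=> i _; rewrite normc0 expr0n.
by rewrite gerBl; apply: (sqn_ge0 PH); exact: L2_traj.
Qed.

Lemma sqn_traj_le f l N : hset H f ->
  sqn H (traj f l N) <= sqn H f + \sum_(n < N) cabs (l n) ^+ 2.
Proof.
move=> hf; have := traj_sqn l N hf.
have : 0 <= \sum_(n < N) cabs (out f l n) ^+ 2 by apply: sumr_ge0 => i _; exact: sqr_ge0.
by move=> h1 h2; move: h1; rewrite h2 addrAC subr_ge0.
Qed.

Lemma sqn_ebar : sqn H ebar = 1.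
Proof.
apply: EFin_inj; rewrite sqn_L2; last exact: L2_ebar.
under eq_integral do rewrite cabs_ebar expr1n.
by rewrite integral_cst// nu1 mul1e.
Qed.

Lemma bcoef_sqr_le N : \sum_(n < N) cabs (bcoef n) ^+ 2 <= 1.
Proof.
case: N => [|N]; first by rewrite big_ord0.
rewrite big_ord_recl [bcoef _]/= normc0 expr0n add0r -sqn_ebar.
exact: bessel_coef L2_ebar.
Qed.

Lemma cabs_bcoef n : cabs (bcoef n) <= 1.
Proof.
rewrite -(@ler_pXn2r _ 2)// ?nnegrE ?cabs_ge0// expr1n.
apply: le_trans (bcoef_sqr_le n.+1); rewrite big_ord_recr/= lerDr.
by apply: sumr_ge0 => i _; exact: sqr_ge0.
Qed.

Lemma cstepD a b f g : hset H f -> hset H g ->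
  cstep (a + b) (f + g) = cstep a f + cstep b g.
Proof.
move=> hf hg; apply/funext => x.
have -> : (cstep a f + cstep b g) x = (cstep a f x : R[i]) + cstep b g x by [].
rewrite /cstep -mulrDr; congr (_ * _).
have -> : cintegral nu (f + g) = cintegral nu f + cintegral nu g.
  by rewrite -cintegralD//; exact: L2_cintg.
have -> : (f + g) x = (f x : R[i]) + g x by []. by ring.
Qed.

Lemma cstepZ a c f : hset H f -> cstep (c * a) (c *: f) = c *: cstep a f.
Proof.
move=> hf; apply/funext => x.
have -> : (c *: cstep a f) x = c * (cstep a f x : R[i]) by [].
rewrite /cstep mulrCA; congr (_ * _).
have -> : cintegral nu (c *: f) = c * cintegral nu f by rewrite -cintegralZ//; exact: L2_cintg.
have -> : (c *: f) x = c * (f x : R[i]) by []. by ring.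
Qed.

Lemma trajD f g l l' n : hset H f -> hset H g ->
  traj (f + g) (fun k => l k + l' k) n = traj f l n + traj g l' n.
Proof.
move=> hf hg; elim: n => //= n ->; rewrite cstepD//; exact: L2_traj.
Qed.

Lemma trajZ c f l n : hset H f -> traj (c *: f) (fun k => c * l k) n = c *: traj f l n.
Proof. by move=> hf; elim: n => //= n ->; rewrite cstepZ//; exact: L2_traj. Qed.

Lemma coefZ c f n : hset H f -> coef (c *: f) n = c * coef f n.
Proof.
move=> hf; rewrite /coef /out -cintegralZ; last by apply: L2_cintg => //; exact: L2_traj.
congr cintegral; rewrite -[RHS]/(c *: traj f (fun=> 0) n) -trajZ//.
by congr traj; apply/funext => k; rewrite mulr0.
Qed.

Lemma traj_shift f l n : traj f l n.+1 = traj (cstep (l 0%N) f) (fun k => l k.+1) n.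
Proof. by elim: n => //= n ih; rewrite -ih. Qed.

Lemma traj0_zero n : traj 0 (fun=> 0) n = 0.
Proof.
elim: n => //= n ->; apply/funext => x; rewrite /cstep (cintegral_cst nu1 0).
by rewrite subr0 addr0 mulr0.
Qed.

(** The system is linear and time invariant: after one step, the first input has become the state
    [l 0 *: ebar] running without input, and the remaining inputs act on the zero state, one unit of
    time later. *)
Lemma out_conv l n : out 0 l n = conv l n.
Proof.
rewrite /conv; elim: n l => [|n ih] l.
  by rewrite big_ord_recl big_ord0 /= mul0r addr0 /out/= (cintegral_cst nu1 0).
rewrite /out traj_shift.
have -> : cstep (l 0%N) 0 = l 0%N *: ebar + 0.
  rewrite addr0; apply/funext => x; rewrite /cstep (cintegral_cst nu1 0).
  by rewrite [0 x]/(0 : R[i]) subr0 add0r mulrC.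
have hb := hsetZ PH (l 0%N) L2_ebar.
rewrite (_ : (fun k => l k.+1) = (fun k => 0 + l k.+1)); last by apply/funext => k; rewrite add0r.
rewrite trajD//; last exact: ph0.
rewrite (cintegralD (f := traj _ _ n) (g := traj 0 _ n)); first last.
- by apply: L2_cintg => //; apply: L2_traj; exact: ph0.
- by apply: L2_cintg => //; apply: L2_traj.
rewrite -[X in _ + X]/(out 0 (fun k => l k.+1) n) ih.
rewrite -[X in X + _]/(coef (l 0%N *: ebar) n) coefZ//; last exact: L2_ebar.
rewrite [RHS]big_ord_recr/= subnn addrC mulrC; congr (_ + _).
by apply: eq_bigr => k _; rewrite subSn// -ltnS.
Qed.

(** A Taylor expansion with explicit remainder; C is the kernel mean. As N grows, zero input gives C
    times the series of the outputs of [f], hence the formula for [V1]; zero initial state gives C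
    times the output series = (C - 1) times the input series, hence b = 1 - 1/C. *)
Lemma traj_kernel f l (w : R[i]) N : cabs w < 1 -> hset H f ->
  let C := cintegral nu (cauchy_kernel w) in
  cintegral nu (fun x => (f x : R[i]) * cauchy_kernel w x) =
  C * \sum_(n < N) out f l n * w ^+ n - (C - 1) * \sum_(n < N) l n * w ^+ n +
  w ^+ N * cintegral nu (fun x => (traj f l N x : R[i]) * cauchy_kernel w x).
Proof.
move=> w1 hf C; elim: N => [|N ih]; first by rewrite !big_ord0 !mulr0 subr0 add0r mul1r.
have hX n := L2_traj l n hf.
have ik g : hset H g -> cintg nu (fun x => (g x : R[i]) * cauchy_kernel w x).
  move=> hg; apply: (L2_cintg nu1).
  have [] := L2_bounded_mul (cmeas_cauchy_kernel w) (fun x => cabs_cauchy_kernel x w1) hg.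
  by under eq_fun do rewrite mulrC.
have i1 : cintg nu (cauchy_kernel w).
  apply: (L2_cintg nu1); apply: (L2_bounded nu1) (cmeas_cauchy_kernel w) (fun x => cabs_cauchy_kernel x w1).
rewrite (sum_recr (fun n => out f l n * w ^+ n)) (sum_recr (fun n => l n * w ^+ n)) ih.
(* The state is the constant [out - l] plus a rest u = echi times the next state. By
   [cauchy_kernel_mul], u times the kernel is u plus w times the next state times the kernel, and u
   has mean [l N]. *)
have e1 : (fun x => (traj f l N x : R[i]) * cauchy_kernel w x) =
   (fun x => (out f l N - l N) * cauchy_kernel w x +
     ((traj f l N x - out f l N + l N) + w * ((traj f l N.+1 x : R[i]) * cauchy_kernel w x))).
  apply/funext => x; rewrite [traj f l N.+1 x]/= /cstep -/(out f l N).
  set u := traj f l N x - out f l N + l N.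
  have -> : (traj f l N x : R[i]) = out f l N - l N + u by rewrite /u; ring.
  rewrite mulrDl; congr (_ + _).
  have -> : u * cauchy_kernel w x = u * ebar x * ((echi x : R[i]) * cauchy_kernel w x).
    by rewrite mulrA -(mulrA u) [(ebar x : R[i]) * echi x]ebarK mulr1.
  by rewrite cauchy_kernel_mul// mulrDr -(mulrA u) [(ebar x : R[i]) * echi x]ebarK mulr1; ring.
rewrite [in X in _ + X = _]e1 cintegralD; last 2 first.
- exact: cintgZ.
- apply: cintgD; last by apply: cintgZ; apply: ik; exact: (hX N.+1).
  by apply: (L2_cintg nu1); do 2 apply: L2_addc.
rewrite cintegralZ// -/C cintegralD; last 2 first.
- by apply: (L2_cintg nu1); do 2 apply: L2_addc.
- by apply: cintgZ; apply: ik; exact: (hX N.+1).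
rewrite cintegralZ; last by apply: ik; exact: (hX N.+1).
have -> : cintegral nu (fun x => traj f l N x - out f l N + l N) = l N.
  under eq_fun do rewrite -addrA.
  rewrite cintegralD; [|exact: L2_cintg|by apply: (L2_cintg nu1); exact: L2_cst].
  by rewrite cintegral_cst// -/(out f l N); ring.
by rewrite exprSr; ring.
Qed.

End dynamics.

(** * Power series on the unit disc *)

Section complex_series.
Context {R : realType}.
Implicit Types (u d h : nat -> R[i]) (s : nat -> R).

Lemma csum_abs_cvg u s : (forall n, cabs (u n) <= s n) ->
  (\sum_(0 <= n <oo) (s n)%:E < +oo)%E -> csum_to u (csum u).
Proof.
move=> us sy.
have s0 n : 0 <= s n by apply: le_trans (us n); exact: cabs_ge0.
have key (p : R[i] -> R) : (forall z, `|p z| <= cabs z) -> cvgn (series (fun n => p (u n))).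
  move=> hp; suff : cvgn (series (fun n => `|p (u n)|)) by move/normed_cvg.
  have h0 k : 0 <= `|p (u k)| by [].
  have -> : series (fun n => `|p (u n)|) = (fun n => \sum_(k < n) `|p (u k)|).
    by apply/funext => n; rewrite /series/= big_mkord.
  apply: (@cvg_series_nneseries R (fun k => `|p (u k)|) h0).
  apply: le_lt_trans sy; apply: lee_nneseries => // n _.
  by rewrite lee_fin; exact: le_trans (hp _) (us n).
by split; [exact: key (@cabs_re R)|exact: key (@cabs_im R)].
Qed.

Lemma ccvg_bounded (v : nat -> R[i]) (l : R[i]) : ccvg v l -> exists M, forall n, cabs (v n) <= M.
Proof.
move=> /cvgrPdist_le/(_ 1 ltr01) [N _ hN].
exists (cabs l + 1 + \sum_(n < N) cabs (v n)) => n.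
have sN : 0 <= \sum_(n < N) cabs (v n) by apply: sumr_ge0 => i _; exact: cabs_ge0.
have [nN|Nn] := ltnP n N.
  rewrite (bigD1 (Ordinal nN))//=.
  have : 0 <= \sum_(i < N | i != Ordinal nN) cabs (v i) by apply: sumr_ge0 => i _; exact: cabs_ge0.
  by have := cabs_ge0 l; move: (\sum_(_ < _ | _) _) (cabs _) (cabs _) => x y z; lra.
have := hN n Nn; rewrite /= sub0r normrN ger0_norm ?cabs_ge0// => h.
have := cabs_leB (v n) l; move: h sN (cabs_ge0 l).
by move: (cabs _) (\sum_(_ < _) _) (cabs _) (cabs _) => x y z t; lra.
Qed.

(** Convergence at 1/2 bounds the coefficients by 2 M 2^n. For t <= 1/4 the ratio 2t is at most 1/2,
    so the series without its head is at most 2 M (2t) 2 = 8 M t, which tends to 0 with t. *)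
Let pseries_zero_head d :
  (forall t : R, 0 < t -> t < 1 -> ccvg (fun N => \sum_(n < N) d n * ((t%:C)%C) ^+ n) 0) ->
  d 0%N = 0.
Proof.
move=> hd; have h2 : 0 < 2^-1 :> R by [].
have h2' : 2^-1 < 1 :> R by rewrite invf_lt1// ltr1n.
have [M hM] := ccvg_bounded (hd _ h2 h2').
have M0 : 0 <= M by apply: le_trans (hM 0%N); exact: cabs_ge0.
have dM n : cabs (d n) <= 2 * M * 2 ^+ n.
  have := hM n.+1; rewrite (sum_recr (fun k => d k * ((2^-1 : R)%:C)%C ^+ k)) => h.
  have : cabs (d n * ((2^-1 : R)%:C)%C ^+ n) <= 2 * M.
    rewrite (_ : d n * _ = (\sum_(k < n) d k * ((2^-1 : R)%:C)%C ^+ k +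
       d n * ((2^-1 : R)%:C)%C ^+ n) - \sum_(k < n) d k * ((2^-1 : R)%:C)%C ^+ k); last by ring.
    by apply: le_trans (le_normcD _ _) _; rewrite normcN mulr_natl mulr2n lerD.
  rewrite normcM cabsX cabs_real ger0_norm// exprVn.
  by rewrite ler_pdivrMr ?exprn_gt0.
have key t : 0 < t -> t <= 4^-1 -> cabs (d 0%N) <= 8 * M * t.
  move=> t0 t4; have t1 : t < 1 by apply: le_lt_trans t4 _; rewrite invf_lt1// ltr1n.
  have tail N : cabs (\sum_(n < N) d n.+1 * ((t%:C)%C) ^+ n.+1) <= 8 * M * t.
    apply: le_trans (cabs_sum _ _ _) _.
    have : \sum_(n < N) (2 * M) * (2 * t) ^+ n.+1 <= 8 * M * t - 8 * M * t * 2^-1 ^+ N.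
      elim: N => [|N ih]; first by rewrite big_ord0 expr0 mulr1 subrr.
      rewrite (sum_recr (fun n => 2 * M * (2 * t) ^+ n.+1)).
      have : (2 * t) ^+ N.+1 <= 2 * t * 2^-1 ^+ N.
        rewrite exprS ler_wpM2l//; first by rewrite mulr_ge0// ltW.
        by apply: lerXn2r; rewrite ?nnegrE ?mulr_ge0//; lra.
      have M2 : 0 <= 2 * M by rewrite mulr_ge0.
      move=> /(ler_wpM2l M2) hh; rewrite [in leRHS]exprS; move: ih hh; set S := \sum_(_ < _) _.
      by move: (2^-1 ^+ N) ((2 * t) ^+ N.+1) => q r; lra.
    move=> h; apply: le_trans (_ : _ <= 8 * M * t - 8 * M * t * 2^-1 ^+ N) _; last first.
      by rewrite gerBl !mulr_ge0// ?exprn_ge0// ltW.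
    apply: le_trans h; apply: ler_sum => n _.
    rewrite normcM cabsX cabs_real ger0_norm ?(ltW t0)// exprMn mulrA.
    by rewrite ler_wpM2r// exprn_ge0// ltW.
  apply/ler_addgt0Pr => e e0; have /cvgrPdist_le/(_ e e0) [N _ hN] := hd _ t0 t1.
  have := hN N.+1 (leqnSn N); rewrite /= sub0r normrN ger0_norm ?cabs_ge0// subr0.
  rewrite big_ord_recl/= expr0 mulr1 => h.
  have := cabs_leB (d 0%N) (- \sum_(n < N) d n.+1 * ((t%:C)%C) ^+ n.+1).
  rewrite opprK normcN => h'; have := tail N.
  by move: h h'; rewrite /bump/=; move: (cabs _) (cabs _) (cabs _) (8 * M * t) => x y z t'; lra.
apply: eq0_normc; apply/eqP; rewrite eq_le cabs_ge0 andbT.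
apply/ler_addgt0Pr => e e0; rewrite add0r.
(* The natural choice of t is e / (8 (M + 1)); if it exceeds 1/4, then e > 2 (M + 1) and t = 1/4
   already suffices. *)
have [eM|eM] := leP (e / (8 * (M + 1))) 4^-1.
  have M1 : 0 < 8 * (M + 1) by lra.
  apply: le_trans (key _ (divr_gt0 e0 M1) eM) _.
  rewrite mulrA ler_pdivrMr//.
  by rewrite [leLHS]mulrC ler_pM2l//; lra.
apply: le_trans (key 4^-1 _ (lexx _)) _ => //.
by move: eM; rewrite ltr_pdivlMr; lra.
Qed.

(** Only real points of the disc are needed. Once the head of the difference vanishes, division by t
    shifts the series and an induction on the index finishes. This makes the selection in [taylor]
    unambiguous. *)
Lemma pseries_unique a a' (F : R[i] -> R[i]) :
  (forall w : R[i], `|w| < 1 -> csum_to (fun n => a n * w ^+ n) (F w)) ->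
  (forall w : R[i], `|w| < 1 -> csum_to (fun n => a' n * w ^+ n) (F w)) -> a = a'.
Proof.
move=> ha ha'.
suff key d : (forall t : R, 0 < t -> t < 1 ->
    ccvg (fun N => \sum_(n < N) d n * ((t%:C)%C) ^+ n) 0) -> forall n, d n = 0.
  apply/funext => n; apply/eqP; rewrite -subr_eq0; apply/eqP.
  apply: (key (fun n => a n - a' n)) => t t0 t1.
  have tl : `|(t%:C)%C| < 1 :> R[i] by rewrite cabs_lt1 cabs_real ger0_norm ?(ltW t0).
  have /csum_toP h := ha _ tl; have /csum_toP h' := ha' _ tl.
  have := ccvgD h (ccvgN h'); rewrite subrr.
  by under eq_fun do rewrite -sumrB; under eq_fun do under eq_bigr do rewrite -mulrBl.
move=> hd n; elim: n d hd => [|n ih] d hd; first exact: pseries_zero_head.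
have d0 := pseries_zero_head hd.
apply: (ih (fun n => d n.+1)) => t t0 t1.
have := hd t t0 t1; rewrite -ccvgS => /(ccvgZ ((t^-1)%:C)%C); rewrite mulr0.
congr ccvg; apply/funext => N; rewrite big_ord_recl d0 mul0r add0r mulr_sumr.
apply: eq_bigr => i _; rewrite mulrCA; congr (_ * _).
rewrite /= /bump/= exprS mulrA -[X in X * _]rmorphM mulVf ?gt_eqF//.
by rewrite rmorph1 mul1r.
Qed.

Lemma taylorE a (F : R[i] -> R[i]) :
  (forall w : R[i], `|w| < 1 -> csum_to (fun n => a n * w ^+ n) (F w)) -> taylor F = a.
Proof.
move=> ha; rewrite /taylor; case: xgetP => [b -> hb|]; first exact: (pseries_unique hb ha).
by move=> /(_ a) [].
Qed.

Lemma geometric_lty (q K : R) : 0 <= q -> q < 1 -> 0 <= K ->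
  (\sum_(0 <= n <oo) (K * q ^+ n)%:E < +oo)%E.
Proof.
move=> q0 q1 K0; have q1' : 0 < 1 - q by lra.
apply: (@nneseries_bounded_lty _ _ (K / (1 - q))) => [k|n]; first by rewrite mulr_ge0// exprn_ge0.
have : \sum_(k < n) K * q ^+ k = K / (1 - q) - K / (1 - q) * q ^+ n.
  elim: n => [|n ih]; first by rewrite big_ord0 expr0 mulr1 subrr.
  by rewrite (sum_recr (fun k => K * q ^+ k)) ih exprS; field; rewrite gt_eqF.
by move=> ->; rewrite gerBl; apply: mulr_ge0; [exact/divr_ge0/ltW|exact: exprn_ge0].
Qed.

Lemma pseries_cvg h (K : R) (w : R[i]) : (forall n, cabs (h n) <= K) -> cabs w < 1 ->
  ccvg (fun N => \sum_(n < N) h n * w ^+ n) (pseries_eval h w).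
Proof.
move=> hK w1; apply/(@csum_toP _ (fun n => h n * w ^+ n)); apply: (@csum_abs_cvg _ (fun n => K * cabs w ^+ n)).
  by move=> n; rewrite normcM cabsX ler_wpM2r// exprn_ge0// cabs_ge0.
by apply: geometric_lty => //; [exact: cabs_ge0|exact: le_trans (cabs_ge0 _) (hK 0%N)].
Qed.

End complex_series.

Section power_spaces.
Context {R : realType}.

Lemma prehilbert_scalars : prehilbert (@scalars R).
Proof.
split => //=.
- by move=> a f g h _ _ _; rewrite mulrA -[RHS]mulrDl.
- by move=> f g _ _; rewrite cJM conjcK mulrC.
- by move=> f _; rewrite mulCJ /= sqr_ge0.
Qed.

Lemma hnorm_scalars (z : R[i]) : @hnorm _ (@scalars R) z = cabs z.
Proof. by rewrite /hnorm /= mulCJ /= sqrtr_sqr ger0_norm// cabs_ge0. Qed.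

Lemma H2P (h : nat -> R[i]^o) :
  hset (H2 R) h <-> (\sum_(0 <= n <oo) ((cabs (h n)) ^+ 2)%:E < +oo)%E.
Proof.
rewrite /=; under eq_eseriesr do rewrite hnorm_scalars.
by split => [[]|].
Qed.

Lemma power_dot_cvg (H : hilbert R) (PH : prehilbert H) h k :
  hset (power_space H) h -> hset (power_space H) k ->
  ccvg (fun N => \sum_(n < N) hdot H (h n) (k n)) (hdot (power_space H) h k).
Proof.
move=> [hh1 hh2] [hk1 hk2]; apply/(@csum_toP _ (fun n => hdot H (h n) (k n))).
apply: (@csum_abs_cvg _ _ (fun n => @hnorm _ H (h n) ^+ 2 + @hnorm _ H (k n) ^+ 2)).
  move=> n; apply: le_trans (cauchy_schwarz_norm PH (hh1 n) (hk1 n)) _.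
  have := sqr_ge0 (@hnorm _ H (h n) - @hnorm _ H (k n)).
  have := mulr_ge0 (hnorm_ge0 (h n)) (hnorm_ge0 (k n)).
  by rewrite sqrrB; move: (hnorm _) (hnorm _) => x y; lra.
under eq_eseriesr do rewrite EFinD.
by rewrite nneseriesD; [rewrite lte_add_pinfty|move=> *; rewrite lee_fin sqr_ge0..].
Qed.

End power_spaces.

(** * The Cauchy transform, the inner function and the Gram matrix *)

Section cauchy_transform.
Context {R : realType}.
Local Notation RB := (measurableTypeR R).
Variable nu : {measure set RB -> \bar R}.
Hypothesis nu1 : nu setT = 1%E.
Local Notation H := (L2 nu).
Let PH : prehilbert H := prehilbert_L2 nu.
Local Notation C w := (cintegral nu (cauchy_kernel w)).

Lemma L2_cauchy_kernel (w : R[i]) : cabs w < 1 -> hset H (cauchy_kernel w).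
Proof.
by move=> w1; apply: (L2_bounded nu1) (cmeas_cauchy_kernel w) (fun x => cabs_cauchy_kernel x w1).
Qed.

Lemma Re_kernel_mean_ge (w : R[i]) : cabs w < 1 -> 2^-1 <= Re (C w).
Proof.
move=> w1; have [i1 _] := L2_cintg nu1 (L2_cauchy_kernel w1).
have -> : 2^-1 = \int[nu]_(x in setT) 2^-1 :> R by rewrite Rintegral_cst// nu1 mulr1.
apply: le_Rintegral => //.
- exact: integrable_cst1.
- by move=> x _; exact: Re_cauchy_kernel_ge.
Qed.

Lemma kernel_mean_ge (w : R[i]) : cabs w < 1 -> 2^-1 <= cabs (C w).
Proof.
move=> w1; apply: le_trans (Re_kernel_mean_ge w1) _.
by apply: le_trans (cabs_re _); exact: ler_norm.
Qed.

Lemma kernel_mean_neq0 (w : R[i]) : cabs w < 1 -> C w != 0.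
Proof.
move=> w1; apply/eqP => h; have := kernel_mean_ge w1.
by rewrite h normc0 leNgt invr_gt0 ltr0n.
Qed.

Lemma cabs_kernel_meanV (w : R[i]) : cabs w < 1 -> cabs (C w)^-1 <= 2.
Proof.
move=> w1; rewrite normcV -[2]invrK lef_pV2 ?kernel_mean_ge// posrE//.
by apply: lt_le_trans (kernel_mean_ge w1).
Qed.

Lemma herglotzE (w : R[i]) : cabs w < 1 -> herglotz nu w = 2 * C w - 1.
Proof.
move=> w1; have ik := L2_cintg nu1 (L2_cauchy_kernel w1).
rewrite -(cintegralZ 2 ik) -[X in _ - X](cintegral_cst nu1) -cintegralB; last 2 first.
- exact: cintgZ.
- by apply: L2_cintg => //; exact: L2_cst.
congr cintegral; apply/funext => x; rewrite /cauchy_kernel -/(ebar x).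
have := cauchy_kernel_den x w1; move: (w * _) => z z0.
by apply: (mulIf z0); rewrite divfK// mulrBl mul1r -mulrA mulVf// mulr1; ring.
Qed.

(** The Herglotz integral is 2C - 1, and (1 + z) / (1 - z) = 2C - 1 is a Moebius equation in z with
    the single solution 1 - 1/C. *)
Lemma inner_functionE (w : R[i]) : cabs w < 1 -> inner_function nu w = 1 - (C w)^-1.
Proof.
move=> w1; have C0 := kernel_mean_neq0 w1.
rewrite /inner_function; set P := [set z : R[i] | _].
have ex : exists z, P z.
  exists (1 - (C w)^-1); split; first by rewrite subKr invr_eq0.
  by rewrite herglotzE// subKr invrK; rewrite mulrDl mulrBl mulVf//; ring.
have := xgetPex 0 ex; set z := xget _ _; move: z => z {ex} [z1].
rewrite herglotzE// => hz; have h : 1 + z = (2 * C w - 1) * (1 - z) by rewrite -hz divfK.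
have h' : C w * (1 - z) = 1.
  have two : (2 : R[i]) != 0 by rewrite pnatr_eq0.
  apply: (mulfI two); rewrite mulrA.
  have -> : 2 * C w * (1 - z) = (2 * C w - 1) * (1 - z) + (1 - z) by ring.
  by rewrite -h; ring.
have -> : (C w)^-1 = 1 - z by apply: (mulfI C0); rewrite mulfV// h'.
by ring.
Qed.

Lemma kernel_dot_le f (w : R[i]) : cabs w < 1 -> hset H f ->
  cabs (cintegral nu (fun x => (f x : R[i]) * cauchy_kernel w x)) <=
  @hnorm _ H f * (1 - cabs w)^-1.
Proof.
move=> w1 hf; pose k x := ((cauchy_kernel w x)^*)%C.
have mk : cmeas (k : RB -> R[i]) by apply: cmeasJ; exact: cmeas_cauchy_kernel.
have kb x : cabs (k x) <= (1 - cabs w)^-1 by rewrite cabsJ cabs_cauchy_kernel.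
have hk : hset H k by exact: L2_bounded mk kb.
have -> : cintegral nu (fun x => (f x : R[i]) * cauchy_kernel w x) = hdot H f k.
  by rewrite !L2_dotE; congr cintegral; apply/funext => x; rewrite /k conjcK.
apply: le_trans (cauchy_schwarz_norm PH hf hk) _.
rewrite ler_wpM2l ?hnorm_ge0//.
have w1' : 0 < 1 - cabs w by lra.
rewrite -(@ler_pXn2r _ 2)// ?nnegrE ?hnorm_ge0 ?invr_ge0 ?(ltW w1')//.
by rewrite (hnorm_sqr PH hk); exact: sqn_bounded mk kb.
Qed.

(** The remainder in [traj_kernel] is w^N times a bounded factor, because the states stay bounded
    when the inputs are square summable. *)
Lemma traj_cauchy_cvg f (l : nat -> R[i]) (w : R[i]) (K : R) : cabs w < 1 -> hset H f ->
  (forall N, \sum_(n < N) cabs (l n) ^+ 2 <= K) ->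
  ccvg (fun N => C w * \sum_(n < N) out nu f l n * w ^+ n -
     (C w - 1) * \sum_(n < N) l n * w ^+ n)
   (cintegral nu (fun x => (f x : R[i]) * cauchy_kernel w x)).
Proof.
move=> w1 hf hK; have w1' : 0 < 1 - cabs w by lra.
pose M := Num.sqrt (sqn H f + K) * (1 - cabs w)^-1.
apply: (@ccvg_squeeze _ _ _ (fun N => M * cabs w ^+ N)); last first.
  by apply: cvg_geometric_le => //; exact: cabs_ge0.
move=> N; rewrite (traj_kernel nu1 l N w1 hf) cabs_subC.
rewrite [X in cabs X](_ : _ = w ^+ N * cintegral nu (fun x => (traj nu f l N x : R[i]) * cauchy_kernel w x)); last by ring.
rewrite normcM cabsX mulrC ler_wpM2r ?exprn_ge0 ?cabs_ge0//.
apply: le_trans (kernel_dot_le w1 (L2_traj nu1 l N hf)) _.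
rewrite ler_wpM2r ?invr_ge0 ?(ltW w1')//.
by rewrite hnormE ler_wsqrtr// (le_trans (sqn_traj_le nu1 l N hf))// lerD2l.
Qed.

Lemma V1E f : hset H f -> V1 nu f = coef nu f.
Proof.
move=> hf; apply: taylorE => w; rewrite cabs_lt1 => w1; apply/csum_toP.
have := @traj_cauchy_cvg f (fun=> 0) w 0 w1 hf _.
have z N : \sum_(n < N) cabs (0 : R[i]) ^+ 2 <= 0.
  by rewrite big1// => i _; rewrite normc0 expr0n.
move=> /(_ z)/(ccvgZ (C w)^-1); rewrite mulrC; congr ccvg.
apply/funext => N; rewrite [X in _ - (_ * X)]big1; last by move=> i _; rewrite mul0r.
by rewrite mulr0 subr0 mulrA mulVf ?mul1r// kernel_mean_neq0.
Qed.

(** With zero initial state the left side of the Taylor expansion is 0; dividing by C turns (C - 1)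
    / C into the inner function. *)
Lemma mulH2E h : hset (H2 R) h -> mulH2 (inner_function nu) h = conv nu h.
Proof.
move=> /H2P hh; apply: taylorE => w; rewrite cabs_lt1 => w1; apply/csum_toP.
pose K := fine (\sum_(0 <= n <oo) ((cabs (h n)) ^+ 2)%:E)%E.
have hK N : \sum_(n < N) cabs (h n) ^+ 2 <= K.
  by apply: (@nneseries_partial_le _ (fun n => cabs (h n) ^+ 2)) => // n; exact: sqr_ge0.
have hb n : cabs (h n) <= Num.sqrt K.
  rewrite -[cabs _]ger0_norm ?cabs_ge0// -sqrtr_sqr ler_wsqrtr//.
  apply: le_trans (hK n.+1); rewrite (sum_recr (fun n => cabs (h n) ^+ 2)) lerDr.
  by apply: sumr_ge0 => i _; exact: sqr_ge0.
have := traj_cauchy_cvg w1 (ph0 PH) hK.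
have z0 : cintegral nu (fun x : RB => ((0 : hvec H) x : R[i]) * cauchy_kernel w x) = 0.
  rewrite -[RHS](cintegral_cst nu1 0); congr cintegral; apply/funext => x.
  exact: mul0r.
rewrite z0.
move=> /(ccvgZ (C w)^-1) hc; have := ccvgD hc (ccvgZ (inner_function nu w) (pseries_cvg hb w1)).
rewrite mulr0 add0r; congr ccvg; apply/funext => N.
have C0 := kernel_mean_neq0 w1.
under [in X in (C w)^-1 * (_ * X - _)]eq_bigr do rewrite out_conv//.
rewrite inner_functionE// mulrBr mulrA mulVf// mul1r mulrA mulrBr mulVf// mulr1; ring.
Qed.

(** Multiplication by [echi] preserves the inner products of characters, so [pstep] carries the
    recurrence at m to the recurrence at m + 1 with all indices raised by one. The missing term k =
    0 is the mean that [pstep] subtracts. *)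
Lemma auxiliary_iter n : auxiliary nu n = iter n (pstep nu) (fun=> 1).
Proof.
have mean_e m k : hdot H (char_e m.+1) (char_e k.+1) = hdot H (char_e m) (char_e k).
  rewrite !L2_dotE; congr cintegral; apply/funext => x; rewrite !char_eS cJM echiJ.
  by rewrite mulrACA echiK mul1r.
have he m : hset H (char_e m).
  apply: (L2_bounded nu1 (M := 1)); first exact: cmeas_char_e.
  by move=> x; rewrite /char_e cabs_cexpi.
pose g m := iter m (pstep nu) (fun=> 1 : R[i]^o).
have hg m : hset H (g m) by elim: m => [|m ih]; [exact: L2_cst|exact: L2_pstep].
have gE m : g m = char_e m - \sum_(k < m) hdot H (char_e m) (char_e k) *: g k.
  elim: m => [|m ih]; first by rewrite big_ord0 subr0 char_e0.
  rewrite big_ord_recl; under eq_bigr do rewrite mean_e.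
  have pZ a f : hset H f -> pstep nu (a *: f) = a *: pstep nu f.
    move=> hf; apply/funext => x.
    have -> : (a *: pstep nu f) x = a * (pstep nu f x : R[i]) by [].
    rewrite /pstep mulrBr -cintegralZ; last by apply: (L2_cintg nu1); exact: L2_echi_mul.
    have e y : (echi y : R[i]) * (a *: f) y = a * ((echi y : R[i]) * f y).
      by rewrite mulrCA.
    by rewrite e; congr (_ - cintegral _ _); apply/funext => y; rewrite e.
  have pD f1 f2 : hset H f1 -> hset H f2 -> pstep nu (f1 + f2) = pstep nu f1 + pstep nu f2.
    move=> h1 h2; apply/funext => x.
    have -> : (pstep nu f1 + pstep nu f2) x = (pstep nu f1 x : R[i]) + pstep nu f2 x by [].
    have e y : (echi y : R[i]) * (f1 + f2) y = (echi y : R[i]) * f1 y + (echi y : R[i]) * f2 y.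
      by rewrite -mulrDr.
    rewrite /pstep addrACA -opprD -cintegralD; last 2 first.
    - by apply: (L2_cintg nu1); exact: L2_echi_mul.
    - by apply: (L2_cintg nu1); exact: L2_echi_mul.
    by rewrite e; congr (_ - cintegral _ _); apply/funext => y; rewrite e.
  have psum (I : Type) (s : seq I) (F : I -> RB -> R[i]^o) : (forall i, hset H (F i)) ->
      pstep nu (\sum_(i <- s) F i) = \sum_(i <- s) pstep nu (F i).
    move=> hF; elim: s => [|i s ihs].
      rewrite !big_nil -[X in pstep nu X](scale0r (fun=> 1 : R[i]^o)) pZ ?scale0r//.
      exact: L2_cst.
    by rewrite !big_cons pD// ?ihs//; exact: hset_sum.
  rewrite -[g m.+1]/(pstep nu (g m)) {1}ih pD//; last first.
    by apply: hsetN => //; apply: hset_sum => // i _; exact: hsetZ.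
  rewrite -scaleN1r pZ; last by apply: hset_sum => // i _; exact: hsetZ.
  rewrite psum; last by move=> i; exact: hsetZ.
  rewrite scaleN1r opprD addrA; congr (_ - _); last first.
    by apply: eq_bigr => k _; rewrite pZ.
  apply/funext => x; rewrite /pstep -char_eS.
  have -> : (char_e m.+1 - hdot H (char_e m.+1) (char_e (@ord0 m)) *: g (@ord0 m)) x =
    (char_e m.+1 x : R[i]) - hdot H (char_e m.+1) (char_e 0) * 1 by [].
  rewrite mulr1 char_e0 hdot_cst1; congr (_ - cintegral _ _).
  by apply/funext => y; rewrite char_eS.
suff : forall m, forall k, (k < m)%N -> auxiliary nu k = g k by move=> /(_ n.+1 n (leqnn _)).
elim => // m ih k; rewrite ltnS leq_eqVlt => /orP[/eqP ->|]; last exact: ih.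
by rewrite auxiliaryE gE; congr (_ - _); apply: eq_bigr => i _; rewrite ih.
Qed.

Lemma auxiliaryS n : auxiliary nu n.+1 = pstep nu (auxiliary nu n).
Proof. by rewrite !auxiliary_iter. Qed.

Lemma auxiliary0 : auxiliary nu 0 = (fun=> 1).
Proof. by rewrite auxiliary_iter. Qed.

Lemma L2_auxiliary n : hset H (auxiliary nu n).
Proof.
elim: n => [|n ih]; first by rewrite auxiliary0; exact: L2_cst.
by rewrite auxiliaryS; exact: L2_pstep.
Qed.

(** Subtracting the mean is a self-adjoint projection, and multiplication by [ebar] has adjoint
    multiplication by [echi]. *)
Lemma hdot_cstep0 f g : hset H f -> hset H g ->
  hdot H (cstep nu 0 f) g = hdot H f (pstep nu g).
Proof.
move=> hf hg; have hc z : hset H (fun=> z) by exact: L2_cst.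
have hcg := L2_echi_mul hg.
have -> : hdot H (cstep nu 0 f) g =
    hdot H ((f : RB -> R[i]^o) + (fun=> - cintegral nu f)) (fun x => (echi x : R[i]) * g x).
  rewrite !L2_dotE; congr cintegral; apply/funext => x; rewrite /cstep cJM echiJ addr0 mulrA.
  by congr (_ * _); rewrite mulrC.
have -> : hdot H f (pstep nu g) =
    hdot H f ((fun x => (echi x : R[i]) * g x) +
       (fun=> - cintegral nu (fun x => (echi x : R[i]) * g x))) by [].
rewrite hdotDl// hdotDr//; congr (_ + _).
have e (u : R[i]) h : hset H h -> hdot H h (fun=> u) = (u^*)%C * cintegral nu h.
  move=> hh; rewrite -hdot_cst1 -(hdotZr PH)//; congr hdot; apply/funext => x.
  exact: (esym (mulr1 u)).
rewrite e// (ph_dotJ PH hcg)// e// cJM conjcK !cJN; ring.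
Qed.

Lemma hdot_auxiliary f n : hset H f -> hdot H f (auxiliary nu n) = coef nu f n.
Proof.
elim: n f => [|n ih] f hf.
  by rewrite auxiliary0 hdot_cst1.
rewrite auxiliaryS -hdot_cstep0//; last exact: L2_auxiliary.
rewrite ih; last exact: L2_cstep.
by rewrite /coef /out traj_shift.
Qed.

(** [pstep h] has mean 0, and a step with input <h, ebar> takes it back to [h]; the energy balance
    of that step is the rank-one defect. *)
Lemma hdot_pstep f g : hset H f -> hset H g ->
  hdot H (pstep nu f) (pstep nu g) = hdot H f g - hdot H f ebar * ((hdot H g ebar)^*)%C.
Proof.
move=> hf hg.
have mE h : cintegral nu (fun x => (echi x : R[i]) * h x) = hdot H h ebar.
  by rewrite !L2_dotE; congr cintegral; apply/funext => x; rewrite ebarJ mulrC.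
have he : hset H (pstep nu f) by exact: L2_pstep.
have pE h : hset H h -> cstep nu (hdot H h ebar) (pstep nu h) = h.
  move=> hh; apply/funext => x; rewrite /cstep.
  have -> : cintegral nu (pstep nu h) = 0.
    rewrite /pstep cintegralB; last 2 first.
    - by apply: (L2_cintg nu1); exact: L2_echi_mul.
    - by apply: (L2_cintg nu1); exact: L2_cst.
    by rewrite (cintegral_cst nu1) subrr.
  by rewrite /pstep mE subr0 subrK mulrA ebarK mul1r.
have pm h : hset H h -> cintegral nu (pstep nu h) = 0.
  move=> hh; rewrite /pstep cintegralB; last 2 first.
  - by apply: (L2_cintg nu1); exact: L2_echi_mul.
  - by apply: (L2_cintg nu1); exact: L2_cst.
  by rewrite (cintegral_cst nu1) subrr.
have := hdot_cstep nu1 (hdot H f ebar) (hdot H g ebar) he (L2_pstep nu1 hg).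
by rewrite !pE// !pm// mul0r subr0 => ->; rewrite addrK.
Qed.

(** In matrix form, the identity minus M M^*, with M the lower triangular Toeplitz matrix of
    multiplication by [b]. Each use of [hdot_pstep] lowers both indices and subtracts one product of
    coefficients, until an index is 0; there [coef1] settles the value. *)
Lemma gram m n : hdot H (auxiliary nu m) (auxiliary nu n) =
  (m == n)%:R - \sum_(j < n.+1) (if (j <= m)%N then
    bcoef nu (n - j)%N * ((bcoef nu (m - j)%N)^*)%C else 0).
Proof.
have hb k : hdot H (auxiliary nu k) ebar = ((bcoef nu k.+1)^*)%C.
  rewrite (ph_dotJ PH (L2_ebar nu1) (L2_auxiliary k)) hdot_auxiliary//.
  exact: L2_ebar.
have one : hset H (fun=> 1 : R[i]^o) by exact: L2_cst.
have coef1 k : coef nu (fun=> 1 : R[i]^o) k = (k == 0)%:R.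
  case: k => [|k]; first by rewrite /coef/out/= (cintegral_cst nu1).
  rewrite /coef/out traj_shift (_ : cstep _ _ _ = 0); last first.
    by apply/funext => x; rewrite /cstep (cintegral_cst nu1) subrr addr0 mulr0.
  rewrite traj0_zero //; exact: (cintegral_cst nu1 0).
elim: m n => [|m ih] [|n].
- rewrite !auxiliary0 hdot_cst1 (cintegral_cst nu1) big_ord_recl big_ord0/=.
  by rewrite mul0r addr0 subr0.
- rewrite auxiliary0 hdot_auxiliary// coef1 big1 ?subr0// => j _.
  case: ifP => //; rewrite leqn0 => /eqP ->; rewrite !subn0.
  exact: (etrans (congr1 ( *%R (bcoef nu n.+1)) (conjc0 R)) (mulr0 _)).
- rewrite auxiliary0 hdot_cst1 -hdot_cst1 (ph_dotJ PH one (L2_auxiliary _)).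
  by rewrite hdot_auxiliary// coef1 big_ord_recl big_ord0/= mul0r addr0 subr0 oppr0.
rewrite !auxiliaryS hdot_pstep ?ih; try exact: L2_auxiliary.
rewrite !hb conjcK [in RHS]big_ord_recl opprD addrA [RHS]addrAC.
congr (_ - _); exact: mulrC.
Qed.

End cauchy_transform.

(** * Isometry and range of the one-variable transform *)

Section unitary_cauchy_transform.
Context {R : realType}.
Local Notation RB := (measurableTypeR R).
Variable nu : {measure set RB -> \bar R}.
Hypothesis nu1 : nu setT = 1%E.
Local Notation H := (L2 nu).
Let PH : prehilbert H := prehilbert_L2 nu.

(** By [traj_sqn] with zero input, this says that the coefficients of [f] carry the whole norm of
    [f], that is, that [V1] is isometric. *)
Definition stable := forall f, hset H f ->
  (fun n => sqn H (traj nu f (fun=> 0) n)) @ \oo --> 0.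

(** The coefficients of z^j b, which are column j of the Toeplitz matrix of multiplication by
    [b]. *)
Definition bshift j m : R[i] := if (j <= m)%N then bcoef nu (m - j)%N else 0.

Lemma bshift_sqr_le j N : \sum_(m < N) cabs (bshift j m) ^+ 2 <= 1.
Proof.
elim: j N => [|j ih] N.
  rewrite (eq_bigr (fun m : 'I_N => cabs (bcoef nu m) ^+ 2)); first exact: bcoef_sqr_le.
  by move=> m _; rewrite /bshift leq0n subn0.
case: N => [|N]; first by rewrite big_ord0.
rewrite big_ord_recl {1}/bshift ltn0 normc0 expr0n add0r.
by apply: le_trans (ih N).
Qed.

Definition delta (j k : nat) : R[i]^o := (k == j)%:R.

Lemma conv_delta j : conv nu (delta j) = bshift j.
Proof.
apply/funext => m; rewrite /conv /bshift /delta; case: leqP => [jm|mj].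
  have jm' : (m - j < m.+1)%N by rewrite ltnS leq_subr.
  rewrite (bigD1 (Ordinal jm'))//= subKn// eqxx mulr1 big1 ?addr0// => k kj.
  case: eqP => [h|]; last by rewrite mulr0.
  move/eqP: kj; case; apply/val_inj => /=; rewrite -h subKn//.
  by rewrite -ltnS.
rewrite big1// => k _; case: eqP => [h|]; last by rewrite mulr0.
by have := leq_subr k m; rewrite h leqNgt mj.
Qed.

Lemma H2_of_bounded (u : nat -> R[i]^o) (K : R) :
  (forall N, \sum_(n < N) cabs (u n) ^+ 2 <= K) -> hset (H2 R) u.
Proof.
by move=> h; apply/H2P; apply: (@nneseries_bounded_lty _ _ K) => // n; exact: sqr_ge0.
Qed.

Lemma delta_sqr_le j N : \sum_(n < N) cabs (delta j n) ^+ 2 <= 1.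
Proof.
have [jN|Nj] := ltnP j N; last first.
  rewrite big1// => k _; rewrite /delta; case: eqP => [h|]; last first.
    by rewrite normc0 expr0n.
  by have := ltn_ord k; rewrite h ltnNge Nj.
rewrite (bigD1 (Ordinal jN))//= big1 ?addr0; last first.
  move=> k kj; rewrite /delta; case: eqP => [h|]; last first.
    by rewrite normc0 expr0n.
  by move/eqP: kj; case; apply/val_inj.
by rewrite /delta eqxx normc1 expr1n.
Qed.

Lemma H2_delta j : hset (H2 R) (delta j).
Proof. by apply: (@H2_of_bounded _ 1) => N; exact: delta_sqr_le. Qed.

Lemma H2_coef f : hset H f -> hset (H2 R) (coef nu f).
Proof. by move=> hf; apply: (@H2_of_bounded _ (sqn H f)) => N; exact: bessel_coef. Qed.

Lemma gram_bshift m n : hdot H (auxiliary nu m) (auxiliary nu n) =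
  (m == n)%:R - \sum_(j < n.+1) bcoef nu (n - j)%N * ((bshift j m)^*)%C.
Proof.
rewrite gram//; congr (_ - _); apply: eq_bigr => j _; rewrite /bshift; case: ifP => // _.
by rewrite (etrans (congr1 _ (conjc0 R)) (mulr0 _)).
Qed.

(* Duality with the Bessel inequality for the coefficients. *)
Lemma auxiliary_sum_sqn (u : nat -> R[i]) M N : (M <= N)%N ->
  sqn H (\sum_(M <= m < N) u m *: auxiliary nu m) <= \sum_(M <= m < N) cabs (u m) ^+ 2.
Proof.
move=> MN; set F := \sum_(_ <= _ < _) _.
have hv m : hset H (u m *: auxiliary nu m) by apply: hsetZ => //; exact: L2_auxiliary.
have hF : hset H F by apply: hset_sum.
have e : sqn H F = \sum_(M <= m < N) Re (((u m)^*)%C * coef nu F m).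
  rewrite {1}/sqn {2}/F hdot_sumr// cRe_sum; apply: eq_bigr => m _.
  by rewrite hdotZr ?hdot_auxiliary//; exact: L2_auxiliary.
have le1 m : Re (((u m)^*)%C * coef nu F m) <= (cabs (u m) ^+ 2 + cabs (coef nu F m) ^+ 2) / 2.
  apply: le_trans (ler_norm _) _; apply: le_trans (cabs_re _) _.
  rewrite normcM cabsJ; have := sqr_ge0 (cabs (u m) - cabs (coef nu F m)).
  by rewrite sqrrB; move: (cabs _) (cabs _) => x y; lra.
have le2 : sqn H F <= (\sum_(M <= m < N) cabs (u m) ^+ 2 + sqn H F) / 2.
  rewrite {1}e; apply: le_trans (ler_sum _ (fun m _ => le1 m)) _.
  rewrite -mulr_suml ler_wpM2r// big_split/= lerD2l.
  apply: le_trans (bessel_coef nu1 N hF); rewrite -(big_mkord xpredT (fun n => cabs (coef nu F n) ^+ 2)).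
  rewrite (big_cat_nat (leq0n M) MN)/= lerDr.
  by apply: sumr_ge0 => i _; exact: sqr_ge0.
by move: le2; move: (sqn _ _) (\sum_(_ <= _ < _) _) => x y; lra.
Qed.

Hypothesis st : stable.

Lemma stable_dot_cvg f X : hset H f -> (forall N, hset H (X N)) ->
  (exists K, forall N, sqn H (X N) <= K) ->
  ccvg (fun N => hdot H (traj nu f (fun=> 0) N) (X N)) 0.
Proof.
move=> hf hX [K hK].
apply: (@ccvg_squeeze _ _ _ (fun N => Num.sqrt (sqn H (traj nu f (fun=> 0) N)) * Num.sqrt K)).
  move=> N; rewrite subr0; apply: le_trans (cauchy_schwarz_norm PH (L2_traj nu1 _ N hf) (hX N)) _.
  by rewrite !hnormE ler_wpM2l ?sqrtr_ge0// ler_wsqrtr.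
rewrite -(mul0r (Num.sqrt K)); apply: cvgM; last exact: cvg_cst.
rewrite -(sqrtr0 R); apply: (continuous_cvg _ (@sqrt_continuous R 0)); exact: st.
Qed.

Lemma coef_dot_cvg f g : hset H f -> hset H g ->
  ccvg (fun N => \sum_(n < N) coef nu f n * ((coef nu g n)^*)%C) (hdot H f g).
Proof.
move=> hf hg.
have h : ccvg (fun N => hdot H (traj nu f (fun=> 0) N) (traj nu g (fun=> 0) N)) 0.
  apply: stable_dot_cvg => // [N|]; first exact: L2_traj.
  exists (sqn H g) => N; apply: le_trans (sqn_traj_le nu1 _ N hg) _.
  by rewrite big1 ?addr0// => i _; rewrite normc0 expr0n.
have := ccvgD (ccvg_cst (hdot H f g)) (ccvgN h); rewrite oppr0 addr0.
congr ccvg; apply/funext => N.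
rewrite (traj_dot nu1 (fun=> 0) (fun=> 0) N hf hg) [X in _ = _ + X]big1 ?addr0// => i _.
by rewrite mul0r.
Qed.

(** The second trajectory starts at 0 and the first has no input, so only the pairing of the two
    states remains; the driven state is bounded by the norm of [l] while the free one decays. *)
Lemma conv_dot_cvg f l : hset H f -> hset (H2 R) l ->
  ccvg (fun N => \sum_(n < N) coef nu f n * ((conv nu l n)^*)%C) 0.
Proof.
move=> hf /H2P hl; have h0 := ph0 PH.
have hX N := L2_traj nu1 l N h0.
have : ccvg (fun N => hdot H (traj nu f (fun=> 0) N) (traj nu 0 l N)) 0.
  apply: stable_dot_cvg => //.
  exists (fine (\sum_(0 <= n <oo) ((cabs (l n)) ^+ 2)%:E)%E) => N.
  apply: le_trans (sqn_traj_le nu1 l N h0) _; rewrite {1}/sqn hdot0l// add0r.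
  by apply: (@nneseries_partial_le _ (fun n => cabs (l n) ^+ 2)) => // n; exact: sqr_ge0.
move=> /ccvgN; rewrite oppr0; congr ccvg; apply/funext => N.
under [in RHS]eq_bigr do rewrite -out_conv//.
rewrite (traj_dot nu1 (fun=> 0) l N hf h0) hdot0r// add0r big1 ?addr0// => i _.
by rewrite mul0r.
Qed.

Lemma V1_dot f g : hset H f -> hset H g -> hdot (H2 R) (V1 nu f) (V1 nu g) = hdot H f g.
Proof.
move=> hf hg; rewrite !V1E//; apply: csum_unique.
by apply/(@csum_toP _ (fun n => coef nu f n * ((coef nu g n)^*)%C)); exact: coef_dot_cvg.
Qed.

Lemma V1_Hb f : hset H f -> hset (Hb nu) (V1 nu f).
Proof.
move=> hf; rewrite V1E//; split; first exact: H2_coef.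
move=> _ [l hl <-]; rewrite mulH2E//; apply: csum_unique.
by apply/(@csum_toP _ (fun n => coef nu f n * ((conv nu l n)^*)%C)); exact: conv_dot_cvg.
Qed.

Lemma hnorm_V1 f : hset H f -> @hnorm _ (Hb nu) (V1 nu f) = @hnorm _ H f.
Proof. by move=> hf; rewrite /hnorm [hdot _ _ _]V1_dot. Qed.

End unitary_cauchy_transform.

Section surjectivity.
Context {R : realType}.
Local Notation RB := (measurableTypeR R).
Variable nu : {measure set RB -> \bar R}.
Hypothesis nu1 : nu setT = 1%E.
Local Notation H := (L2 nu).
Let PH : prehilbert H := prehilbert_L2 nu.

(** The preimage is the sum of the h_m g_m, convergent by [auxiliary_sum_sqn]. In its n-th
    coefficient the identity part of the Gram matrix contributes h_n; the rest is a combination of n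
    + 1 pairings of [h] with the elements z^j b of b H^2, all of them 0. *)
Lemma V1_surj h : hset (Hb nu) h -> exists2 f, hset H f & V1 nu f = h.
Proof.
move=> [hh horth]; have hhs := hh; move/H2P: hhs => hs.
pose v m : RB -> R[i]^o := (h m : R[i]) *: auxiliary nu m.
have hv m : hset H (v m) by apply: hsetZ => //; exact: L2_auxiliary.
have [f [hf fcvg]] := L2_series_cvg hv (fun m => sqr_ge0 (cabs (h m)))
  (fun M N MN => auxiliary_sum_sqn nu1 h MN) hs.
exists f => //; rewrite V1E//; apply/funext => n.
have orth j : ccvg (fun N => \sum_(m < N) (h m : R[i]) * ((bshift nu j m)^*)%C) 0.
  rewrite -[X in ccvg _ X](horth (bshift nu j)); last first.
    exists (delta j); first exact: H2_delta.
    by rewrite mulH2E//; [exact: conv_delta|exact: H2_delta].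
  have hb : hset (H2 R) (bshift nu j).
    by apply: (@H2_of_bounded _ _ 1) => N; exact: bshift_sqr_le.
  exact: (power_dot_cvg (prehilbert_scalars (R := R)) hh hb).
have lim1 : ccvg (fun N => hdot H (\sum_(m < N) v m) (auxiliary nu n)) (coef nu f n).
  rewrite -hdot_auxiliary//; apply: (hdot_cvg PH) => //; last exact: L2_auxiliary.
  by move=> N; apply: (hset_sum PH).
have lim2 : ccvg (fun N => \sum_(m < N) (m == n :> nat)%:R * (h m : R[i]) -
    \sum_(j < n.+1) bcoef nu (n - j)%N * \sum_(m < N) (h m : R[i]) * ((bshift nu j m)^*)%C) (h n - 0).
  apply: ccvgD; last first.
    apply: ccvgN; have h0 : \sum_(j < n.+1) bcoef nu (n - j)%N * 0 = 0 :> R[i].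
      by rewrite big1// => j _; rewrite mulr0.
    rewrite -[X in ccvg _ X]h0.
    apply: (@ccvg_sum _ _ _ (fun (j : 'I_n.+1) N => bcoef nu (n - j)%N *
      \sum_(m < N) (h m : R[i]) * ((bshift nu j m)^*)%C)) => j.
    exact: ccvgZ.
  exact: ccvg_sum_delta.
rewrite subr0 in lim2; apply: ccvg_unique lim1 _.
move: lim2; congr ccvg; apply/funext => N.
have -> : hdot H (\sum_(m < N) v m) (auxiliary nu n) = \sum_(m < N) ((m == n :> nat)%:R * (h m : R[i]) -
    (h m : R[i]) * \sum_(j < n.+1) bcoef nu (n - j)%N * ((bshift nu j m)^*)%C).
  rewrite (hdot_suml PH _ (P := xpredT) (fun (m : 'I_N) _ => hv m) (L2_auxiliary nu1 n)); apply: eq_bigr => m _.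
  rewrite (hdotZl PH _ (L2_auxiliary nu1 m) (L2_auxiliary nu1 n)) gram_bshift//.
  by rewrite mulrBr [X in X - _]mulrC.
rewrite sumrB; congr (_ - _).
under eq_bigr do rewrite mulr_sumr; rewrite exchange_big/=; apply: eq_bigr => m _.
by rewrite mulr_sumr; apply: eq_bigr => j _; rewrite mulrCA.
Qed.

End surjectivity.

(** * Strong stability from the stability of one character *)

Import HBNNSimple.

Section sign_approximation.
Context {R : realType}.
Implicit Types x y : R.

(* Iterating this polynomial on [-1, 1] converges to the sign function. *)
Definition sgn_step y : R := (3 * y - y ^+ 3) / 2.

Lemma sgn_step_bound y : `|y| <= 1 -> `|sgn_step y| <= 1.
Proof.
rewrite !ler_norml /sgn_step => /andP[h1 h2].
(* The polynomial takes the values -1 and 1 at -1 and 1 with zero derivative, hence the double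
   roots; the cofactors are positive on [-1, 1]. *)
have e1 : (3 * y - y ^+ 3) / 2 + 1 = (y + 1) ^+ 2 * (2 - y) / 2 by field.
have e2 : 1 - (3 * y - y ^+ 3) / 2 = (1 - y) ^+ 2 * (2 + y) / 2 by field.
have p1 : 0 <= (y + 1) ^+ 2 * (2 - y) / 2.
  by apply: mulr_ge0 => //; apply: mulr_ge0; [exact: sqr_ge0|lra].
have p2 : 0 <= (1 - y) ^+ 2 * (2 + y) / 2.
  by apply: mulr_ge0 => //; apply: mulr_ge0; [exact: sqr_ge0|lra].
by move: e1 e2 p1 p2; move: ((3 * y - y ^+ 3) / 2) => z; lra.
Qed.

Lemma iter_sgn_step_bound y n : `|y| <= 1 -> `|iter n sgn_step y| <= 1.
Proof. by move=> hy; elim: n => //= n ih; exact: sgn_step_bound. Qed.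

Lemma sgn_stepN y : sgn_step (- y) = - sgn_step y.
Proof. by rewrite /sgn_step; field. Qed.

Lemma iter_sgn_stepN y n : iter n sgn_step (- y) = - iter n sgn_step y.
Proof. by elim: n => //= n ->; exact: sgn_stepN. Qed.

Lemma iter_sgn_step_pos y : 0 < y -> y <= 1 -> (fun n => iter n sgn_step y) @ \oo --> (1 : R).
Proof.
move=> y0 y1; have h n : [/\ y <= iter n sgn_step y, iter n sgn_step y <= 1 &
    1 - iter n sgn_step y <= (1 - y / 2) ^+ n].
  elim: n => [|n [h1 h2 h3]]; first by rewrite /= expr0; split => //; lra.
  rewrite iterS; move: h1 h2 h3; set z := iter n sgn_step y => h1 h2 h3.
  (* The distance to 1 is multiplied by 1 - (z + z^2) / 2, which is at most 1 - y / 2 because the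
     iterates stay above y > 0. *)
  have e : 1 - sgn_step z = (1 - z) * ((1 - z) * (2 + z) / 2) by rewrite /sgn_step; field.
  have z0 : 0 <= 1 - z by lra.
  have b1 : (1 - z) * (2 + z) / 2 <= 1 - y / 2 by nra.
  have b0 : 0 <= (1 - z) * (2 + z) / 2 by apply: mulr_ge0 => //; apply: mulr_ge0 => //; lra.
  split.
  - have : (1 - z) * ((1 - z) * (2 + z) / 2) <= 1 - z by rewrite ler_piMr//; lra.
    by rewrite -e; lra.
  - by have := mulr_ge0 z0 b0; rewrite -e; lra.
  - rewrite e exprSr; exact: ler_pM.
have q0 : 0 <= 1 - y / 2 by lra.
have q1 : 1 - y / 2 < 1 by lra.
have g := @cvg_geometric_le R (1 - y / 2) 1 q0 q1.
apply/cvgrPdist_le => e e0; move/cvgrPdist_le : g => /(_ e e0); apply: filterS => n.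
rewrite sub0r normrN mul1r ger0_norm ?exprn_ge0// => hn.
by have [h1 h2 h3] := h n; rewrite ger0_norm ?subr_ge0//; exact: le_trans h3 hn.
Qed.

Lemma iter_sgn_step_cvg y : `|y| <= 1 -> (fun n => iter n sgn_step y) @ \oo --> Num.sg y.
Proof.
rewrite ler_norml => /andP[h1 h2]; have [y0|y0|<-] := ltgtP 0 y.
- by rewrite gtr0_sg//; exact: iter_sgn_step_pos.
- rewrite ltr0_sg//; have := @iter_sgn_step_pos (- y).
  rewrite oppr_gt0 lerNl => /(_ y0 h1) /cvgN.
  rewrite (_ : - _ = fun n => iter n sgn_step y)//.
  by apply/funext => n; rewrite [LHS](_ : _ = - iter n sgn_step (- y))// iter_sgn_stepN opprK.
- rewrite sgr0 (_ : (fun _ => _) = fun=> 0); first exact: cvg_cst.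
  apply/funext => n; elim: n => //= n ->.
  by rewrite /sgn_step mulr0 expr0n subr0 mul0r.
Qed.

End sign_approximation.

Lemma measure_setC0 (R : realType) d (T : measurableType d) (nu : {measure set T -> \bar R}) (A : set T) :
  measurable A -> nu setT = 1%E -> nu A = 1%E -> nu (~` A) = 0%E.
Proof.
move=> mA nu1 nuA; have h : (1%E = 1%E + nu (~` A))%E.
  have := measureU nu mA (measurableC mA); rewrite setICr => /(_ erefl).
  by rewrite setUCr [LHS]nu1 [X in _ = X + _]nuA.
have fin : nu (~` A) \is a fin_num.
  rewrite ge0_fin_numE//; apply: (@le_lt_trans _ _ (nu setT)); last by rewrite nu1 ltry.
  by apply: le_measure; rewrite ?inE//; exact: measurableC.
move: h; rewrite -(fineK fin) -EFinD => /(congr1 fine)/= h.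
by rewrite (_ : fine _ = 0)//; lra.
Qed.

Section stability.
Context {R : realType}.
Local Notation RB := (measurableTypeR R).
Variable nu : {measure set RB -> \bar R}.
Hypothesis nu1 : nu setT = 1%E.
Local Notation H := (L2 nu).
Let PH : prehilbert H := prehilbert_L2 nu.
Local Notation Tn f n := (traj nu f (fun=> 0) n).

Definition vanishing (f : RB -> R[i]^o) := (fun n => sqn H (Tn f n)) @ \oo --> 0.

Let Tn_le f n : hset H f -> sqn H (Tn f n) <= sqn H f.
Proof.
move=> hf; apply: le_trans (sqn_traj_le nu1 _ n hf) _.
by rewrite big1 ?addr0// => i _; rewrite normc0 expr0n.
Qed.

Lemma vanishing0 : vanishing 0.
Proof.
have e n : sqn H (Tn 0 n) = 0 by rewrite traj0_zero// /sqn hdot0l//; exact: ph0.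
by rewrite /vanishing (funext e); exact: cvg_cst.
Qed.

Lemma vanishing_lin (a : R[i]) f g : hset H f -> hset H g -> vanishing f -> vanishing g ->
  vanishing (a *: f + g).
Proof.
move=> hf hg vf vg.
have e n : Tn (a *: f + g) n = a *: Tn f n + Tn g n.
  rewrite -trajZ// -trajD//; last exact: hsetZ.
  by congr (traj _ _ _ n); apply/funext => k; rewrite mulr0 addr0.
rewrite /vanishing; under eq_fun do rewrite e.
apply: (@squeeze_cvgr _ _ _ _ (fun=> 0) (fun n => (cabs a ^+ 2 * sqn H (Tn f n) + sqn H (Tn g n)) * 2)).
- apply: nearW => n; rewrite mulr_natr sqn_ge0 ?sqn_lin_le//; do ?exact: L2_traj.
  by apply: (phL PH); exact: L2_traj.
- exact: cvg_cst.
- rewrite [X in _ --> X](_ : 0 = (cabs a ^+ 2 * 0 + 0) * 2); last by rewrite mulr0 addr0 mul0r.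
  apply: cvgM; last exact: cvg_cst.
  by apply: cvgD => //; apply: cvgM => //; exact: cvg_cst.
Qed.

Lemma vanishing_approx f : hset H f ->
  (forall e, 0 < e -> exists g, [/\ hset H g, vanishing g & sqn H (f - g) <= e]) ->
  vanishing f.
Proof.
move=> hf h; apply/cvgrPdist_le => e e0.
(* [sqn_lin_le] doubles the sum of the two errors. *)
have e4 : 0 < e / 4 by rewrite divr_gt0.
have [g [hg vg fg]] := h _ e4.
move/cvgrPdist_le : vg => /(_ _ e4); apply: filterS => n.
have hn k : hset H k -> hset H (Tn k n) by move=> hk; exact: L2_traj.
rewrite !sub0r !normrN !ger0_norm; try by apply: sqn_ge0 => //; exact: hn.
move=> hgn; have hfg : hset H (f - g) by exact: hsetB.
have -> : Tn f n = (1 : R[i]) *: Tn (f - g) n + Tn g n.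
  rewrite scale1r -trajD// subrK; congr (traj _ _ _ n).
  by apply/funext => k; rewrite addr0.
apply: le_trans (sqn_lin_le PH 1 (hn _ hfg) (hn _ hg)) _.
rewrite normc1 expr1n mul1r.
have := le_trans (Tn_le n hfg) fg; move: hgn.
by move: (sqn _ _) (sqn _ _) => x y; lra.
Qed.

Lemma vanishing_step f : vanishing (cstep nu 0 f) <-> vanishing f.
Proof.
rewrite /vanishing -[X in _ <-> X](cvg_shiftS (fun n => sqn H (Tn f n))).
have -> // : (fun n => sqn H (Tn (cstep nu 0 f) n)) = [sequence sqn H (Tn f n.+1)]_n.
by apply/funext => n; exact: (congr1 (sqn H) (esym (traj_shift nu f (fun=> 0) n))).
Qed.

(** The character of integer frequency a - b. Two natural numbers are used so that [echi] and [ebar]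
    each act by a successor; [char_zS] identifies pairs with the same frequency. *)
Definition char_z (a b : nat) : RB -> R[i]^o :=
  fun x => (char_e a x : R[i]) * ((char_e b x : R[i])^*)%C.

Lemma cabs_char_z a b x : cabs (char_z a b x) = 1.
Proof. by rewrite /char_z normcM cabsJ !cabs_cexpi mulr1. Qed.

Lemma cmeas_char_z a b : cmeas (char_z a b : RB -> R[i]).
Proof. by apply: cmeasM; [exact: cmeas_char_e|apply: cmeasJ; exact: cmeas_char_e]. Qed.

Lemma L2_char_z a b : hset H (char_z a b).
Proof. by apply: (L2_bounded nu1 (M := 1)); [exact: cmeas_char_z|move=> x; rewrite cabs_char_z]. Qed.

Lemma char_zS a b : char_z a.+1 b.+1 = char_z a b.
Proof.
by apply/funext => x; rewrite /char_z !char_eS cJM echiJ mulrACA echiK mul1r.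
Qed.

Lemma echi_char_z a b x : (echi x : R[i]) * char_z a b x = char_z a.+1 b x.
Proof. by rewrite /char_z char_eS mulrA. Qed.

Lemma ebar_char_z a b x : (ebar x : R[i]) * char_z a b x = char_z a b.+1 x.
Proof. by rewrite /char_z char_eS cJM echiJ mulrCA. Qed.

Hypothesis van_ebar : vanishing ebar.

(** Multiplication by [ebar] differs from a step of the dynamics by a multiple of [ebar], which
    decays by hypothesis. *)
Let vanishing_of_step f : hset H f -> vanishing f ->
  vanishing (fun x => (ebar x : R[i]) * f x).
Proof.
move=> hf vf; have -> : (fun x => (ebar x : R[i]) * f x) =
    (cintegral nu f : R[i]) *: ebar + cstep nu 0 f.
  apply/funext => x.
  change ((ebar x : R[i]) * f x = cintegral nu f * (ebar x : R[i]) + (ebar x : R[i]) * (f x - cintegral nu f + 0)).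
  by ring.
by apply: vanishing_lin => //; [exact: L2_ebar|exact: L2_cstep|exact: (proj2 (vanishing_step f))].
Qed.

Let vanishing_cst1 : vanishing (fun=> 1).
Proof.
have e : cstep nu 0 (fun=> 1) = 0.
  by apply/funext => x; rewrite /cstep (cintegral_cst nu1) subrr addr0 mulr0.
by apply: (proj1 (vanishing_step (fun=> 1))); rewrite e; exact: vanishing0.
Qed.

(** Negative frequencies arise from the constant 1 by multiplication with [ebar]. For positive ones,
    a single step lowers the frequency by one up to a multiple of [ebar], and decay after one step
    is the same as decay. *)
Lemma vanishing_char_z a b : vanishing (char_z a b).
Proof.
elim: a b => [|a ih] [|b].
- rewrite (_ : char_z 0 0 = fun=> 1)//; apply/funext => x.
  by rewrite /char_z char_e0 conjc1 mulr1.
- elim: b => [|b ihb].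
    have -> : char_z 0 1 = (fun x => (ebar x : R[i]) * (fun=> 1 : R[i]) x).
      by apply/funext => x; rewrite /char_z char_eS char_e0 cJM echiJ conjc1 mul1r.
    by apply: vanishing_of_step => //; exact: L2_cst.
  have -> : char_z 0 b.+2 = (fun x => (ebar x : R[i]) * char_z 0 b.+1 x).
    by apply/funext => x; rewrite ebar_char_z.
  by apply: vanishing_of_step => //; exact: L2_char_z.
- apply: (proj1 (vanishing_step (char_z a.+1 0))).
  have -> : cstep nu 0 (char_z a.+1 0) = (- cintegral nu (char_z a.+1 0)) *: ebar + char_z a 0.
    apply/funext => x.
    change ((ebar x : R[i]) * (char_z a.+1 0 x - cintegral nu (char_z a.+1 0) + 0) =
      - cintegral nu (char_z a.+1 0) * (ebar x : R[i]) + char_z a 0 x).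
    have -> : (char_z a 0 x : R[i]) = (ebar x : R[i]) * char_z a.+1 0 x by rewrite ebar_char_z char_zS.
    by ring.
  by apply: vanishing_lin => //; [exact: L2_ebar|exact: L2_char_z].
- by rewrite char_zS.
Qed.

Definition bdd_meas (h : RB -> R[i]) := cmeas h /\ exists M, forall x, cabs (h x) <= M.

Let bm_L2 h : bdd_meas h -> hset H (h : RB -> R[i]^o).
Proof. by move=> [mh [M hM]]; exact: L2_bounded mh hM. Qed.

Let bmM h g : bdd_meas h -> bdd_meas g -> bdd_meas (fun x => h x * g x).
Proof.
move=> [mh [M hM]] [mg [N hN]]; split; first exact: cmeasM.
by exists (M * N) => x; rewrite normcM ler_pM ?cabs_ge0.
Qed.

Let bmD h g : bdd_meas h -> bdd_meas g -> bdd_meas (fun x => h x + g x).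
Proof.
move=> [mh [M hM]] [mg [N hN]]; split; first exact: cmeasD.
by exists (M + N) => x; apply: le_trans (le_normcD _ _) _; rewrite lerD.
Qed.

Let bm_cst (z : R[i]) : bdd_meas (fun=> z).
Proof. by split; [exact: cmeas_cst|exists (cabs z)]. Qed.

Let bm_char_z a b : bdd_meas (char_z a b).
Proof. by split; [exact: cmeas_char_z|exists 1 => x; rewrite cabs_char_z]. Qed.

Local Opaque vanishing.

(** The characters are built into the predicate so that multiplication by [echi] or [ebar] merely
    shifts [a] or [b]. *)
Definition char_z_vanishing (g : RB -> R[i]) := bdd_meas g /\
  forall a b, vanishing (fun x => g x * char_z a b x).

(* The bounded functions preserving [char_z_vanishing] form an algebra closed under
   bounded pointwise limits and containing the characters, hence containing the
   indicators of all Borel sets. *)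
Definition multiplier (h : RB -> R[i]) := bdd_meas h /\
  forall g, char_z_vanishing g -> char_z_vanishing (fun x => h x * g x).

Let mulM h k : multiplier h -> multiplier k -> multiplier (fun x => h x * k x).
Proof.
move=> [bh hh] [bk hk]; split; first exact: bmM.
by move=> g hg; under eq_fun do rewrite -mulrA; exact/hh/hk.
Qed.

Let mulD h k : multiplier h -> multiplier k -> multiplier (fun x => h x + k x).
Proof.
move=> [bh hh] [bk hk]; split; first exact: bmD.
move=> g [bg hg]; split; first by apply: bmM => //; exact: bmD.
move=> a b; have [b1 v1] := hh _ (conj bg hg); have [b2 v2] := hk _ (conj bg hg).
have -> : (fun x => (h x + k x) * g x * char_z a b x) =
    (1 : R[i]) *: ((fun x => h x * g x * char_z a b x) : RB -> R[i]^o) + (fun x => k x * g x * char_z a b x).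
  by apply/funext => x; rewrite scale1r !mulrDl.
exact: (vanishing_lin 1 (bm_L2 (bmM b1 (bm_char_z a b))) (bm_L2 (bmM b2 (bm_char_z a b))) (v1 a b) (v2 a b)).
Qed.

Let mul_cst (z : R[i]) : multiplier (fun=> z).
Proof.
split; first exact: bm_cst.
move=> g [bg hg]; split; first exact: (bmM (bm_cst z) bg).
move=> a b; have -> : (fun x => z * g x * char_z a b x) =
    (z : R[i]) *: ((fun x => g x * char_z a b x) : RB -> R[i]^o) + 0.
  by apply/funext => x; rewrite addr0 -mulrA.
exact: (vanishing_lin z (bm_L2 (bmM bg (bm_char_z a b))) (ph0 PH) (hg a b) vanishing0).
Qed.

(** By dominated convergence the products with [h n] approximate the product with [k] in L^2. Since
    the dynamics is contractive, decay passes to such limits ([vanishing_approx]). *)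
Let mul_limit (h : nat -> RB -> R[i]) (k : RB -> R[i]) (M : R) : (forall n, multiplier (h n)) ->
  (forall n x, cabs (h n x) <= M) -> {ae nu, forall x, ccvg (fun n => h n x) (k x)} ->
  bdd_meas k -> multiplier k.
Proof.
move=> mh hM hk bk; split; first exact: bk.
move=> g [bg hg]; split; first exact: (bmM bk bg).
move=> a b; have [mk [K kK]] := bk; have [mg [G gG]] := bg.
have M0 : 0 <= M by apply: le_trans (hM 0%N point); exact: cabs_ge0.
have K0 : 0 <= K by apply: le_trans (kK point); exact: cabs_ge0.
have G0 : 0 <= G by apply: le_trans (gG point); exact: cabs_ge0.
apply: vanishing_approx; first by apply: bm_L2; do 2 apply: bmM => //.
pose D n x : R[i] := (k x - h n x) * g x.
have mD n : cmeas (D n).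
  by apply: cmeasM => //; apply: cmeasB => //; have [[]] := mh n.
have bD n x : cabs (D n x) <= (K + M) * G.
  rewrite normcM ler_pM ?cabs_ge0//.
  by apply: le_trans (le_normcD _ _) _; rewrite normcN lerD.
have D0 : (fun n => \int[nu]_x (cabs (D n x) ^+ 2)%:E)%E @ \oo --> 0%E.
  have := @dominated_convergence _ _ _ nu setT measurableT
    (fun n x => (cabs (D n x) ^+ 2)%:E) (cst 0%E) (cst (((K + M) * G) ^+ 2)%:E).
  case=> //.
  - by move=> n; apply: measurable_cabs2.
  - apply: filterS hk => x hx _; apply: cvg_EFin; first exact: nearW.
    rewrite (_ : fine \o _ = fun n => cabs (D n x) ^+ 2)//.
    have h0 : (fun n => cabs (D n x)) @ \oo --> 0.
      rewrite -(mul0r (cabs (g x))).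
      under eq_fun do rewrite normcM cabs_subC.
      by apply: cvgM => //; exact: cvg_cst.
    by under eq_fun do rewrite expr2; rewrite -(mulr0 0); exact: cvgM.
  - exact: integrable_cst1.
  - apply: aeW => x n _ /=; rewrite lee_fin ger0_norm ?sqr_ge0//.
    by rewrite ler_pXn2r ?nnegrE ?cabs_ge0// mulr_ge0// addr_ge0.
  by move=> _ _; rewrite integral_cst//= mul0e.
move=> e e0.
have hD n : hset H (D n : RB -> R[i]^o) by exact: L2_bounded (mD n) (bD n).
have [n hn] : exists n, sqn H (D n) < e.
  have /fine_cvg/cvgrPdist_lt/(_ e e0) [n _ hn] := D0.
  exists n; have := hn n (leqnn n); rewrite /= -sqn_L2// sub0r normrN.
  by rewrite ger0_norm//; exact: sqn_ge0 PH _ (hD n).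
have [bhn hhn] := mh n; have [b1 v1] := hhn _ (conj bg hg).
exists (fun x => h n x * g x * char_z a b x); split => //; first by apply: bm_L2; apply: bmM.
apply: le_trans (ltW hn).
have [bkg bhg] := (bmM (bmM bk bg) (bm_char_z a b), bmM (bmM bhn bg) (bm_char_z a b)).
apply: L2_ae_sqn; [exact: (hsetB PH (bm_L2 bkg) (bm_L2 bhg))|exact: hD|].
move=> x; change (cabs (k x * g x * char_z a b x - h n x * g x * char_z a b x) <= cabs (D n x)).
by rewrite -mulrBl -mulrBl normcM cabs_char_z mulr1.
Qed.

Let mul_chi (sgn : bool) : multiplier (fun x => if sgn then echi x else ebar x).
Proof.
split; first by case: sgn; split; [exact: cmeas_echi|exists 1 => x; rewrite cabs_echi|
  exact: cmeas_ebar|exists 1 => x; rewrite cabs_ebar].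
move=> g [bg hg]; split.
  apply: bmM => //; case: sgn; split; [exact: cmeas_echi|exists 1 => x; rewrite cabs_echi//|
    exact: cmeas_ebar|exists 1 => x; rewrite cabs_ebar//].
move=> a b; case: sgn.
  have -> : (fun x => (echi x : R[i]) * g x * char_z a b x) = (fun x => g x * char_z a.+1 b x).
    by apply/funext => x; rewrite -echi_char_z [_ * g x]mulrC mulrA.
  exact: hg.
have -> : (fun x => (ebar x : R[i]) * g x * char_z a b x) = (fun x => g x * char_z a b.+1 x).
  by apply/funext => x; rewrite -ebar_char_z [_ * g x]mulrC mulrA.
exact: hg.
Qed.

Definition rmultiplier (f : RB -> R) := multiplier (fun x => ((f x)%:C)%C).

Let rmulM f g : rmultiplier f -> rmultiplier g -> rmultiplier (fun x => f x * g x).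
Proof. by move=> hf hg; rewrite /rmultiplier; under eq_fun do rewrite rmorphM; exact: (mulM hf hg). Qed.

Let rmulD f g : rmultiplier f -> rmultiplier g -> rmultiplier (fun x => f x + g x).
Proof. by move=> hf hg; rewrite /rmultiplier; under eq_fun do rewrite rmorphD; exact: (mulD hf hg). Qed.

Let rmul_cst (r : R) : rmultiplier (fun=> r). Proof. exact: mul_cst. Qed.

Let rmulZ (r : R) f : rmultiplier f -> rmultiplier (fun x => r * f x).
Proof. by move=> hf; exact: (rmulM (rmul_cst r) hf). Qed.

Let rmul_meas f : rmultiplier f -> measurable_fun setT f.
Proof. by move=> [[[]]]. Qed.

Let rmul_limit (h : nat -> RB -> R) (k : RB -> R) (M : R) : (forall n, rmultiplier (h n)) ->
  (forall n x, `|h n x| <= M) -> measurable_fun setT k -> (forall x, `|k x| <= M) ->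
  {ae nu, forall x, (fun n => h n x) @ \oo --> k x} -> rmultiplier k.
Proof.
move=> mh hM mk kM hk; apply: (@mul_limit (fun n x => ((h n x)%:C)%C) _ M) => //.
- by move=> n x; rewrite cabs_real.
- by apply: filterS hk => x hx; apply/ccvgP; split => //=; exact: cvg_cst.
- by split; [split => //; exact: measurable_cst|exists M => x; rewrite cabs_real].
Qed.

Let rmul_cos : rmultiplier (fun x => cos (2 * pi * x)).
Proof.
rewrite /rmultiplier (_ : (fun x => _) = (fun x => (2^-1%:C)%C * ((echi x : R[i]) + ebar x))).
  by apply: mulM; [exact: mul_cst|apply: mulD; [exact: (mul_chi true)|exact: (mul_chi false)]].
apply/funext => x; rewrite /echi /ebar /cexpi cosN sinN; apply: complex_ext => /=.
  by rewrite mul0r subr0; field.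
by rewrite mul0r addr0 subrr mulr0.
Qed.

Let rmul_sin : rmultiplier (fun x => sin (2 * pi * x)).
Proof.
rewrite /rmultiplier (_ : (fun x => _) =
    (fun x => (Complex 0 (- 2^-1)) * ((echi x : R[i]) + (-1) * (ebar x : R[i])))).
  apply: mulM; [exact: mul_cst|apply: mulD; [exact: (mul_chi true)|]].
  by apply: mulM; [exact: mul_cst|exact: (mul_chi false)].
apply/funext => x; rewrite mulN1r /echi /ebar /cexpi cosN sinN; apply: complex_ext => /=.
  by field.
by rewrite subrr mul0r mulr0 addr0.
Qed.

Let rmul_vanishing f (c : R[i]) : rmultiplier f -> vanishing (fun x => c * ((f x)%:C)%C).
Proof.
move=> [_ h]; have h1 : char_z_vanishing (fun=> 1).
  split; [exact: bm_cst|move=> a b; rewrite (_ : (fun x => _) = char_z a b); first exact: vanishing_char_z].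
  by apply/funext => x; rewrite mul1r.
have [_ hc] := mul_cst c; have [_ /(_ 0%N 0%N)] := hc _ (h _ h1).
rewrite (_ : (fun x => _) = (fun x => c * ((f x)%:C)%C))//; apply/funext => x.
by rewrite /char_z char_e0 mulr1 mul1r conjc1 mulr1.
Qed.

Local Opaque rmultiplier.

Let rmul_iter f n : rmultiplier f -> rmultiplier (fun x => iter n sgn_step (f x)).
Proof.
move=> hf; elim: n => [|n ih]; first exact: hf.
have -> : (fun x => iter n.+1 sgn_step (f x)) = (fun x => 2^-1 * (3 * iter n sgn_step (f x) +
    (-1) * (iter n sgn_step (f x) * (iter n sgn_step (f x) * iter n sgn_step (f x))))).
  by apply/funext => x; rewrite iterS /sgn_step; field.
apply: rmulZ; apply: rmulD; first exact: rmulZ.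
exact: (rmulZ (-1) (rmulM ih (rmulM ih ih))).
Qed.

Definition mset (A : set RB) := measurable A /\ rmultiplier (\1_A : RB -> R).

(** The sign s of [f] is a bounded limit of polynomials in [f], and the indicator of {f > 0} is (s^2
    + s) / 2. *)
Let mset_pos f : rmultiplier f -> (forall x, `|f x| <= 1) -> mset [set x | 0 < f x].
Proof.
move=> hf fb; have mf := rmul_meas hf.
have msg : measurable [set x | 0 < f x].
  have := mf measurableT _ (measurable_itv `]0, +oo[); rewrite setTI.
  by congr measurable; apply/seteqP; split => x /=; rewrite in_itv/= andbT.
split; first exact: msg.
have hs : rmultiplier (fun x => Num.sg (f x)).
  apply: (@rmul_limit (fun n x => iter n sgn_step (f x)) _ 1).
  - by move=> n; exact: rmul_iter.
  - by move=> n x; exact: iter_sgn_step_bound.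
  - apply: (@measurable_fun_cvg _ _ _ _ (fun n x => iter n sgn_step (f x))).
      by move=> n; apply: rmul_meas; exact: rmul_iter.
    by move=> x _; exact: iter_sgn_step_cvg.
  - by move=> x; rewrite normr_sg; case: (_ != 0).
  - by apply: aeW => x; exact: iter_sgn_step_cvg.
rewrite (_ : \1_ _ = (fun x => 2^-1 * (Num.sg (f x) * Num.sg (f x) + Num.sg (f x)))).
  exact: (rmulZ _ (rmulD (rmulM hs hs) hs)).
apply/funext => x; rewrite indicE; have [f0|f0|f0] := ltgtP 0 (f x).
- by rewrite mem_set// gtr0_sg// mulr1 (_ : 1 + 1 = 2)// mulVf// pnatr_eq0.
- by rewrite memNset//= ?ltr0_sg//; [by rewrite mulrNN mulr1 subrr mulr0|apply/negP; rewrite -leNgt ltW].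
- by rewrite memNset//= -f0 ?ltxx// sgr0 mul0r addr0 mulr0.
Qed.

Let msetC (A : set RB) : mset A -> mset (~` A).
Proof.
move=> [mA hA]; split; first exact: measurableC.
rewrite (_ : \1_ _ = (fun x => 1 + (-1) * \1_A x)).
  exact: (rmulD (rmul_cst 1) (rmulZ (-1) hA)).
by apply/funext => x; rewrite !indicE in_setC; case: (_ \in _); rewrite /= ?mulr1 ?mulr0 ?addr0 ?subrr// addrN.
Qed.

Let msetI (A B : set RB) : mset A -> mset B -> mset (A `&` B).
Proof.
move=> [mA hA] [mB hB]; split; first exact: measurableI.
by rewrite indicI; exact: (rmulM hA hB).
Qed.

Let msetU (A B : set RB) : mset A -> mset B -> mset (A `|` B).
Proof. by move=> hA hB; rewrite -[A `|` B]setCK setCU; exact: (msetC (msetI (msetC hA) (msetC hB))). Qed.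

Let msetT : mset setT.
Proof. by split; [exact: measurableT|rewrite indicT; exact: (rmul_cst 1)]. Qed.

Let mset0 : mset set0.
Proof. by rewrite -setCT; exact: (msetC msetT). Qed.

(** A constant sequence of indicators converges almost everywhere, so [rmul_limit] already absorbs
    null sets. *)
Let mset_ae (A B : set RB) : measurable A -> {ae nu, forall x, A x <-> B x} -> mset B -> mset A.
Proof.
move=> mA hAB [mB hB]; split; first exact: mA.
apply: (@rmul_limit (fun _ => \1_B) _ 1).
- by move=> _; exact: hB.
- by move=> _ x; rewrite indicE; case: (_ \in _); rewrite ?normr1 ?normr0.
- exact: measurable_indic.
- by move=> x; rewrite indicE; case: (_ \in _); rewrite ?normr1 ?normr0.
- apply: filterS hAB => x hx; rewrite (_ : \1_A x = \1_B x); first exact: cvg_cst.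
  rewrite !indicE; have -> // : (x \in A) = (x \in B).
  by apply/idP/idP => /set_mem/hx h; exact: mem_set.
Qed.

Hypothesis nuI : nu (@unit_interval R) = 1%E.

Let ae_unit : {ae nu, forall x : RB, 0 <= x < 1}.
Proof.
have mI : measurable (@unit_interval R : set RB) by exact: measurable_itv.
exists (~` @unit_interval R); split; first exact: measurableC.
  exact: measure_setC0 mI nu1 nuI.
by move=> x /= h I; apply: h; move: I; rewrite /unit_interval /= in_itv.
Qed.

Let sin_neg (x : R) : 2^-1 < x -> x < 1 -> sin (2 * pi * x) < 0.
Proof.
move=> x1 x2; have p0 := pi_gt0 R.
have -> : 2 * pi * x = (2 * pi * x - pi) + pi by rewrite subrK.
rewrite sinDpi oppr_lt0; apply: sin_gt0_pi; apply/andP; split; nra.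
Qed.

Let sin_nneg (x : R) : 0 <= x -> x <= 2^-1 -> 0 <= sin (2 * pi * x).
Proof.
by move=> x1 x2; have p0 := pi_gt0 R; apply: sin_ge0_pi; rewrite ?in_itv/=; apply/andP; split; nra.
Qed.

Let cos_lower (a x : R) : 0 <= a -> a <= 2^-1 -> 0 <= x -> x <= 2^-1 ->
  (cos (2 * pi * x) < cos (2 * pi * a)) = (a < x).
Proof.
move=> a0 a1 x0 x1; have p0 := pi_gt0 R.
rewrite ltr_cos ?in_itv/=; [|apply/andP; split; nra..].
by rewrite ltr_pM2l// mulr_gt0.
Qed.

Let cos_upper (a x : R) : 2^-1 <= a -> a <= 1 -> 2^-1 <= x -> x <= 1 ->
  (cos (2 * pi * a) < cos (2 * pi * x)) = (a < x).
Proof.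
move=> a0 a1 x0 x1; have p0 := pi_gt0 R.
have e (y : R) : cos (2 * pi * y) = cos (2 * pi * (1 - y)).
  rewrite -cosN -(cosD2pi (- _)); congr cos; rewrite -mulr_natl; ring.
by rewrite (e a) (e x) cos_lower ?ltrD2l ?ltrN2//; lra.
Qed.

(** On [0, 1) the sign of sin (2 pi x) separates the two halves of the period, and cos (2 pi x) is
    strictly monotone on each. Up to a null set the ray is therefore [N] together with [L] when a <=
    1/2, and the part of [N] in [G] when a > 1/2. *)
Let mset_ray (a : R) : mset `]a, +oo[.
Proof.
have mr : measurable (`]a, +oo[ : set RB) by exact: measurable_itv.
pose N := [set x : RB | 0 < - sin (2 * pi * x)].
have mN : mset N.
  apply: mset_pos => [|x]; last by rewrite normrN ler_norml sin_geN1 sin_le1.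
  by under eq_fun do rewrite -mulN1r; exact: (rmulZ (-1) rmul_sin).
(* The factor 1/2 keeps the function within [-1, 1], as [mset_pos] requires. *)
pose L := [set x : RB | 0 < 2^-1 * (cos (2 * pi * a) + (-1) * cos (2 * pi * x))].
have cb (y : R) : `|cos y| <= 1 by rewrite ler_norml cos_geN1 cos_le1.
have mL : mset L.
  apply: mset_pos => [|x].
    exact: (rmulZ _ (rmulD (rmul_cst _) (rmulZ (-1) rmul_cos))).
  have := cb (2 * pi * a); have := cb (2 * pi * x); rewrite !ler_norml.
  by move: (cos _) (cos _) => u v /andP[? ?] /andP[? ?]; apply/andP; split; lra.
pose G := [set x : RB | 0 < 2^-1 * (cos (2 * pi * x) + - cos (2 * pi * a))].
have mG : mset G.
  apply: mset_pos => [|x].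
    exact: (rmulZ _ (rmulD rmul_cos (rmul_cst (- cos (2 * pi * a))))).
  have := cb (2 * pi * a); have := cb (2 * pi * x); rewrite !ler_norml.
  by move: (cos _) (cos _) => u v /andP[? ?] /andP[? ?]; apply/andP; split; lra.
have LE x : L x <-> cos (2 * pi * x) < cos (2 * pi * a).
  by rewrite /L/= mulN1r pmulr_rgt0// subr_gt0.
have GE x : G x <-> cos (2 * pi * a) < cos (2 * pi * x).
  by rewrite /G/= pmulr_rgt0// subr_gt0.
have NE x : N x <-> sin (2 * pi * x) < 0 by rewrite /N/= oppr_gt0.
have [a0|a0] := ltP a 0.
  apply: (mset_ae mr _ msetT); apply: filterS ae_unit => x /andP[x0 _].
  by rewrite /= in_itv/= andbT; split => // _; exact: lt_le_trans x0.
have [a1|a1] := leP 1 a.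
  apply: (mset_ae mr _ mset0); apply: filterS ae_unit => x /andP[_ x1].
  by rewrite /= in_itv/= andbT; split => // ax; have := lt_trans ax x1; rewrite ltNge a1.
have [a2|a2] := leP a 2^-1.
  apply: (mset_ae mr _ (msetU mN mL)).
  apply: filterS ae_unit => x /andP[x0 x1]; rewrite /= in_itv/= andbT.
  have [x2|x2] := leP x 2^-1.
    split => [ax|[/NE|/LE]]; first by right; apply/LE; rewrite cos_lower.
      by rewrite ltNge sin_nneg.
    by rewrite cos_lower.
  by split => [_|_]; [left; apply/NE; exact: sin_neg|exact: le_lt_trans x2].
apply: (mset_ae mr _ (msetI mN mG)).
apply: filterS ae_unit => x /andP[x0 x1]; rewrite /= in_itv/= andbT.
have [x2|x2] := leP x 2^-1.
  split => [ax|[/NE]]; last by rewrite ltNge sin_nneg.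
  by have := lt_trans a2 (lt_le_trans ax x2); rewrite ltxx.
split => [ax|[_ /GE]]; last by rewrite cos_upper// ltW.
by split; [apply/NE; exact: sin_neg|apply/GE; rewrite cos_upper// ltW].
Qed.

Let mset_measurable (A : set RB) : measurable A -> mset A.
Proof.
have -> : (measurable : set (set RB)) = <<s RGenOInfty.G (R := R) >>.
  exact: RGenOInfty.measurableE.
move: A; apply: smallest_sub; last by move=> _ [x ->]; exact: mset_ray.
split.
- exact: mset0.
- by move=> A hA; rewrite setTD; exact: msetC.
- move=> A hA; pose B n := \big[setU/set0]_(i < n) A i.
  have hB n : mset (B n).
    rewrite /B; elim: n => [|n ih]; last by rewrite big_ord_recr/=; exact: (msetU ih (hA n)).
    by rewrite big_ord0; exact: mset0.
  have mU : measurable (\bigcup_k A k) by apply: bigcupT_measurable => k; have [] := hA k.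
  split; first exact: mU.
  apply: (@rmul_limit (fun n => \1_(B n)) _ 1).
  - by move=> n; have [] := hB n.
  - by move=> n x; rewrite indicE; case: (_ \in _); rewrite ?normr1 ?normr0.
  - exact: measurable_indic.
  - by move=> x; rewrite indicE; case: (_ \in _); rewrite ?normr1 ?normr0.
  - apply: aeW => x; apply: cvg_near_cst.
    have [[k _ Ak]|nA] := pselect ((\bigcup_k A k) x).
      exists k.+1 => // n /= kn; rewrite !indicE.
      have -> : x \in B n by apply/mem_set; rewrite /B -bigcup_mkord; exists k.
      by have -> : x \in \bigcup_k A k by apply/mem_set; exists k.
    exists 0%N => // n _; rewrite !indicE.
    have -> : (x \in B n) = false.
      by apply/negP => /set_mem; rewrite /B -bigcup_mkord => -[i _ Ai]; apply: nA; exists i.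
    by have -> : (x \in \bigcup_k A k) = false by apply/negP => /set_mem.
Qed.

Let vanishing_nnsfun (g : {nnsfun RB >-> R}) :
  vanishing (fun x => ((g x)%:C)%C) /\ hset H (fun x => ((g x)%:C)%C : R[i]^o).
Proof.
have fg : finite_set (range g) by exact: fimfunP.
pose F y x : R[i]^o := ((y%:C)%C * ((\1_(g @^-1` [set y]) x : R)%:C)%C).
have mA y : measurable (g @^-1` [set y]).
  by rewrite -[X in measurable X]setTI; apply: measurable_funP.
have hF y : hset H (F y).
  apply: (L2_bounded nu1 (M := `|y|)) => [|x].
    apply: cmeasM; first exact: cmeas_cst.
    by split; [exact: measurable_indic|exact: measurable_cst].
  rewrite normcM !cabs_real -[leRHS]mulr1 ler_wpM2l//.
  by rewrite indicE; case: (_ \in _); rewrite ?normr1 ?normr0.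
have vF y : vanishing (F y) by exact: (rmul_vanishing _ (mset_measurable (mA y)).2).
have -> : (fun x => ((g x)%:C)%C) = \sum_(y <- finmap.enum_fset (fset_set (range g))) F y.
  apply/funext => x; rewrite (fimfunE g x) (fsbig_finite _ _ fg)/=.
  rewrite rmorph_sum/=; elim: (finmap.enum_fset _) => [|y s ih]; first by rewrite !big_nil.
  by rewrite !big_cons ih rmorphM.
elim: (finmap.enum_fset _) => [|y s [ihv ihh]].
  by rewrite big_nil; split; [exact: vanishing0|exact: ph0].
rewrite big_cons -[F y]scale1r; split; first exact: (vanishing_lin 1 (hF y) ihh (vF y) ihv).
exact: (phL PH 1 (hF y) ihh).
Qed.

Let vanishing_nneg (g : RB -> R) : (forall x, 0 <= g x) ->
  hset H (fun x => ((g x)%:C)%C : R[i]^o) -> vanishing (fun x => ((g x)%:C)%C).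
Proof.
move=> g0 hg; have mg : measurable_fun setT g by have [] := L2_cmeas hg.
have mg' : measurable_fun setT (EFin \o g) by exact/measurable_EFinP.
pose gn := nnsfun_approx measurableT mg'.
have gcvg x : (fun n => gn n x) @ \oo --> g x.
  have /fine_cvgP[_] : EFin \o (fun n => gn n x) @ \oo --> (EFin \o g) x.
    by apply: cvg_nnsfun_approx => // y _; rewrite lee_fin.
  by [].
have gle n x : gn n x <= g x.
  have nd : nondecreasing_seq (fun n => gn n x).
    by move=> i j ij; have /lefP := nd_nnsfun_approx measurableT mg' ij; exact.
  have := nondecreasing_cvgn_le nd (cvgP _ (gcvg x)) n.
  by rewrite (cvg_lim _ (gcvg x)).
have hgn n := (vanishing_nnsfun (gn n)).2.
have hd n : hset H ((fun x => ((g x)%:C)%C : R[i]^o) - (fun x => ((gn n x)%:C)%C : R[i]^o)).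
  exact: (hsetB PH hg (hgn n)).
have dE n x : cabs (((fun x => ((g x)%:C)%C : R[i]^o) - (fun x => ((gn n x)%:C)%C : R[i]^o)) x) = g x - gn n x.
  change (cabs (((g x)%:C)%C - ((gn n x)%:C)%C : R[i]) = g x - gn n x).
  by rewrite -rmorphB cabs_real ger0_norm// subr_ge0.
have D0 : (fun n => \int[nu]_x ((g x - gn n x) ^+ 2)%:E)%E @ \oo --> 0%E.
  have := @dominated_convergence _ _ _ nu setT measurableT
    (fun n x => ((g x - gn n x) ^+ 2)%:E) (cst 0%E) (fun x => (cabs ((g x)%:C)%C ^+ 2)%:E).
  case.
  - by move=> n; apply/measurable_EFinP; apply: measurable_funX; exact: measurable_funB.
  - exact: measurable_cst.
  - apply: aeW => x _; apply: cvg_EFin; first exact: nearW.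
    rewrite (_ : fine \o _ = fun n => (g x - gn n x) * (g x - gn n x)); last first.
      by apply/funext => n; rewrite /= expr2.
    rewrite [X in _ --> X](_ : 0 = (g x - g x) * (g x - g x)); last by rewrite subrr mulr0.
    by apply: cvgM; apply: cvgB => //; exact: cvg_cst.
  - exact: L2_integrable hg.
  - apply: aeW => x n _ /=; rewrite lee_fin ger0_norm ?sqr_ge0//.
    rewrite ler_pXn2r ?nnegrE ?cabs_ge0 ?subr_ge0//.
    have := cabs_real (g x); rewrite /= => ->; rewrite ger0_norm// lerBlDr lerDl.
    by have : 0 <= gn n x by [].
  by move=> _ _; rewrite integral_cst//= mul0e.
apply: (vanishing_approx hg) => e e0.
have /fine_cvg/cvgrPdist_lt/(_ e e0) [n _ hn] := D0.
exists (fun x => ((gn n x)%:C)%C : R[i]^o); split; [exact: hgn|exact: (vanishing_nnsfun (gn n)).1|].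
have := hn n (leqnn n); rewrite /= sub0r normrN => /ltW; apply: le_trans.
apply: le_trans (ler_norm _) _; rewrite le_eqVlt; apply/orP; left; apply/eqP; congr (`|_|).
apply: EFin_inj; rewrite sqn_L2//; rewrite fineK.
  by apply: eq_integral => x _; rewrite dE.
rewrite (_ : (\int[nu]_x ((g x - gn n x) ^+ 2)%:E)%E =
   (sqn H ((fun x => ((g x)%:C)%C : R[i]^o) - (fun x => ((gn n x)%:C)%C : R[i]^o)))%:E)//.
by rewrite sqn_L2//; apply: eq_integral => x _; rewrite dE.
Qed.

Lemma stable_of_vanishing_ebar : stable nu.
Proof.
move=> f hf; change (vanishing f).
have [m1 m2] := L2_cmeas hf.
have piece (p : R[i] -> R) : measurable_fun setT (fun x => p (f x)) ->
    (forall z, `|p z| <= cabs z) -> vanishing (fun x => ((p (f x))%:C)%C) /\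
    hset H (fun x => ((p (f x))%:C)%C : R[i]^o).
  move=> mp pb.
  have sq (q : R[i] -> R) : measurable_fun setT (fun x => q (f x)) ->
     (forall z, 0 <= q z <= cabs z) -> hset H (fun x => ((q (f x))%:C)%C : R[i]^o).
    move=> mq qb; apply: (@L2_le _ _ _ _ _ (fun x => cabs (f x) ^+ 2)).
    - by split; [exact: mq|exact: measurable_cst].
    - move=> x; have /andP[q0 q1] := qb (f x).
      by rewrite cabs_real ger0_norm// ler_pXn2r// nnegrE cabs_ge0.
    - exact: L2_integrable.
  have mM (q : R[i] -> R) : measurable_fun setT (fun x => q (f x)) ->
     measurable_fun setT (fun x => Num.max (q (f x)) 0).
    by move=> mq; apply: measurable_maxr => //; exact: measurable_cst.
  have hmax (q : R[i] -> R) : (forall z, `|q z| <= cabs z) -> forall z, 0 <= Num.max (q z) 0 <= cabs z.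
    by move=> qb z; rewrite le_max lexx orbT ge_max cabs_ge0 andbT (le_trans (ler_norm _) (qb z)).
  have pN z : `|- p z| <= cabs z by rewrite normrN.
  have mN : measurable_fun setT (fun x => - p (f x)) by exact: measurableT_comp.
  have h1 := sq (fun z => Num.max (p z) 0) (mM p mp) (hmax p pb).
  have h2 := sq (fun z => Num.max (- p z) 0) (mM (fun z => - p z) mN) (hmax (fun z => - p z) pN).
  have v1 : vanishing (fun x => ((Num.max (p (f x)) 0)%:C)%C).
    by apply: vanishing_nneg h1 => x; rewrite le_max lexx orbT.
  have v2 : vanishing (fun x => ((Num.max (- p (f x)) 0)%:C)%C).
    by apply: vanishing_nneg h2 => x; rewrite le_max lexx orbT.
  have -> : (fun x => ((p (f x))%:C)%C) = (-1 : R[i]) *: ((fun x => ((Num.max (- p (f x)) 0)%:C)%C) : RB -> R[i]^o) +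
       (fun x => ((Num.max (p (f x)) 0)%:C)%C).
    apply/funext => x.
    change (((p (f x))%:C)%C = -1 * ((Num.max (- p (f x)) 0)%:C)%C + ((Num.max (p (f x)) 0)%:C)%C).
    rewrite mulN1r addrC -rmorphB; congr (real_complex _ _).
    by rewrite !maxEle oppr_le0; have [|] := leP (p (f x)) 0; have [|] := leP 0 (p (f x)); lra.
  split; first exact: (vanishing_lin _ h2 h1 v2 v1).
  exact: (phL PH _ h2 h1).
have [v1 h1] := piece _ m1 (@cabs_re R).
have [v2 h2] := piece _ m2 (@cabs_im R).
have -> : f = (Complex 0 1 : R[i]) *: ((fun x => ((Im (f x))%:C)%C) : RB -> R[i]^o) +
     (fun x => ((Re (f x))%:C)%C).
  apply/funext => x.
  change ((f x : R[i]) = Complex 0 1 * ((Im (f x))%:C)%C + ((Re (f x))%:C)%C).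
  by apply: complex_ext; rewrite ?cReD ?cImD ?cReM ?cImM /=; ring.
exact: (vanishing_lin _ h2 h1 v2 v1).
Qed.

End stability.

(** * Singular measures are stable *)

Section uniform_characters.
Context {R : realType}.
Local Notation RB := (measurableTypeR R).
Local Notation U := (uniform_prob (@ltr01 R)).

Let one_period (c : R) (g G : R -> R) : 0 < c -> continuous g -> (forall x, `|g x| <= 1) ->
  (forall x : R, is_derive x (1 : R) G (g x)) -> G 1 = G 0 ->
  (\int[U]_x (g x)%:E = 0)%E.
Proof.
have U1 : U setT = 1%E by exact: probability_setT.
move=> c0 cg g1 dG G01; have mg : measurable_fun setT g by exact: continuous_measurable_fun.
(* Adding 1 makes the integrand nonnegative, as [integral_uniform] requires; the added integral is
   removed afterwards. *)
have h : (\int[U]_x (1 + g x)%:E = 1)%E.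
  rewrite integral_uniform; first last.
  - by move=> x; rewrite lee_fin; have := g1 x; rewrite ler_norml => /andP[]; lra.
  - by apply/measurable_EFinP; apply: measurable_funD.
  have dF (x : R) : is_derive x (1 : R) (fun y => y + G y) (1 + g x).
    by have dGx := dG x; exact: is_deriveD.
  have cF : continuous (fun y => y + G y).
    by move=> x; apply: differentiable_continuous; apply/derivable1_diffP; have [] := dF x.
  rewrite (continuous_FTC2 (F := fun y => y + G y)) ?ltr01//.
  - by rewrite G01 subr0 invr1 mul1e -EFinB; congr EFin; lra.
  - by apply: continuous_subspaceT => x; apply: cvgD; [exact: cvg_cst|exact: cg].
  - split; [by move=> x _; have [] := dF x|exact: cvg_at_right_filter (cF 0)|exact: cvg_at_left_filter (cF 1)].
  - by move=> x _; rewrite derive1E; have [_ ->] := dF x.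
have ig : U.-integrable setT (EFin \o g).
  apply: measurable_bounded_integrable => //; first by rewrite [X in (X < _)%E]U1 ltry.
  by exists 1; split => // y y1 x _; exact: le_trans (g1 x) (ltW y1).
have i1 : U.-integrable setT (EFin \o cst 1) by exact: finite_measure_integrable_cst.
have : (\int[U]_x (1 + g x)%:E = \int[U]_x (cst 1 x)%:E + \int[U]_x (g x)%:E)%E.
  exact: (@integralD_EFin _ _ _ U setT measurableT (cst 1) g i1 ig).
have c1 : (\int[U]_x (cst 1 x)%:E = 1)%E.
  by have := @integral_cst _ _ _ U setT measurableT (1%:E); rewrite [X in (_ * X)%E]U1 mule1.
rewrite h c1.
have := integrable_fin_num measurableT ig; rewrite /=.
case: (\int[_]_x _)%E => [r _ /(congr1 fine)/= e|//|//].
by congr EFin; lra.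
Qed.

Lemma uniform_char_mean n : cintegral U (fun x => ((char_e n.+1 x : R[i])^*)%C) = 0.
Proof.
pose c : R := 2 * pi * n.+1%:R.
have c0 : 0 < c by rewrite !mulr_gt0// pi_gt0.
have cn0 : c != 0 by rewrite gt_eqF.
have mulc x : is_derive x (1 : R) (fun y => c * y) c.
  by apply: (is_derive_eq (is_deriveZ _ _)); rewrite /GRing.scale/= mulr1.
have contc : continuous (fun y : R => c * y).
  by move=> x; apply: cvgM; [exact: cvg_cst|exact: cvg_id].
have per : cos c = 1 /\ sin c = 0.
  suff : cexpi c = 1 by rewrite /cexpi => -[-> ->].
  rewrite /c mulr_natr; elim: n.+1 => [|m ih]; first by rewrite mulr0n cexpi0.
  by rewrite mulrS cexpiD ih mulr1 -[2 * pi]add0r cexpi_period cexpi0.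
have [cos1 sin1] := per.
have hc : (\int[U]_x (cos (c * x))%:E = 0)%E.
  apply: (@one_period c _ (fun x => c^-1 * sin (c * x))) => //.
  - move=> x; apply: continuous_comp; [exact: contc|exact: continuous_cos].
  - by move=> x; rewrite ler_norml cos_geN1 cos_le1.
  - move=> x; have := mulc x => dx.
    by apply: (is_derive_eq (is_deriveZ _ _)); rewrite /GRing.scale/= mulrCA mulVf// mulr1.
  - by rewrite mulr1 mulr0 sin1 sin0.
have hs : (\int[U]_x (sin (c * x))%:E = 0)%E.
  apply: (@one_period c _ (fun x => (- c^-1) * cos (c * x))) => //.
  - move=> x; apply: continuous_comp; [exact: contc|exact: continuous_sin].
  - by move=> x; rewrite ler_norml sin_geN1 sin_le1.
  - move=> x; have := mulc x => dx.
    apply: (is_derive_eq (is_deriveZ _ _)); rewrite /GRing.scale/=.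
    by field.
  - by rewrite mulr1 mulr0 cos1 cos0.
rewrite cintegralJ; last first.
  apply: (L2_cintg (probability_setT U)); apply: (L2_bounded (probability_setT U) (M := 1)).
    exact: cmeas_char_e.
  by move=> x; rewrite cabs_cexpi.
rewrite (_ : cintegral _ _ = 0) ?conjc0// /cintegral /char_e /cexpi /Rintegral/=.
by rewrite hc hs.
Qed.

(** For the uniform measure the trajectory of [ebar] runs through conjugate characters of mean 0, so
    all [bcoef] vanish. Driving the zero state by a single input 1 then forces C - 1 = 0. *)
Lemma uniform_kernel_mean (w : R[i]) : cabs w < 1 -> cintegral U (cauchy_kernel w) = 1.
Proof.
move=> w1; have U1 : U setT = 1%E by exact: probability_setT.
have trajE n : traj U ebar (fun=> 0) n = (fun x => ((char_e n.+1 x : R[i])^*)%C).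
  elim: n => [|n ih].
    by apply/funext => x; rewrite char_eS char_e0 cJM echiJ conjc1 mulr1.
  apply/funext => x; rewrite [LHS]/= ih /cstep uniform_char_mean subr0 addr0.
  by rewrite [in RHS]char_eS cJM echiJ.
have b0 n : bcoef U n = 0.
  by case: n => // n; rewrite /bcoef /coef /out trajE uniform_char_mean.
pose C := cintegral U (cauchy_kernel w).
have hz := ph0 (prehilbert_L2 U).
have lim : ccvg (fun N => - (C - 1)) (cintegral U (fun x => ((0 : hvec (L2 U)) x : R[i]) * cauchy_kernel w x)).
  have h := @traj_cauchy_cvg R U U1 0 (@delta R 0) w 1 w1 hz.
  have hd N : \sum_(n < N) cabs (@delta R 0 n) ^+ 2 <= 1.
    case: N => [|N]; first by rewrite big_ord0.
    rewrite big_ord_recl big1 ?addr0; last by move=> i _; rewrite [delta _ _](_ : _ = 0)// normc0 expr0n.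
    by rewrite /delta eqxx normc1 expr1n.
  have := h hd; rewrite -ccvgS -[X in _ -> X]ccvgS; congr ccvg; apply/funext => N.
  rewrite [X in C * X]big1; last first.
    by move=> i _; rewrite out_conv// conv_delta /bshift/= b0 mul0r.
  rewrite mulr0 sub0r big_ord_recl big1 ?addr0; last by move=> i _; rewrite [delta _ _](_ : _ = 0)// mul0r.
  by rewrite /delta eqxx expr0 !mulr1.
have := ccvg_unique lim (ccvg_cst _).
rewrite (_ : cintegral U _ = 0); last first.
  by rewrite -[RHS](cintegral_cst U1 0); congr cintegral; apply/funext => x; exact: mul0r.
by move/esym/eqP; rewrite oppr_eq0 subr_eq0 => /eqP.
Qed.

Lemma uniform_char_sqn (a : nat -> R[i]) N :
  (\int[U]_x (cabs (\sum_(n < N) a n * (char_e n x : R[i])) ^+ 2)%:E =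
   (\sum_(n < N) cabs (a n) ^+ 2)%:E)%E.
Proof.
have U1 : U setT = 1%E by exact: probability_setT.
have PH := prehilbert_L2 U.
have he n : hset (L2 U) (char_e n).
  by apply: (L2_bounded U1 (M := 1)); [exact: cmeas_char_e|move=> x; rewrite cabs_cexpi].
have dot m n : hdot (L2 U) (char_e m) (char_e n) = (m == n)%:R.
  wlog mn : m n / (m <= n)%N.
    move=> hw; have [mn|/ltnW nm] := leqP m n; first exact: hw.
    by rewrite (ph_dotJ PH (he n) (he m)) hw// eq_sym rmorph_nat.
  elim: m n mn => [|m ih] [|n] // mn.
  - by rewrite !char_e0 hdot_cst1 (cintegral_cst U1).
  - rewrite (ph_dotJ PH (he n.+1) (he 0%N)) char_e0 hdot_cst1 -cintegralJ ?uniform_char_mean//.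
    exact: L2_cintg U1 _ (he n.+1).
  - rewrite eqSS -ih// !L2_dotE; congr cintegral; apply/funext => x.
    by rewrite !char_eS cJM echiJ mulrACA echiK mul1r.
pose S : hvec (L2 U) := \sum_(n < N) a n *: (char_e n : RB -> R[i]^o).
have hS : hset (L2 U) S by apply: hset_sum => // n _; exact: hsetZ.
have SE x : S x = \sum_(n < N) a n * (char_e n x : R[i]).
  by rewrite /S; elim/big_ind2 : _ => // f u g v <- <-.
under eq_integral do rewrite -SE.
rewrite -sqn_L2//; congr EFin; rewrite /sqn {1}/S hdot_suml//; last by move=> n _; exact: hsetZ.
rewrite cRe_sum; apply: eq_bigr => n _; rewrite hdotZl//.
rewrite /S hdot_sumr//; last by move=> m _; exact: hsetZ.
have -> : \sum_(m < N) hdot (L2 U) (char_e n) (a m *: (char_e m : RB -> R[i]^o)) = ((a n)^*)%C.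
  rewrite (bigD1 n isT) big1 => [|m /andP[_ mn]].
    by rewrite Monoid.mulm1 (hdotZr PH (a n) (he n) (he n)) dot eqxx mulr1.
  have mn' : (m != n :> nat) by [].
  by rewrite (hdotZr PH (a m) (he n) (he m)) dot eq_sym (negbTE mn') mulr0.
by rewrite mulCJ.
Qed.

End uniform_characters.

Section probability_of_measure.
Context (R : realType) d (T : measurableType d) (m : {measure set T -> \bar R}).

(** Slices and marginals enter as plain measures with a proof of total mass 1. This copy carries the
    probability structure that the Fubini-Tonelli lemmas expect. *)
Definition prob_of (m1 : m setT = 1%E) : set T -> \bar R := m.

Variable m1 : m setT = 1%E.

HB.instance Definition _ := Measure.copy (prob_of m1) m.
HB.instance Definition _ := Measure_isProbability.Build _ _ _ (prob_of m1) m1.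

End probability_of_measure.

Lemma tonelli_prob (R : realType) d d' (X : measurableType d) (Y : measurableType d')
    (m : {measure set X -> \bar R}) (n : {measure set Y -> \bar R}) (f : X * Y -> \bar R) :
  m setT = 1%E -> n setT = 1%E -> measurable_fun setT f -> (forall z, 0 <= f z)%E ->
  (\int[m]_x \int[n]_y f (x, y) = \int[n]_y \int[m]_x f (x, y))%E.
Proof.
move=> m1 n1 mf f0.
exact: (@fubini_tonelli _ _ _ _ _ (prob_of m1) (prob_of n1) f mf f0).
Qed.

Section poisson.
Context {R : realType}.
Local Notation RB := (measurableTypeR R).

Definition poisson (w : R[i]) (t : RB) : R := 2 * Re (cauchy_kernel w t) - 1.

Lemma poisson_ge0 w t : cabs w < 1 -> 0 <= poisson w t.
Proof. by move=> w1; have := Re_cauchy_kernel_ge t w1; rewrite /poisson; lra. Qed.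

Lemma measurable_poisson w : measurable_fun setT (poisson w).
Proof.
apply: measurable_funB; last exact: measurable_cst.
by apply: measurable_funM; [exact: measurable_cst|have [] := cmeas_cauchy_kernel w].
Qed.

Lemma cabs_kernel_den r (x t : R) :
  cabs (1 - (r%:C)%C * (echi x : R[i]) * ebar t) ^+ 2 = (1 - r) ^+ 2 + 2 * r * (1 - cos (2 * pi * (x - t))).
Proof.
rewrite -mulrA -[(echi x : R[i]) * ebar t]cexpiD -mulrBr cabs_sqr cReB cImB cReM cImM /=.
rewrite !mul0r subr0 addr0 sub0r sqrrN.
have := cos2Dsin2 (2 * pi * (x - t)); move: (cos _) (sin _) => c s h.
have -> : (1 - r * c) ^+ 2 + (r * s) ^+ 2 = 1 - 2 * r * c + r ^+ 2 * (c ^+ 2 + s ^+ 2) by ring.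
by rewrite h; ring.
Qed.

Lemma poissonE r (x t : R) : 0 <= r -> r < 1 ->
  poisson ((r%:C)%C * (echi x : R[i])) t =
  (1 - r ^+ 2) / ((1 - r) ^+ 2 + 2 * r * (1 - cos (2 * pi * (x - t)))).
Proof.
move=> r0 r1; have cw y : cabs ((r%:C)%C * (echi y : R[i])) = r.
  by rewrite normcM cabs_echi mulr1 cabs_real ger0_norm.
rewrite /poisson Re_cauchy_kernel ?cw//; congr (_ * _).
by rewrite /cauchy_kernel -/(ebar t) normcV exprVn cabs_kernel_den.
Qed.

(** The kernel depends only on the cosine of the angle between the two points. This lets the point
    on the circle become the variable of integration, where the total mass is known. *)
Lemma poisson_sym r (x t : R) : 0 <= r -> r < 1 ->
  poisson ((r%:C)%C * (echi x : R[i])) t = poisson ((r%:C)%C * (echi t : R[i])) x.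
Proof.
move=> r0 r1; rewrite !poissonE//.
have -> // : cos (2 * pi * (x - t)) = cos (2 * pi * (t - x)).
by rewrite -cosN; congr (cos _); ring.
Qed.

(** The symmetries of the cosine about 0 and about half a period reduce [s] to [d, 1/2], where it
    decreases. *)
Lemma cos_away (d s : R) : 0 < d -> d <= `|s| -> `|s| <= 1 - d -> cos (2 * pi * s) <= cos (2 * pi * d).
Proof.
move=> d0 ds sd; have p0 := pi_gt0 R.
have -> : cos (2 * pi * s) = cos (2 * pi * `|s|).
  have [s0|s0] := leP 0 s; first by rewrite ger0_norm.
  by rewrite ltr0_norm// mulrN cosN.
move: (`|s|) ds sd => a da ad.
have mono (u : R) : d <= u -> u <= 2^-1 -> cos (2 * pi * u) <= cos (2 * pi * d).
  move=> du u2; rewrite leNgt ltr_cos ?in_itv/=; [|apply/andP; split; nra..].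
  by rewrite ltr_pM2l ?mulr_gt0// -leNgt.
have [a2|a2] := leP a 2^-1; first exact: mono.
have -> : cos (2 * pi * a) = cos (2 * pi * (1 - a)).
  rewrite -cosN -(cosD2pi (- _)); congr (cos _); rewrite -mulr_natl; ring.
by apply: mono; lra.
Qed.

End poisson.

Section singular_measures.
Context {R : realType}.
Local Notation RB := (measurableTypeR R).
Variable nu : {measure set RB -> \bar R}.
Hypothesis nu1 : nu setT = 1%E.
Local Notation H := (L2 nu).
Let PH : prehilbert H := prehilbert_L2 nu.
Local Notation C w := (cintegral nu (cauchy_kernel w)).
Local Notation U := (uniform_prob (@ltr01 R)).

(** [traj_kernel] for the zero state and a single input 1 at time 0: the outputs are the [bcoef],
    the final state has norm at most 1, and the factor 2 bounds |1/C|. *)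
Lemma bpoly_error (w : R[i]) N : cabs w < 1 ->
  cabs (\sum_(n < N.+1) bcoef nu n * w ^+ n - (1 - (C w)^-1)) <=
  2 * (1 - cabs w)^-1 * cabs w ^+ N.+1.
Proof.
move=> w1; have C0 := kernel_mean_neq0 nu1 w1; have hz := ph0 PH.
have := traj_kernel nu1 (@delta R 0) N.+1 w1 hz.
have -> : cintegral nu (fun x : RB => ((0 : hvec H) x : R[i]) * cauchy_kernel w x) = 0.
  by rewrite -[RHS](cintegral_cst nu1 0); congr cintegral; apply/funext => x; exact: mul0r.
have -> : \sum_(n < N.+1) @delta R 0 n * w ^+ n = 1.
  rewrite big_ord_recl big1 ?addr0; last by move=> i _; rewrite [delta _ _](_ : _ = 0)// mul0r.
  by rewrite /delta eqxx mul1r expr0.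
have -> : \sum_(n < N.+1) out nu 0 (@delta R 0) n * w ^+ n = \sum_(n < N.+1) bcoef nu n * w ^+ n.
  by apply: eq_bigr => n _; rewrite out_conv// conv_delta /bshift leq0n subn0.
set X := traj _ _ _ _; set B := \sum_(_ < _) _; move=> e.
have -> : B - (1 - (C w)^-1) = - ((C w)^-1 * (w ^+ N.+1 * cintegral nu (fun x => (X x : R[i]) * cauchy_kernel w x))).
  apply: (mulfI C0); rewrite mulrN mulrA mulfV// mul1r mulrBr mulrBr mulfV// mulr1.
  by apply/eqP; rewrite -subr_eq0 opprK; apply/eqP; apply: etrans (esym e); ring.
rewrite normcN normcM -mulrA; apply: ler_pM; rewrite ?cabs_ge0//.
  exact: cabs_kernel_meanV.
rewrite normcM cabsX mulrC ler_wpM2r ?exprn_ge0 ?cabs_ge0//.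
apply: le_trans (kernel_dot_le nu1 w1 (L2_traj nu1 _ _ hz)) _.
rewrite ler_piMl ?invr_ge0 ?subr_ge0 ?(ltW w1)// hnormE -sqrtr1 ler_wsqrtr//.
apply: le_trans (sqn_traj_le nu1 _ _ hz) _; rewrite {1}/sqn hdot0l// add0r.
rewrite big_ord_recl big1 ?addr0; last first.
  by move=> i _; rewrite [delta _ _](_ : _ = 0)// normc0 expr0n.
by rewrite /delta eqxx normc1 expr1n.
Qed.

Lemma poisson_mean (w : R[i]) : cabs w < 1 ->
  ((2 * Re (C w) - 1)%:E = \int[nu]_t (poisson w t)%:E)%E.
Proof.
move=> w1; have [i1 _] := L2_cintg nu1 (L2_cauchy_kernel nu1 w1).
have i2 : nu.-integrable setT (fun t => (2 * Re (cauchy_kernel w t))%:E).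
  by under eq_fun do rewrite EFinM; exact: integrableZl.
have i3 : nu.-integrable setT (fun t => (2 * Re (cauchy_kernel w t) - 1)%:E).
  under eq_fun do rewrite EFinB.
  by apply: integrableB => //; exact: (integrable_cst1 nu1 1).
rewrite -(fineK (integrable_fin_num measurableT i3)); congr EFin.
rewrite -[RHS]/(\int[nu]_t (2 * Re (cauchy_kernel w t) - 1)) RintegralB//; last first.
  exact: (integrable_cst1 nu1 1).
by rewrite RintegralZl// Rintegral_cst// nu1 mulr1.
Qed.

(* The key consequence of the Herglotz representation: where the Poisson
   integral of [nu] is small, the inner function has modulus close to 1. *)
Lemma inner_defect (w : R[i]) : cabs w < 1 ->
  1 - cabs (1 - (C w)^-1) ^+ 2 <= 4 * (2 * Re (C w) - 1).
Proof.
move=> w1; have C0 := kernel_mean_neq0 nu1 w1; have Cge := kernel_mean_ge nu1 w1.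
have Rge := Re_kernel_mean_ge nu1 w1.
move: (C w) C0 Cge Rge => c c0 cge rge.
have n0 : 0 < cabs c ^+ 2 by rewrite exprn_gt0// (lt_le_trans _ cge).
have -> : 1 - cabs (1 - c^-1) ^+ 2 = (2 * Re c - 1) / cabs c ^+ 2.
  have -> : 1 - c^-1 = (c - 1) / c by rewrite mulrBl mulfV// mul1r.
  rewrite normcM normcV exprMn exprVn.
  have -> : cabs (c - 1) ^+ 2 = cabs c ^+ 2 - 2 * Re c + 1.
    by rewrite !cabs_sqr cReB cImB /=; ring.
  by field; rewrite gt_eqF// (lt_le_trans _ cge).
rewrite ler_pdivrMr// mulrAC ler_peMl//; first by lra.
have : 2^-1 ^+ 2 <= cabs c ^+ 2 by rewrite ler_pXn2r ?nnegrE ?cabs_ge0.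
by move: (cabs c ^+ 2) => z; rewrite expr2; lra.
Qed.

(** Here B is the modulus of the truncated series, b that of the inner function, e the truncation
    error and P the bound on 1 - b^2. If e <= b <= 1, then (b - e)^2 >= b^2 - 2e; the remaining
    cases are crude. *)
Let perturbed_square (B b e P : R) : 0 <= B -> 0 <= b -> 0 <= e -> 0 <= P ->
  b <= B + e -> 1 - b ^+ 2 <= P -> 1 <= B ^+ 2 + 2 * e + P.
Proof.
move=> B0 b0 e0 P0 hb h2; have B2 := sqr_ge0 B; have e2 := sqr_ge0 e.
have [b1|b1] := leP 1 b.
  have [Be|Be] := leP (2^-1) e; first lra.
  have : (1 - e) ^+ 2 <= B ^+ 2 by rewrite ler_pXn2r // ?nnegrE; lra.
  by rewrite sqrrB; lra.
have [Be|Be] := leP e b.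
  have : (b - e) ^+ 2 <= B ^+ 2 by rewrite ler_pXn2r // ?nnegrE; lra.
  have : b * e <= e by rewrite ler_piMl// ltW.
  by rewrite sqrrB; lra.
have : b ^+ 2 <= e by rewrite expr2; nra.
lra.
Qed.

Lemma bpoly_lower (w : R[i]) N : cabs w < 1 ->
  1 <= cabs (\sum_(n < N.+1) bcoef nu n * w ^+ n) ^+ 2 +
       2 * (2 * (1 - cabs w)^-1 * cabs w ^+ N.+1) + 4 * (2 * Re (C w) - 1).
Proof.
move=> w1; have h1 := bpoly_error N w1; have h2 := inner_defect w1.
apply: perturbed_square h2; try exact: cabs_ge0.
- by apply: le_trans h1; exact: cabs_ge0.
- by rewrite mulr_ge0//; have := Re_kernel_mean_ge nu1 w1; lra.
- by rewrite -lerBlDl; apply: le_trans (cabs_leB _ _) _; rewrite cabs_subC.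
Qed.

End singular_measures.

Section singular_is_inner.
Context {R : realType}.
Local Notation RB := (measurableTypeR R).
Variable nu : {measure set RB -> \bar R}.
Hypothesis nu1 : nu setT = 1%E.
Hypothesis nuI : nu (@unit_interval R) = 1%E.
Hypothesis sing : singular nu.
Local Notation H := (L2 nu).
Let PH : prehilbert H := prehilbert_L2 nu.
Local Notation C w := (cintegral nu (cauchy_kernel w)).
Local Notation U := (uniform_prob (@ltr01 R)).

(** [nu] lives on a Lebesgue null set, which outer regularity covers by a small open [V]. Up to
    [nu]-mass [e], [nu] then sits on a set [K] at positive distance from the complement of an
    enlargement [W] of [V]. The upper bound 1 - del expresses separation on the circle, where 0 and
    1 coincide. *)
Lemma singular_separation (e : R) : 0 < e -> exists (W K : set RB) (del : R),
  [/\ measurable W /\ (lebesgue_measure W <= (5 * e)%:E)%E, measurable K,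
      (nu (~` K) <= e%:E)%E, 0 < del &
      forall x t, 0 <= x <= 1 -> ~ W x -> K t -> del <= `|x - t| <= 1 - del].
Proof.
move=> e0; have [S [mS S0 nS]] := sing.
have Sfin : (lebesgue_measure (S : set R) < +oo)%E by rewrite [X in (X < _)%E]S0 ltry.
have [V [oV SV VS]] := lebesgue_regularity_outer mS Sfin e0.
have mV : measurable (V : set RB) by exact: open_measurable.
pose I (a b : R) : set RB := `]a, b[%classic.
have mI a b : measurable (I a b) by exact: measurable_itv.
(* Neighbourhoods of both ends of the period are added to separate points across the identification
   of 0 with 1; the total length is at most e + 2e + 2e. *)
pose W : set RB := V `|` (I (- e) e `|` I (1 - e) (1 + e)).
have mO : measurable W by apply: measurableU => //; exact: measurableU.
have oO : open (W : set R).
  by apply: openU => //; apply: openU; exact: interval_open.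
have lI (a : R) : (lebesgue_measure (I (a - e)%R (a + e)%R) <= (2 * e)%:E)%E.
  rewrite /I lebesgue_measure_itv /=; case: ifP => _; last by rewrite lee_fin; lra.
  by rewrite -EFinB lee_fin; lra.
have lV : (lebesgue_measure V <= e%:E)%E.
  rewrite -(setDUK SV); apply: le_trans (measureU2 _ _ _) _ => //; first exact: measurableD.
  by rewrite -[X in _ + X]/(lebesgue_measure (V `\` S)) [X in (X + _)%E](_ : _ = 0%E)// add0e ltW.
have lO : (lebesgue_measure W <= (5 * e)%:E)%E.
  apply: le_trans (measureU2 _ _ _) _ => //; first exact: measurableU.
  rewrite (_ : 5 * e = e + (2 * e + 2 * e)); last by ring.
  rewrite 2!EFinD; apply: leeD => //; apply: le_trans (measureU2 _ _ _) _ => //.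
  by apply: leeD; [rewrite -[e in I _ e]add0r -[- e]add0r|]; exact: lI.
(* A point of the carrier is interior to [W], hence belongs to [K n] for large [n]; so the
   complements of the [K n] shrink to a set of [nu]-measure 0. *)
pose K (n : nat) : set RB := @unit_interval R `&` [set t | forall y, ~ W y -> n.+1%:R^-1 <= `|t - y|].
have mUI : measurable (@unit_interval R : set RB) by exact: measurable_itv.
have mK n : measurable (K n).
  apply: measurableI => //.
  rewrite (_ : [set t | _] = ~` (\bigcup_(y in ~` W) ball (y : R) n.+1%:R^-1)).
    apply: measurableC; apply: open_measurable; apply: bigcup_open => y _; exact: ball_open.
  apply/seteqP; split => t /=.
    by move=> h [y Oy]; rewrite /ball/= distrC ltNge h.
  move=> h y Oy; rewrite leNgt; apply/negP => ty; apply: h; exists y => //.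
  by rewrite /ball/= distrC.
have Kcvg : (nu \o (fun n => ~` K n)) @ \oo --> nu (\bigcap_n ~` K n).
  apply: nonincreasing_cvg_mu.
  - apply: (@le_lt_trans _ _ (nu setT)); last by rewrite nu1 ltry.
    by apply: le_measure; rewrite ?inE//; exact: measurableC.
  - by move=> n; exact: measurableC.
  - by apply: bigcapT_measurable => n; exact: measurableC.
  - move=> m n mn; apply/subsetPset => t /= h [t1 t2]; apply: h; split => // y /t2.
    by apply: le_trans; rewrite lef_pV2 ?posrE ?ltr0n// ler_nat.
have Klim : nu (\bigcap_n ~` K n) = 0%E.
  apply/eqP; rewrite eq_le measure_ge0 andbT.
  have -> : 0%E = (nu (~` @unit_interval R) + nu (~` S))%E.
    by rewrite (measure_setC0 mUI nu1 nuI) nS adde0.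
  apply: le_trans (measureU2 _ _ _); [|exact: measurableC|exact: measurableC].
  apply: le_measure; rewrite ?inE.
  - by apply: bigcapT_measurable => n; exact: measurableC.
  - by apply: measurableU; exact: measurableC.
  move=> t ht; have [It|] := pselect (@unit_interval R t); last by left.
  right => St; have Ot : W t by left; exact: SV.
  have := open_nbhs_nbhs (conj oO Ot); rewrite -nbhs_ballE => -[r /= r0 hr].
  have [n _ hn] := near_infty_natSinv_lt (PosNum r0).
  apply: (ht n Logic.I) => //; split => // y Oy; rewrite leNgt; apply/negP => ty; apply: Oy.
  by apply: hr; rewrite /ball/=; apply: lt_trans ty _; exact: (hn n (leqnn n)).
have [n hn] : exists n, (nu (~` K n) <= e%:E)%E.
  move: Kcvg; rewrite Klim => /fine_cvg/cvgrPdist_lt/(_ e e0) [n _ hn].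
  exists n; have := hn n (leqnn n); rewrite /= sub0r normrN => /ltW h.
  have fin : nu (~` K n) \is a fin_num.
    rewrite ge0_fin_numE//; apply: (@le_lt_trans _ _ (nu setT)); last by rewrite nu1 ltry.
    by apply: le_measure; rewrite ?inE//; exact: measurableC.
  by rewrite -(fineK fin) lee_fin; apply: le_trans h; exact: ler_norm.
(* The first entry of the minimum bounds the distance from below. Off [W] one has e <= x <= 1 - e,
   so the second bounds it from above. *)
exists W, (K n), (Num.min n.+1%:R^-1 e); split => //.
  by rewrite lt_min e0 andbT invr_gt0 ltr0n.
move=> x t /andP[x0 x1] Ox [It Kt]; apply/andP; split.
  by rewrite ge_min distrC Kt.
move: It; rewrite /unit_interval /= in_itv/= => /andP[t0 t1].
have xe : e <= x.
  rewrite leNgt; apply/negP => xe; apply: Ox; right; left.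
  by rewrite /I/= in_itv/= xe andbT; lra.
have xe' : x <= 1 - e.
  rewrite leNgt; apply/negP => xe'; apply: Ox; right; right.
  by rewrite /I/= in_itv/= xe'/=; lra.
apply: (@le_trans _ _ (1 - e)); last by rewrite lerD2l lerN2 ge_min lexx orbT.
by rewrite ler_norml; apply/andP; split; lra.
Qed.

(** The numerator 1 - r^2 is at most 2 (1 - r), and since 2r >= 1 the denominator is at least 1 -
    cos. *)
Lemma poisson_away (r del x t : R) : 2^-1 <= r -> r < 1 -> 0 < del ->
  del <= `|x - t| -> `|x - t| <= 1 - del ->
  poisson ((r%:C)%C * (echi x : R[i])) t <= 2 * (1 - r) / (1 - cos (2 * pi * del)).
Proof.
move=> r2 r1 d0 d1 d2; have r0 : 0 <= r by lra.
have p0 := pi_gt0 R; have k0 : 0 < 1 - cos (2 * pi * del).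
  have d3 : 0 <= pi * (1 - 2 * del) by apply: mulr_ge0; [exact: ltW|lra].
  have d4 : 0 < pi * del by rewrite mulr_gt0.
  have i0 : (0 : R) \in `[0, pi] by rewrite in_itv/= lexx ltW.
  have i1 : 2 * pi * del \in `[0, pi] by rewrite in_itv/=; apply/andP; split; nra.
  by rewrite subr_gt0 -[X in _ < X]cos0 ltr_cos// -mulrA mulr_gt0.
have := cos_away d0 d1 d2; rewrite poissonE//.
move: (cos _) (cos _) k0 => c k k0 ck.
have D : 1 - k <= (1 - r) ^+ 2 + 2 * r * (1 - c).
  by have := sqr_ge0 (1 - r); nra.
apply: (@le_trans _ _ ((1 - r ^+ 2) / (1 - k))).
  rewrite ler_wpM2l//; first by rewrite subr_ge0 exprn_ile1 ?(ltW r1).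
  by rewrite lef_pV2// posrE// (lt_le_trans k0 D).
rewrite ler_pM2r ?invr_gt0//; nra.
Qed.

(** [bpoly_lower] is averaged over the circle of radius r. By Parseval the average of the squared
    truncated series is at most the sum of the |b_n|^2 for n <= N, which is 1 minus the quantity to
    be bounded; the Poisson integral of [nu] must therefore be small on average. *)
Let estimate (e : R) : 0 < e -> exists N, sqn H (traj nu ebar (fun=> 0) N) <= 15 * e.
Proof.
move=> e0; have [W [K [del [[mO lO] mK nK d0 sep]]]] := singular_separation e0.
have p0 := pi_gt0 R.
(* Capped at 1/2 so that [2 * pi * d1] lies in [0, pi], where the cosine is strictly decreasing and
   hence k > 0. *)
pose d1 := Num.min del 2^-1.
have d10 : 0 < d1 by rewrite lt_min d0 invr_gt0 ltr0n.
have d12 : d1 <= 2^-1 by rewrite ge_min lexx orbT.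
have d1d : d1 <= del by rewrite ge_min lexx.
pose k := 1 - cos (2 * pi * d1).
have k0 : 0 < k.
  have d3 : 0 <= pi * (1 - 2 * d1) by apply: mulr_ge0; [exact: ltW|lra].
  have d4 : 0 < pi * d1 by rewrite mulr_gt0.
  have i0 : (0 : R) \in `[0, pi] by rewrite in_itv/= lexx ltW.
  have i1 : 2 * pi * d1 \in `[0, pi] by rewrite in_itv/=; apply/andP; split; nra.
  by rewrite subr_gt0 -[X in _ < X]cos0 ltr_cos// -mulrA mulr_gt0.
(* This is 1 - r: small enough for r >= 1/2 and for the bound 2 s / k of [poisson_away] to be at
   most [e]. *)
pose s := Num.min 2^-1 (e * k / 2).
have s0 : 0 < s by rewrite lt_min invr_gt0 ltr0n !mulr_gt0.
have s2 : s <= 2^-1 by rewrite ge_min lexx.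
have sk : 2 * s / k <= e.
  rewrite ler_pdivrMr// -ler_pdivlMl// mulrC.
  by rewrite ge_min lexx orbT.
pose r := 1 - s.
have r2 : 2^-1 <= r by rewrite /r; lra.
have r1 : r < 1 by rewrite /r; lra.
have r0 : 0 <= r by lra.
pose w (x : R) : R[i] := (r%:C)%C * (echi x : R[i]).
have cw x : cabs (w x) = r.
  by rewrite normcM cabs_echi mulr1 cabs_real ger0_norm.
have w1 x : cabs (w x) < 1 by rewrite cw.
have [N hN] : exists N, 2 * (2 * (1 - r)^-1 * r ^+ N.+1) <= e.
  have /cvgrPdist_le/(_ e e0) [N _ hN] := @cvg_geometric_le R r (2 * (2 * (1 - r)^-1)) r0 r1.
  exists N; have := hN N.+1 (leqnSn N); rewrite /= sub0r normrN => h.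
  by apply: le_trans h; rewrite [leLHS]mulrA ler_norm.
(* The Poisson integral of the part of [nu] off [K]; only its mean over [x] is shown to be small. *)
pose bad (x : RB) := (\int[nu]_t ((\1_(~` K) t : R) * poisson (w x) t)%:E)%E.
have bad0 x : (0 <= bad x)%E.
  apply: integral_ge0 => t _; rewrite lee_fin mulr_ge0 ?(poisson_ge0 _ (w1 _))//.
have mpois : measurable_fun setT (fun z : RB * RB => poisson (w z.1) z.2).
  apply: measurable_funB; last exact: measurable_cst.
  apply: measurable_funM; first exact: measurable_cst.
  suff [] : cmeas (fun z : RB * RB => cauchy_kernel (w z.1) z.2) by [].
  apply: cmeasV; apply: cmeasB; first exact: cmeas_cst.
  apply: cmeasM; first apply: cmeasM; first exact: cmeas_cst.
    exact: cmeas_comp measurable_fst cmeas_echi.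
  exact: cmeas_comp measurable_snd cmeas_ebar.
have mbadz : measurable_fun setT (fun z : RB * RB => ((\1_(~` K) z.2 : R) * poisson (w z.1) z.2)%:E).
  apply/measurable_EFinP; apply: measurable_funM => //.
  have mi : measurable_fun setT (\1_(~` K) : RB -> R) by apply: measurable_indic; exact: measurableC.
  exact: (measurableT_comp mi measurable_snd).
have badz0 (z : RB * RB) : (0 <= ((\1_(~` K) z.2 : R) * poisson (w z.1) z.2)%:E)%E.
  by rewrite lee_fin mulr_ge0 ?(poisson_ge0 _ (w1 _)).
have mbad : measurable_fun setT bad.
  exact: (@measurable_fun_fubini_tonelli_F _ _ _ _ _ (prob_of nu1) _ mbadz badz0).
have U1 : U setT = 1%E by exact: probability_setT.
have ibad : (\int[U]_x bad x <= e%:E)%E.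
  (* With [x] integrated first, the symmetry of the kernel gives mass 1 for every [t]; what remains
     is the [nu]-measure of the complement of [K]. *)
  rewrite (@tonelli_prob _ _ _ _ _ U nu _ U1 nu1 mbadz badz0) /=.
  apply: le_trans nK; rewrite -[X in nu X]setIT -integral_indic//; last exact: measurableC.
  rewrite le_eqVlt; apply/orP; left; apply/eqP; apply: eq_integral => t _.
  rewrite (eq_integral (fun x => ((\1_(~` K) t)%:E * (poisson (w t) x)%:E)%E)); last first.
    by move=> x _; rewrite EFinM (poisson_sym _ _ r0 r1).
  rewrite ge0_integralZl_EFin//; last first.
  - by apply/measurable_EFinP; exact: measurable_poisson.
  - by move=> x _; rewrite lee_fin (poisson_ge0 _ (w1 _)).
  rewrite -(poisson_mean U1 (w1 t)) (uniform_kernel_mean (w1 t)) /=.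
  by rewrite (_ : (2 * 1 - 1)%:E = 1%E) ?mule1//; congr EFin; lra.
have Ple (x : RB) : 0 <= x <= 1 -> ~ W x -> ((2 * Re (C (w x)) - 1)%:E <= e%:E + bad x)%E.
  move=> x01 Ox; rewrite (poisson_mean nu1 (w1 x)).
  have -> : (e%:E + bad x = \int[nu]_t (e%:E + ((\1_(~` K) t : R) * poisson (w x) t)%:E))%E.
    rewrite ge0_integralD//.
    - by rewrite integral_cst// nu1 mule1.
    - by move=> t _; rewrite lee_fin; apply: ltW.
    - by move=> t _; rewrite lee_fin mulr_ge0 ?(poisson_ge0 _ (w1 _)).
    - apply/measurable_EFinP; apply: measurable_funM; last exact: measurable_poisson.
      by apply: measurable_indic; exact: measurableC.
  apply: ge0_le_integral => //.
  - by move=> t _; rewrite lee_fin (poisson_ge0 _ (w1 _)).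
  - by apply/measurable_EFinP; exact: measurable_poisson.
  - apply/measurable_EFinP; apply: measurable_funD => //; apply: measurable_funM; last exact: measurable_poisson.
    by apply: measurable_indic; exact: measurableC.
  - move=> t _; rewrite -EFinD lee_fin indicE; have [Kt|Kt] := pselect (K t).
      rewrite memNset// mul0r addr0.
      have /andP[h1 h2] := sep _ _ x01 Ox Kt.
      apply: le_trans (@poisson_away r d1 x t r2 r1 d10 _ _) _.
      + exact: le_trans h1.
      + by apply: le_trans h2 _; rewrite lerD2l lerN2.
      + by rewrite (_ : 1 - r = s)// /r subKr.
    by rewrite mem_set// mul1r lerDr ltW.
pose B (x : RB) := cabs (\sum_(n < N.+1) bcoef nu n * w x ^+ n) ^+ 2.
have BE (x : RB) : B x = cabs (\sum_(n < N.+1) (bcoef nu n * ((r ^+ n)%:C)%C) * (char_e n x : R[i])) ^+ 2.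
  congr (cabs _ ^+ 2); apply: eq_bigr => n _; rewrite -mulrA; congr (_ * _).
  rewrite /w exprMn -rmorphXn; congr (_ * _).
  by elim: (n : nat) => [|m ih]; [rewrite char_e0|rewrite exprS ih char_eS].
have mB : measurable_fun setT B.
  apply: measurable_funX; apply: measurable_cabs; apply: cmeas_sum => n.
  apply: cmeasM; first exact: cmeas_cst.
  rewrite (_ : (fun x => w x ^+ n) = (fun x => ((r ^+ n)%:C)%C * (char_e n x : R[i]))).
    by apply: cmeasM; [exact: cmeas_cst|exact: cmeas_char_e].
  apply/funext => x; rewrite /w exprMn -rmorphXn; congr (_ * _).
  by elim: (n : nat) => [|m ih]; [rewrite char_e0|rewrite exprS ih char_eS].
have iB : (\int[U]_x (B x)%:E <= (1 - sqn H (traj nu ebar (fun=> 0) N))%:E)%E.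
  have -> : B = (fun x : RB => cabs (\sum_(n < N.+1) (bcoef nu n * ((r ^+ n)%:C)%C) * (char_e n x : R[i])) ^+ 2).
    by apply/funext.
  rewrite (uniform_char_sqn (fun n => bcoef nu n * ((r ^+ n)%:C)%C)) lee_fin.
  (* Since b_0 = 0, the coefficients of [b] up to index N are the first N outputs of [ebar], which
     has norm 1. *)
  have -> : 1 - sqn H (traj nu ebar (fun=> 0) N) = \sum_(n < N.+1) cabs (bcoef nu n) ^+ 2.
    rewrite big_ord_recl normc0 expr0n add0r.
    rewrite -[RHS]/(\sum_(n < N) cabs (out nu ebar (fun=> 0) n) ^+ 2).
    rewrite traj_sqn//; last exact: L2_ebar.
    rewrite sqn_ebar// big1 ?addr0// => n _; by rewrite normc0 expr0n.
  apply: ler_sum => n _; rewrite normcM exprMn cabs_real.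
  rewrite ler_piMr ?sqr_ge0// ger0_norm ?exprn_ge0//.
  by rewrite exprn_ile1 ?exprn_ge0// exprn_ile1// ltW.
(* A majorant of 1 on [0, 1]: on [W] through the indicator, elsewhere with 5e = e (truncation) + 4e
   (kernel at the points of [K]). The three error terms have means at most 5e, 5e and 4e, in all
   14e, within the stated 15e. *)
pose rhs (x : RB) := ((B x)%:E + ((\1_W x : R)%:E + ((5 * e)%:E + 4%:E * bad x)))%E.
have m1 : measurable_fun setT (fun x : RB => (4%:E * bad x)%E) by exact: measurable_funeM.
have n1 (x : RB) : (0 <= 4%:E * bad x)%E by rewrite mule_ge0.
have m2 : measurable_fun setT (fun x : RB => ((5 * e)%:E + 4%:E * bad x)%E).
  by apply: emeasurable_funD.
have n2 (x : RB) : (0 <= (5 * e)%:E + 4%:E * bad x)%E.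
  by rewrite adde_ge0// lee_fin; lra.
have mind : measurable_fun setT (fun x : RB => (\1_W x : R)%:E).
  by apply/measurable_EFinP; exact: measurable_indic.
have m3 : measurable_fun setT (fun x : RB => ((\1_W x : R)%:E + ((5 * e)%:E + 4%:E * bad x))%E).
  exact: emeasurable_funD.
have n3 (x : RB) : (0 <= (\1_W x : R)%:E + ((5 * e)%:E + 4%:E * bad x))%E.
  by rewrite adde_ge0// lee_fin.
have mB' : measurable_fun setT (fun x : RB => (B x)%:E) by exact/measurable_EFinP.
have nB (x : RB) : (0 <= (B x)%:E)%E by rewrite lee_fin sqr_ge0.
have mrhs : measurable_fun setT rhs by exact: emeasurable_funD.
have nrhs x : (0 <= rhs x)%E by rewrite adde_ge0.
have rhs1 x : 0 <= x <= 1 -> (1 <= rhs x)%E.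
  move=> x01; have [Ox|Ox] := pselect (W x).
    rewrite /rhs indicE mem_set//=; apply: le_trans (_ : _ <= 0 + (1 + 0))%E _.
      by rewrite adde0 add0e.
    by rewrite leeD// leeD.
  have := bpoly_lower nu1 N (w1 x); rewrite cw -/(B x) => h.
  rewrite /rhs indicE memNset//= add0e.
  apply: (@le_trans _ _ ((B x)%:E + (e%:E + 4%:E * (2 * Re (C (w x)) - 1)%:E))%E).
    rewrite -EFinM -!EFinD lee_fin; apply: le_trans h _.
    by rewrite -addrA lerD2l lerD2r.
  rewrite leeD2l// (_ : (5 * e)%:E + 4%:E * bad x = e%:E + 4%:E * (e%:E + bad x))%E.
    by rewrite leeD2l// lee_wpmul2l// Ple.
  have he : (0 <= e%:E)%E by rewrite lee_fin ltW.
  by rewrite (ge0_muleDr _ he (bad0 x)) addeA -EFinM -EFinD; congr (_%:E + _)%E; ring.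
have tot : (1 <= \int[U]_x rhs x)%E.
  rewrite integral_uniform// subr0 invr1 mul1e.
  rewrite (_ : 1%E = \int[lebesgue_measure]_(x in `[0%R, 1%R]) (cst 1%E) x)%E; last first.
    rewrite integral_cst//= ?lebesgue_measure_itv/= ?lte_fin ?ltr01 ?oppr0 ?adde0 ?mule1//.
  apply: ge0_le_integral => //; exact: measurable_funTS.
have iO : (\int[U]_x (\1_W x : R)%:E <= (5 * e)%:E)%E.
  rewrite integral_uniform// subr0 invr1 mul1e integral_indic//.
  by apply: le_trans lO; apply: le_measure; rewrite ?inE//; apply: measurableI.
exists N; rewrite -lee_fin.
have : (1 <= (1 - sqn H (traj nu ebar (fun=> 0) N))%:E + ((5 * e)%:E + ((5 * e)%:E + 4%:E * e%:E)))%E.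
  apply: le_trans tot _; rewrite /rhs ge0_integralD// leeD//.
  rewrite ge0_integralD// leeD// ge0_integralD//.
  rewrite leeD//.
    by rewrite integral_cst// [X in (_ * X)%E]U1 mule1.
  by rewrite ge0_integralZl_EFin// lee_wpmul2l.
  by move=> x _; rewrite lee_fin; lra.
by rewrite -EFinM -!EFinD !lee_fin; lra.
Qed.

(** The norms along a free trajectory decrease, so one small value suffices. *)
Lemma vanishing_ebar_singular : vanishing nu ebar.
Proof.
have mono n m : (n <= m)%N -> sqn H (traj nu ebar (fun=> 0) m) <= sqn H (traj nu ebar (fun=> 0) n).
  move=> /subnK <-; elim: (m - n)%N => [|j ih]; first by rewrite add0n.
  apply: le_trans ih; rewrite addSn.
  have hX := L2_traj nu1 (fun=> 0) (j + n) (L2_ebar nu1).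
  have := sqn_traj_le nu1 (fun=> 0) 1 hX; rewrite big1 ?addr0// => i _.
  by rewrite normc0 expr0n.
apply/cvgrPdist_le => e e0; have [N hN] := @estimate (e / 15) ltac:(by rewrite divr_gt0).
exists N => // n /= Nn; rewrite sub0r normrN ger0_norm; last by apply: (sqn_ge0 PH); apply: L2_traj => //; exact: L2_ebar.
by apply: le_trans (mono _ _ Nn) _; apply: le_trans hN _; rewrite mulrC divfK.
Qed.

Lemma stable_singular : stable nu.
Proof. exact: (stable_of_vanishing_ebar nu1 vanishing_ebar_singular nuI). Qed.

End singular_is_inner.

(** * Slices and disintegration *)

Section auxiliary_bound.
Context {R : realType}.
Local Notation RB := (measurableTypeR R).
Variable nu : {measure set RB -> \bar R}.
Hypothesis nu1 : nu setT = 1%E.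

Lemma cabs_cintegral_le (f : RB -> R[i]) (M : R) : cmeas f -> (forall x, cabs (f x) <= M) ->
  cabs (cintegral nu f) <= M.
Proof.
move=> mf fM; have M0 : 0 <= M by apply: le_trans (fM 0); exact: cabs_ge0.
have hf : hset (L2 nu) f by exact: L2_bounded fM.
have h1 : hset (L2 nu) (fun=> 1 : R[i]^o) by exact: L2_cst.
have := cauchy_schwarz (prehilbert_L2 nu) hf h1; rewrite hdot_cst1 => h.
rewrite -(@ler_pXn2r _ 2)// ?nnegrE ?cabs_ge0//; apply: le_trans h _.
have s1 : sqn (L2 nu) (fun=> 1 : R[i]^o) <= 1 ^+ 2.
  by apply: (sqn_bounded nu1) => [|x]; [exact: cmeas_cst|rewrite normc1].
rewrite -[leRHS]mulr1; apply: ler_pM; rewrite ?(sqn_ge0 (prehilbert_L2 nu))//.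
  exact: (sqn_bounded nu1).
by rewrite -[leRHS](expr1n _ 2).
Qed.

(** Each [pstep] at most doubles the supremum norm. The bound does not depend on the probability
    measure, so products with slice auxiliary functions are bounded on the whole plane. *)
Lemma cabs_auxiliary n : cmeas (auxiliary nu n : RB -> R[i]) /\
  forall x, cabs (auxiliary nu n x) <= 2 ^+ n.
Proof.
elim: n => [|n [m ih]].
  rewrite auxiliary0//; split => [|x]; first exact: cmeas_cst.
  by rewrite normc1.
have me : cmeas (fun x : RB => (echi x : R[i]) * auxiliary nu n x).
  by apply: cmeasM => //; exact: cmeas_echi.
have ce (x : RB) : cabs ((echi x : R[i]) * auxiliary nu n x) <= 2 ^+ n.
  by rewrite normcM cabs_echi mul1r.
rewrite auxiliaryS//; split => [|x]; first by apply: cmeasB => //; exact: cmeas_cst.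
rewrite /pstep; apply: le_trans (le_normcD _ _) _; rewrite exprS mulr_natl mulr2n normcN.
by apply: lerD => //; exact: cabs_cintegral_le.
Qed.

End auxiliary_bound.

Section kernel_measurability.
Context {R : realType}.
Local Notation RB := (measurableTypeR R).
Variable gamma : R.-pker RB ~> RB.
Local Notation RB2 := (RB * RB)%type.

Lemma gamma1 x : gamma x setT = 1%E.
Proof. exact: prob_kernel. Qed.

Lemma cmeas_fst (f : RB -> R[i]) : cmeas f -> cmeas (fun z : RB2 => f z.1).
Proof. exact: cmeas_comp measurable_fst. Qed.

Lemma cmeas_snd (f : RB -> R[i]) : cmeas f -> cmeas (fun z : RB2 => f z.2).
Proof. exact: cmeas_comp measurable_snd. Qed.

Lemma cmeas_slice (F : RB2 -> R[i]) x : cmeas F -> cmeas (fun y => F (x, y)).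
Proof. by apply: cmeas_comp; exact: measurable_pair1. Qed.

(** The kernel lemma applies to the positive and negative parts. Slices without a finite integral
    cause no trouble, as [fine] is measurable on the whole extended line. *)
Lemma measurable_slice_Rintegral (f : RB2 -> R) : measurable_fun setT f ->
  measurable_fun setT (fun x => Rintegral (gamma x) setT (fun y => f (x, y))).
Proof.
move=> mf; have mE : measurable_fun setT (EFin \o f) by exact/measurable_EFinP.
apply: (measurableT_comp (fine_measurable measurableT)).
under eq_fun do rewrite integralE.
apply: emeasurable_funB.
- have := measurable_fun_integral_sfinite_kernel _ gamma (funepos_ge0 _) (measurable_funepos mE).
  congr measurable_fun; apply/funext => x; apply: eq_integral => y _.
  by rewrite !funeposE.
- have := measurable_fun_integral_sfinite_kernel _ gamma (funeneg_ge0 _) (measurable_funeneg mE).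
  congr measurable_fun; apply/funext => x; apply: eq_integral => y _.
  by rewrite !funenegE.
Qed.

Lemma cmeas_slice_cintegral (F : RB2 -> R[i]) : cmeas F ->
  cmeas (fun x => cintegral (gamma x) (fun y => F (x, y))).
Proof. by move=> [m1 m2]; split; [exact: (measurable_slice_Rintegral m1)|exact: (measurable_slice_Rintegral m2)]. Qed.

Lemma cmeas_slice_traj (F : RB2 -> R[i]^o) (l : nat -> RB -> R[i]) n :
  cmeas F -> (forall k, cmeas (l k)) ->
  cmeas (fun z : RB2 => traj (gamma z.1) (fun y => F (z.1, y)) (fun k => l k z.1) n z.2 : R[i]).
Proof.
move=> mF ml; elim: n => [|n ih].
  by apply: (cmeas_comp (f := F) (p := fun z : RB2 => (z.1, z.2))) => //; exact: measurable_fun_pair.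
apply: cmeasM; first exact: cmeas_snd cmeas_ebar.
apply: cmeasD; last exact: cmeas_fst (ml n).
by apply: cmeasB => //; exact: (cmeas_fst (cmeas_slice_cintegral ih)).
Qed.

Lemma cmeas_slice_out (F : RB2 -> R[i]^o) (l : nat -> RB -> R[i]) n :
  cmeas F -> (forall k, cmeas (l k)) ->
  cmeas (fun x => out (gamma x) (fun y => F (x, y)) (fun k => l k x) n).
Proof. by move=> mF ml; exact: (cmeas_slice_cintegral (cmeas_slice_traj n mF ml)). Qed.

Lemma cmeas_slice_coef (F : RB2 -> R[i]^o) n : cmeas F ->
  cmeas (fun x => coef (gamma x) (fun y => F (x, y)) n).
Proof. by move=> mF; apply: cmeas_slice_out => // k; exact: cmeas_cst. Qed.

Lemma cmeas_slice_bcoef n : cmeas (fun x => bcoef (gamma x) n).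
Proof.
case: n => [|n]; first exact: cmeas_cst.
by apply: (@cmeas_slice_coef (fun z => ebar z.2)); exact: cmeas_snd cmeas_ebar.
Qed.

Lemma cmeas_slice_auxiliary n : cmeas (fun z : RB2 => auxiliary (gamma z.1) n z.2 : R[i]).
Proof.
elim: n => [|n ih].
  rewrite (_ : (fun _ => _) = fun=> 1); first exact: cmeas_cst.
  by apply/funext => z; rewrite (auxiliary0 (gamma1 _)).
rewrite (_ : (fun _ => _) = fun z : RB2 => (echi z.2 : R[i]) * auxiliary (gamma z.1) n z.2 -
    cintegral (gamma z.1) (fun y => (echi y : R[i]) * auxiliary (gamma z.1) n y)); last first.
  by apply/funext => z; rewrite (auxiliaryS (gamma1 _)).
have me : cmeas (fun z : RB2 => (echi z.2 : R[i]) * auxiliary (gamma z.1) n z.2).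
  by apply: cmeasM => //; exact: cmeas_snd cmeas_echi.
by apply: cmeasB => //; exact: (cmeas_fst (cmeas_slice_cintegral me)).
Qed.

End kernel_measurability.

Section cintegral_bound.
Context {R : realType} d (T : measurableType d) (nu : {measure set T -> \bar R}).

(** A unimodular factor u rotates the integral onto the positive axis, which reduces the claim to
    real parts. *)
Lemma cabs_cintegral (f : T -> R[i]) : cintg nu f ->
  ((cabs (cintegral nu f))%:E <= \int[nu]_x (cabs (f x))%:E)%E.
Proof.
move=> hf; set z := cintegral nu f; have [z0|z0] := eqVneq z 0.
  rewrite z0 normc0; apply: integral_ge0 => x _.
  by rewrite lee_fin cabs_ge0.
have n0 : cabs z != 0 by apply/eqP => /eq0_normc/eqP; rewrite (negPf z0).
pose u := (((cabs z)^-1)%:C)%C * (z^*)%C.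
have u1 : cabs u = 1.
  rewrite normcM cabs_real cabsJ ger0_norm ?invr_ge0 ?cabs_ge0//.
  exact: mulVf.
have -> : cabs z = Re (cintegral nu (fun x => u * f x)).
  rewrite cintegralZ// -/z /u -mulrA [X in _ * X]mulrC mulCJ -rmorphM expr2 mulrA mulVf//.
  by rewrite mul1r.
have [i1 i2] := cintgZ u hf.
rewrite -[leLHS]fineK//.
have -> : fine (Re (cintegral nu (fun x => u * f x)))%:E = fine (\int[nu]_x (Re (u * f x))%:E)%E by [].
rewrite fineK ?integrable_fin_num//.
apply: le_trans (lee_abs _) _; apply: le_trans (le_abse_integral _ _ _) _ => //.
  exact: measurable_int i1.
apply: ge0_le_integral => //.
- by apply: measurableT_comp => //; exact: measurable_int i1.
- by apply/measurable_EFinP; apply: measurable_cabs; exact: cintg_cmeas hf.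
- move=> x _; rewrite abse_EFin lee_fin.
  by apply: le_trans (cabs_re _) _; rewrite normcM u1 mul1r.
Qed.

(** The majorant takes extended values because in [slice_orthogonal] it is a sum of slice energies,
    which may be infinite on a null set. *)
Lemma cintegral_dominated (f : nat -> T -> R[i]) (g : T -> \bar R) :
  (forall n, cintg nu (f n)) -> measurable_fun setT g -> (\int[nu]_x g x < +oo)%E ->
  (forall n x, ((cabs (f n x))%:E <= g x)%E) ->
  {ae nu, forall x, ccvg (fun n => f n x) 0} ->
  ccvg (fun n => cintegral nu (f n)) 0.
Proof.
move=> hf mg gy fg f0.
have g0 x : (0 <= g x)%E by apply: le_trans (fg 0%N x); rewrite lee_fin cabs_ge0.
have mf n : measurable_fun setT (fun x => (cabs (f n x))%:E).
  by apply/measurable_EFinP; apply: measurable_cabs; exact: cintg_cmeas (hf n).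
have ig : nu.-integrable setT g.
  apply/integrableP; split=> //.
  by rewrite (eq_integral g)// => x _; rewrite gee0_abs.
have [|||_ _ h] := @dominated_convergence _ _ _ nu setT measurableT
    (fun n x => (cabs (f n x))%:E) (cst 0%E) g mf _ _ ig _.
- exact: measurable_cst.
- apply: filterS f0 => x hx _; apply: cvg_EFin; first exact: nearW.
  by apply: cvg_trans hx; apply: near_eq_cvg; apply: nearW => n; rewrite /= subr0.
- by apply: aeW => x n _; rewrite abse_EFin ger0_norm ?cabs_ge0.
have fin n : (\int[nu]_x (cabs (f n x))%:E)%E \is a fin_num.
  rewrite ge0_fin_numE; last by apply: integral_ge0 => x _; rewrite lee_fin cabs_ge0.
  apply: le_lt_trans gy; apply: ge0_le_integral => //.
  by move=> x _; rewrite lee_fin cabs_ge0.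
apply: (@ccvg_squeeze _ _ _ (fun n => fine (\int[nu]_x (cabs (f n x))%:E)%E)).
  by move=> n; rewrite subr0 -lee_fin fineK// cabs_cintegral.
by move: h; rewrite integral0 => /fine_cvg.
Qed.

End cintegral_bound.

Lemma ae_eq_integrable (R : realType) d (T : measurableType d) (nu : {measure set T -> \bar R})
    (f g : T -> \bar R) : measurable_fun setT g -> nu.-integrable setT f ->
  ae_eq nu setT f g -> nu.-integrable setT g.
Proof.
move=> mg /integrableP[mf fy] fg; apply/integrableP; split => //.
have mf' : measurable_fun setT (fun x => `|f x|%E) by exact: measurableT_comp.
have mg' : measurable_fun setT (fun x => `|g x|%E) by exact: measurableT_comp.
by rewrite -(ae_eq_integral _ _ measurableT mf' mg')//; exact: ae_eq_abse.
Qed.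

Section disintegration.
Context {R : realType}.
Local Notation RB := (measurableTypeR R).
Local Notation RB2 := (RB * RB)%type.
Variables (mu : probability RB2 R) (gamma : R.-pker RB ~> RB).
Hypothesis dis : forall f : RB2 -> \bar R, measurable_fun setT f ->
  (forall x, (0 <= f x)%E) ->
  (\int[mu]_x f x = \int[marginal1 mu]_x1 \int[gamma x1]_x2 f (x1, x2))%E.
Local Notation mu1 := (marginal1 mu).

Lemma measurable_slice_integral (p : RB2 -> R) : measurable_fun setT p -> (forall z, 0 <= p z) ->
  measurable_fun setT (fun x => (\int[gamma x]_y (p (x, y))%:E)%E).
Proof.
move=> mp p0; have mE : measurable_fun setT (EFin \o p) by exact/measurable_EFinP.
apply: (measurable_fun_integral_sfinite_kernel _ gamma _ mE) => z.
by rewrite lee_fin.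
Qed.

Lemma slice_integrable_ge0 (p : RB2 -> R) : (forall z, 0 <= p z) ->
  mu.-integrable setT (EFin \o p) ->
  mu1.-integrable setT (fun x => (\int[gamma x]_y (p (x, y))%:E)%E) /\
  {ae mu1, forall x, (gamma x).-integrable setT (fun y => (p (x, y))%:E)}.
Proof.
move=> p0 ip; have mE := measurable_int _ ip.
have mp : measurable_fun setT p by exact/measurable_EFinP.
have ig : mu1.-integrable setT (fun x => (\int[gamma x]_y (p (x, y))%:E)%E).
  apply/integrableP; split; first exact: measurable_slice_integral.
  rewrite (eq_integral (fun x => (\int[gamma x]_y (p (x, y))%:E)%E)); last first.
    by move=> x _; rewrite gee0_abs// integral_ge0// => y _; rewrite lee_fin.
  have <- := dis mE (fun z => p0 z).
  have /integrableP[_] := ip; congr (_ < _)%E; apply: eq_integral => z _.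
  by rewrite gee0_abs// lee_fin.
split=> //; have := integrable_ae measurableT ig; apply: filterS => x /(_ Logic.I) hx.
apply/integrableP; split.
  by apply/measurable_EFinP; apply: (measurableT_comp mp); exact: measurable_pair1.
rewrite (eq_integral (fun y => (p (x, y))%:E)); last by move=> y _; rewrite gee0_abs// lee_fin.
by rewrite ltey_eq hx.
Qed.

Lemma Rintegral_slice_ge0 (p : RB2 -> R) : (forall z, 0 <= p z) ->
  mu.-integrable setT (EFin \o p) ->
  mu1.-integrable setT (fun x => (Rintegral (gamma x) setT (fun y => p (x, y)))%:E) /\
  Rintegral mu setT p = Rintegral mu1 setT (fun x => Rintegral (gamma x) setT (fun y => p (x, y))).
Proof.
move=> p0 ip; have [ig _] := slice_integrable_ge0 p0 ip.
have mp : measurable_fun setT p by apply/measurable_EFinP; exact: measurable_int ip.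
have mG : measurable_fun setT (fun x => (Rintegral (gamma x) setT (fun y => p (x, y)))%:E).
  by apply/measurable_EFinP; exact: measurable_slice_Rintegral.
have aeG : ae_eq mu1 setT (fun x => (\int[gamma x]_y (p (x, y))%:E)%E)
    (fun x => (Rintegral (gamma x) setT (fun y => p (x, y)))%:E).
  have := integrable_ae measurableT ig; apply: filterS => x h _.
  by rewrite /Rintegral fineK// h.
split; first exact: (ae_eq_integrable mG ig aeG).
rewrite {1 2}/Rintegral; congr fine.
rewrite (dis (measurable_int _ ip) (fun z => p0 z)).
by apply: ae_eq_integral => //; exact: measurable_int ig.
Qed.

Lemma Rintegral_slice (f : RB2 -> R) : mu.-integrable setT (EFin \o f) ->
  mu1.-integrable setT (fun x => (Rintegral (gamma x) setT (fun y => f (x, y)))%:E) /\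
  Rintegral mu setT f = Rintegral mu1 setT (fun x => Rintegral (gamma x) setT (fun y => f (x, y))).
Proof.
move=> if_; have mf : measurable_fun setT f by apply/measurable_EFinP; exact: measurable_int if_.
(* The disintegration speaks of nonnegative functions, so [f] is written as (f + |f|) - |f|. Slice
   integrals subtract only where both slices are integrable, that is, almost everywhere. *)
pose q z := `|f z|; pose p z := f z + q z.
have q0 z : 0 <= q z by exact: normr_ge0.
have p0 z : 0 <= p z by rewrite /p /q -lerBlDl sub0r -normrN ler_norm.
have iq : mu.-integrable setT (EFin \o q) by exact: integrable_norm.
have ip : mu.-integrable setT (EFin \o p).
  exact: (integrableD measurableT if_ iq).
have [ip1 ep] := Rintegral_slice_ge0 p0 ip; have [iq1 eq] := Rintegral_slice_ge0 q0 iq.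
have [_ ap] := slice_integrable_ge0 p0 ip; have [_ aq] := slice_integrable_ge0 q0 iq.
have fE : f = (fun z => p z - q z) by apply/funext => z; rewrite /p addrK.
pose P x := Rintegral (gamma x) setT (fun y => p (x, y)).
pose Q x := Rintegral (gamma x) setT (fun y => q (x, y)).
pose F x := Rintegral (gamma x) setT (fun y => f (x, y)).
have mF : measurable_fun setT F by exact: measurable_slice_Rintegral.
have aeF : ae_eq mu1 setT (fun x => (P x - Q x)%:E) (fun x => (F x)%:E).
  apply: filterS2 ap aq => x h1 h2 _.
  rewrite /F fE; congr EFin; rewrite -/(P x); symmetry.
  exact: (RintegralB measurableT h1 h2).
have iPQ : mu1.-integrable setT (fun x => (P x - Q x)%:E).
  exact: (integrableB measurableT ip1 iq1).
have mFE : measurable_fun setT (fun x => (F x)%:E) by exact/measurable_EFinP.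
split; first exact: (ae_eq_integrable mFE iPQ aeF).
transitivity (Rintegral mu setT p - Rintegral mu setT q).
  by rewrite fE; exact: (RintegralB measurableT ip iq).
rewrite ep eq.
rewrite -(RintegralB measurableT ip1 iq1); rewrite /Rintegral; congr fine.
by apply: ae_eq_integral => //; exact: measurable_int iPQ.
Qed.

Lemma cintegral_slice (F : RB2 -> R[i]) : cintg mu F ->
  cintg mu1 (fun x => cintegral (gamma x) (fun y => F (x, y))) /\
  cintegral mu F = cintegral mu1 (fun x => cintegral (gamma x) (fun y => F (x, y))).
Proof.
move=> [i1 i2]; have [j1 e1] := Rintegral_slice i1; have [j2 e2] := Rintegral_slice i2.
by split; [split|rewrite /cintegral e1 e2].
Qed.

Lemma slice_L2 f : hset (L2 mu) f ->
  {ae mu1, forall x, hset (L2 (gamma x)) (fun y => f (x, y))}.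
Proof.
move=> hf; have [_] := slice_integrable_ge0 (fun z => sqr_ge0 (cabs (f z))) (L2_integrable hf).
apply: filterS => x h; apply: integrable_L2 => //.
by apply: cmeas_slice; exact: L2_cmeas hf.
Qed.

Lemma integral_marginal1 (f : RB -> \bar R) : measurable_fun setT f -> (forall x, (0 <= f x)%E) ->
  (\int[mu]_z f z.1 = \int[mu1]_x f x)%E.
Proof.
move=> mf f0; rewrite dis//; last exact: measurableT_comp mf measurable_fst.
apply: eq_integral => x _; rewrite -[RHS]mule1 -(gamma1 gamma x) -integral_cst//.
Qed.

End disintegration.

(** Multiplication by the inner function is contractive: starting from the zero state, the outputs
    cannot carry more energy than the inputs. *)
Lemma conv_bessel (R : realType) (nu : {measure set (measurableTypeR R) -> \bar R})
    (l : nat -> R[i]) N : nu setT = 1%E ->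
  \sum_(n < N) cabs (conv nu l n) ^+ 2 <= \sum_(n < N) cabs (l n) ^+ 2.
Proof.
move=> nu1; have PH := prehilbert_L2 nu; have h0 := ph0 PH.
under eq_bigr do rewrite -out_conv//.
rewrite (traj_sqn nu1 l N h0) (_ : sqn _ 0 = 0); last by rewrite /sqn (hdot0l PH h0).
rewrite sub0r gerDr oppr_le0; apply: (sqn_ge0 PH); exact: L2_traj.
Qed.

Section slices.
Context {R : realType}.
Local Notation RB := (measurableTypeR R).
Local Notation RB2 := (RB * RB)%type.
Variables (mu : probability RB2 R) (gamma : R.-pker RB ~> RB).
Hypothesis sq : on_unit_square mu.
Hypothesis sl : slice_measures mu gamma.
Hypothesis ss : slice_singular mu gamma.
Local Notation mu1 := (marginal1 mu).
Local Notation H1 := (L2 mu1).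
Let dis := sl.2.
Let P1 : prehilbert H1 := prehilbert_L2 mu1.
Let PH : prehilbert (L2 mu) := prehilbert_L2 mu.

Lemma marginal1_setT : mu1 setT = 1%E.
Proof. exact: probability_setT. Qed.
Let m1 := marginal1_setT.

Lemma marginal1_unit_interval : mu1 (@unit_interval R) = 1%E.
Proof.
have mI : measurable (@unit_interval R : set RB) by exact: measurable_itv.
apply/eqP; rewrite eq_le probability_le1//= -sq.
apply: le_measure; rewrite ?inE; [exact: measurableX| |by move=> z []].
by rewrite -[X in measurable X]setTI; exact: measurable_fst.
Qed.

Lemma stable_marginal1 : stable mu1.
Proof. exact: (stable_singular m1 marginal1_unit_interval ss.1). Qed.

Lemma stable_slice : {ae mu1, forall x, stable (gamma x)}.
Proof.
apply: filterS2 sl.1 ss.2 => x h1 h2.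
exact: (stable_singular (gamma1 gamma x) h1 h2).
Qed.

Definition slice_coef (f : RB2 -> R[i]^o) n : RB -> R[i]^o :=
  fun x => coef (gamma x) (fun y => f (x, y)) n.

Definition slice_conv (l : nat -> RB -> R[i]^o) n : RB -> R[i]^o :=
  fun x => conv (gamma x) (fun k => l k x) n.

(** If the slice of [f] is not square integrable, the right side is infinite; so the bound holds at
    every [x] and can be integrated. *)
Lemma slice_coef_bessel f N x : cmeas (f : RB2 -> R[i]) ->
  ((\sum_(n < N) cabs (slice_coef f n x) ^+ 2)%:E <=
   \int[gamma x]_y (cabs (f (x, y)) ^+ 2)%:E)%E.
Proof.
move=> mf; have [h|] := ltP (\int[gamma x]_y (cabs (f (x, y)) ^+ 2)%:E)%E +oo%E; last first.
  by rewrite leye_eq => /eqP ->; exact: leey.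
have hf : hset (L2 (gamma x)) (fun y => f (x, y)).
  by apply/L2P; split => //; exact: cmeas_slice.
rewrite -sqn_L2// lee_fin; exact: (bessel_coef (gamma1 gamma x)).
Qed.

Lemma sum_slice_coef f N : hset (L2 mu) f ->
  (\sum_(n < N) \int[mu1]_x (cabs (slice_coef f n x) ^+ 2)%:E <= (sqn (L2 mu) f)%:E)%E.
Proof.
move=> hf; have mf := L2_cmeas hf.
have mc n : measurable_fun setT (fun x => (cabs (slice_coef f n x) ^+ 2)%:E).
  by apply: measurable_cabs2; exact: cmeas_slice_coef.
rewrite -ge0_integral_sum//; last by move=> n x _; rewrite lee_fin sqr_ge0.
rewrite sqn_L2// dis; [|exact: measurable_cabs2|by move=> z; rewrite lee_fin sqr_ge0].
apply: ge0_le_integral => //.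
- by move=> x _; apply: sume_ge0 => n _; rewrite lee_fin sqr_ge0.
- by apply: emeasurable_sum.
- apply: (measurable_slice_integral gamma (p := fun z => cabs (f z) ^+ 2)) => [|z]; last exact: sqr_ge0.
  by apply/measurable_EFinP; exact: measurable_cabs2.
- by move=> x _; rewrite sumEFin; exact: slice_coef_bessel.
Qed.

Lemma L2_slice_coef f n : hset (L2 mu) f -> hset H1 (slice_coef f n).
Proof.
move=> hf; apply/L2P; split; first by apply: cmeas_slice_coef; exact: L2_cmeas hf.
apply: (@le_lt_trans _ _ (sqn (L2 mu) f)%:E); last exact: ltry.
apply: le_trans (sum_slice_coef n.+1 hf); rewrite big_ord_recr/= leeDr//.
apply: sume_ge0 => k _; apply: integral_ge0 => x _; rewrite lee_fin; exact: sqr_ge0.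
Qed.

Lemma L2_auxiliary_mul n k :
  hset (L2 mu) (fun z => (auxiliary (gamma z.1) n z.2 : R[i]) * auxiliary mu1 k z.1 : R[i]^o).
Proof.
apply: (@L2_bounded _ _ _ mu (probability_setT mu) _ (2 ^+ n * 2 ^+ k)).
  apply: cmeasM; first exact: cmeas_slice_auxiliary.
  exact: (cmeas_fst (cabs_auxiliary m1 k).1).
move=> z; rewrite normcM; apply: ler_pM; rewrite ?cabs_ge0//.
  exact: (cabs_auxiliary (gamma1 gamma z.1) n).2.
exact: (cabs_auxiliary m1 k).2.
Qed.

(** Integrating over the slice first turns the pairing with the slice auxiliary function into
    [slice_coef]; the remaining pairing with the auxiliary functions of the marginal is [V1]. *)
Lemma NCTE f n : hset (L2 mu) f -> NCT mu gamma f n = V1 mu1 (slice_coef f n).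
Proof.
move=> hf; rewrite V1E//; last exact: L2_slice_coef.
apply/funext => k; rewrite -hdot_auxiliary//; last exact: L2_slice_coef.
pose G (z : RB2) : R[i]^o := (auxiliary (gamma z.1) n z.2 : R[i]) * auxiliary mu1 k z.1.
have hG : hset (L2 mu) G by exact: L2_auxiliary_mul.
rewrite [LHS]L2_dotE L2_dotE (cintegral_slice dis (L2_mulJ hf hG)).2.
have i1 := (cintegral_slice dis (L2_mulJ hf hG)).1.
apply: ae_eq_cintegral; first exact: cintg_cmeas i1.
  by apply: cintg_cmeas; exact: L2_mulJ (L2_slice_coef n hf) (L2_auxiliary m1 k).
apply: filterS (slice_L2 dis hf) => x hx.
rewrite /slice_coef -(hdot_auxiliary (gamma1 gamma x) n hx) L2_dotE mulrC -cintegralZ.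
  by congr cintegral; apply/funext => y; rewrite /G cJM /= mulrA mulrC.
exact: L2_mulJ hx (L2_auxiliary (gamma1 gamma x) n).
Qed.

Lemma L2_slice_conv l n : (forall k, hset H1 (l k)) -> hset H1 (slice_conv l n).
Proof.
move=> hl.
have -> : slice_conv l n = \sum_(k < n.+1) (fun x => bcoef (gamma x) k * (l (n - k)%N x : R[i]) : R[i]^o).
  by apply/funext => x; rewrite fct_sumE.
apply: (hset_sum P1) => k _.
exact: (L2_bounded_mul (cmeas_slice_bcoef gamma k) (fun x => cabs_bcoef (gamma1 gamma x) k) (hl _)).1.
Qed.

Lemma sum_slice_conv l N : (forall k, hset H1 (l k)) ->
  \sum_(n < N) sqn H1 (slice_conv l n) <= \sum_(n < N) sqn H1 (l n).
Proof.
move=> hl.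
have E v : (forall k, hset H1 (v k)) -> (\sum_(n < N) sqn H1 (v n))%:E =
    (\int[mu1]_x (\sum_(n < N) cabs (v n x) ^+ 2)%:E)%E.
  move=> hv; rewrite -sumEFin (eq_bigr _ (fun n _ => sqn_L2 (hv n))) -ge0_integral_sum//.
  - by apply: eq_integral => x _; rewrite sumEFin.
  - by move=> n; apply: measurable_cabs2; exact: L2_cmeas (hv n).
  - by move=> n x _; rewrite lee_fin sqr_ge0.
have M v : (forall k, hset H1 (v k)) ->
    measurable_fun setT (fun x => (\sum_(n < N) cabs (v n x) ^+ 2)%:E).
  move=> hv; apply/measurable_EFinP; apply: measurable_sum => n.
  by apply/measurable_EFinP; apply: measurable_cabs2; exact: L2_cmeas (hv n).
have hc k : hset H1 (slice_conv l k) by exact: L2_slice_conv.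
rewrite -lee_fin !E//; apply: ge0_le_integral => //.
- by move=> x _; rewrite lee_fin; apply: sumr_ge0 => n _; exact: sqr_ge0.
- exact: M.
- exact: M.
- by move=> x _; rewrite lee_fin; exact: (conv_bessel _ _ (gamma1 gamma x)).
Qed.

Lemma power_slice_conv l : hset (power_space H1) l -> hset (power_space H1) (slice_conv l).
Proof.
move=> [hl ly]; split=> [n|]; first exact: L2_slice_conv.
apply: (@nneseries_bounded_lty _ _ (fine (\sum_(0 <= n <oo) ((@hnorm _ H1 (l n)) ^+ 2)%:E)%E)).
  by move=> n; exact: sqr_ge0.
move=> N; apply: le_trans (nneseries_partial_le N (fun n => sqr_ge0 _) ly).
under eq_bigr do rewrite (hnorm_sqr P1 (L2_slice_conv _ hl)).
under [leRHS]eq_bigr do rewrite (hnorm_sqr P1 (hl _)).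
exact: sum_slice_conv.
Qed.

Lemma power_slice_coef f : hset (L2 mu) f -> hset (power_space H1) (slice_coef f).
Proof.
move=> hf; split=> [n|]; first exact: L2_slice_coef.
apply: (@nneseries_bounded_lty _ _ (sqn (L2 mu) f)) => N; first exact: sqr_ge0.
rewrite -lee_fin; apply: le_trans (sum_slice_coef N hf); rewrite -sumEFin.
by apply: lee_sum => n _; rewrite (hnorm_sqr P1) ?sqn_L2//; exact: L2_slice_coef.
Qed.

(** For almost every [x] the slice is stable and [conv_dot_cvg] applies to it; dominated convergence
    carries the limit through the integral over [x]. *)
Lemma slice_orthogonal f l : hset (L2 mu) f -> hset (power_space H1) l ->
  ccvg (fun N => \sum_(n < N) hdot H1 (slice_coef f n) (slice_conv l n)) 0.
Proof.
move=> hf [hl ly]; have mf := L2_cmeas hf.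
have hh n : hset H1 (slice_coef f n) by exact: L2_slice_coef.
have hy n : hset H1 (slice_conv l n) by exact: L2_slice_conv.
pose phi N x := \sum_(n < N) (slice_coef f n x : R[i]) * ((slice_conv l n x)^*)%C.
have ip n : cintg mu1 (fun x => (slice_coef f n x : R[i]) * ((slice_conv l n x)^*)%C).
  exact: (L2_mulJ (hh n) (hy n)).
have -> : (fun N => \sum_(n < N) hdot H1 (slice_coef f n) (slice_conv l n)) =
    (fun N => cintegral mu1 (phi N)).
  by apply/funext => N; rewrite /phi cintegral_sum//; apply: eq_bigr => n _; rewrite L2_dotE.
(* The energies of the slices of [f] and of [l] bound the partial sums uniformly in N, by Bessel and
   by [conv_bessel] respectively. *)
pose a x := (\int[gamma x]_y (cabs (f (x, y)) ^+ 2)%:E)%E.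
pose b x := (\sum_(0 <= n <oo) (cabs (l n x) ^+ 2)%:E)%E.
have ml n : measurable_fun setT (fun x => (cabs (l n x) ^+ 2)%:E).
  by apply: measurable_cabs2; exact: L2_cmeas (hl n).
have ma : measurable_fun setT a.
  apply: (measurable_slice_integral gamma (p := fun z => cabs (f z) ^+ 2)) => [|z]; last exact: sqr_ge0.
  by apply/measurable_EFinP; exact: measurable_cabs2.
have a0 x : (0 <= a x)%E by apply: integral_ge0 => y _; rewrite lee_fin sqr_ge0.
have mb : measurable_fun setT b by apply: ge0_emeasurable_sum => [n x _ _|n _]; [rewrite lee_fin sqr_ge0|exact: ml].
have b0 x : (0 <= b x)%E by apply: nneseries_ge0 => n _ _; rewrite lee_fin sqr_ge0.
have ay : (\int[mu1]_x a x < +oo)%E.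
  rewrite -(dis (f := fun z => (cabs (f z) ^+ 2)%:E)) -?sqn_L2 ?ltry//.
    exact: measurable_cabs2.
  by move=> z; rewrite lee_fin sqr_ge0.
have by_ : (\int[mu1]_x b x < +oo)%E.
  rewrite integral_nneseries//; last by move=> n x _; rewrite lee_fin sqr_ge0.
  apply: le_lt_trans ly; rewrite le_eqVlt; apply/orP; left; apply/eqP.
  by apply: eq_eseriesr => n _; rewrite -sqn_L2// -(hnorm_sqr P1).
have bfin : {ae mu1, forall x, (b x < +oo)%E}.
  have ib : mu1.-integrable setT b.
    by apply/integrableP; split=> //; rewrite (eq_integral b)// => x _; rewrite gee0_abs.
  have := integrable_ae measurableT ib; apply: filterS => x /(_ Logic.I).
  by rewrite ge0_fin_numE.
apply: (@cintegral_dominated _ _ _ _ phi (fun x => (a x + b x)%E)).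
- by move=> N; exact: cintg_sum.
- exact: emeasurable_funD.
- by rewrite ge0_integralD// lte_add_pinfty.
- move=> N x; rewrite /phi.
  apply: (@le_trans _ _ (\sum_(n < N) (cabs (slice_coef f n x) ^+ 2 + cabs (slice_conv l n x) ^+ 2))%:E).
    rewrite lee_fin; apply: le_trans (cabs_sum _ _ _) _; apply: ler_sum => n _.
    rewrite normcM cabsJ.
    have := sqr_ge0 (cabs (slice_coef f n x) - cabs (slice_conv l n x)).
    have := cabs_ge0 (slice_coef f n x); have := cabs_ge0 (slice_conv l n x).
    move: (cabs _) (cabs _) => u v; nra.
  rewrite big_split/= EFinD; apply: leeD; first exact: slice_coef_bessel.
  apply: (@le_trans _ _ (\sum_(n < N) cabs (l n x) ^+ 2)%:E).
    by rewrite lee_fin; exact: (conv_bessel _ _ (gamma1 gamma x)).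
  rewrite -sumEFin -(big_mkord xpredT (fun n => (cabs (l n x) ^+ 2)%:E)).
  by apply: nneseries_lim_ge => n _ _; rewrite lee_fin sqr_ge0.
- apply: filterS2 (filterI stable_slice (slice_L2 dis hf)) bfin => x [sx fx] bx.
  apply: (@conv_dot_cvg _ _ (gamma1 gamma x) sx (fun y => f (x, y)) (fun k => l k x)) => //.
  exact/H2P.
Qed.

End slices.

(** * The de Branges operator *)

Section bounded_operators.
Context {R : realType} (H K : hilbert R) (PK : prehilbert K) (PH : prehilbert H).

(** Linearity of an operator holds only up to [heq], so [T f - T g] is compared with [T (f - g)] in
    norm. *)
Lemma bounded_heq (T : hvec H -> hvec K) f g : bounded_operator T ->
  hset H f -> hset H g -> @heq _ H f g -> @heq _ K (T f) (T g).
Proof.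
move=> [Th Tl [M TM]] hf hg; rewrite {1}/heq => fg; have hfg := hsetB PH hf hg.
have h1 := hsetB PK (Th _ hf) (Th _ hg).
have n0 : @hnorm _ K (T (f - g)) = 0.
  have := TM _ hfg; rewrite fg mulr0 => h.
  by apply/eqP; rewrite eq_le h hnorm_ge0.
have := Tl (-1) g f hg hf; rewrite !scaleN1r -![- _ + _]addrC /heq => n1.
apply/eqP; rewrite eq_le hnorm_ge0 andbT.
have -> : T f - T g = T (f - g) - (T (f - g) - (T f - T g)) by rewrite opprB addrCA subrr addr0.
apply: le_trans (hnormD PK _ _) _; [exact: Th|exact: (hsetN PK (hsetB PK (Th _ hfg) h1))|].
by rewrite n0 hnormN ?n1 ?addr0//; exact: (hsetB PK (Th _ hfg) h1).
Qed.

End bounded_operators.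

Section adjoint_shift.
Context {R : realType}.
Local Notation RB := (measurableTypeR R).
Local Notation RB2 := (RB * RB)%type.
Variables (mu : probability RB2 R) (gamma : R.-pker RB ~> RB).
Hypothesis dis : forall f : RB2 -> \bar R, measurable_fun setT f ->
  (forall x, (0 <= f x)%E) ->
  (\int[mu]_x f x = \int[marginal1 mu]_x1 \int[gamma x1]_x2 f (x1, x2))%E.
Local Notation mu1 := (marginal1 mu).
Local Notation H1 := (L2 mu1).
Local Notation H := (L2 mu).
Let P1 : prehilbert H1 := prehilbert_L2 mu1.
Let PH : prehilbert H := prehilbert_L2 mu.
Local Notation Sstar := (adjoint H H (@mul_e2 R mu)).
Local Notation C w x := (cintegral (gamma x) (cauchy_kernel w)).

Let kmul (w : R[i]) (f : RB2 -> R[i]^o) : RB2 -> R[i]^o :=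
  fun z => cauchy_kernel w z.2 * (f z : R[i]).

(** Multiplication by [ebar] in the second variable satisfies the adjoint relation; the selected
    adjoint has the same inner products, hence agrees with it almost everywhere. *)
Lemma adjoint_mul_e2 k : hset H k ->
  hset H (Sstar k) /\ {ae mu, forall z, Sstar k z = (ebar z.2 : R[i]) * k z}.
Proof.
pose E (f : RB2 -> R[i]^o) : RB2 -> R[i]^o := fun z => (ebar z.2 : R[i]) * f z.
have EP f : hset H f -> hset H (E f) /\ forall h, hset H h -> hdot H (mul_e2 h) f = hdot H h (E f).
  move=> hf; split.
    have [] // := L2_bounded_mul (cmeas_snd (@cmeas_ebar R)) (M := 1) _ hf.
    by move=> z; rewrite cabs_ebar.
  move=> h hh; rewrite !L2_dotE; congr cintegral; apply/funext => z.
  by rewrite /mul_e2 /E -[cexpi _]/(echi z.2 : R[i]) cJM ebarJ mulrCA mulrA.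
have spec : (forall f, hset H f -> hset H (Sstar f) /\ forall h, hset H h -> hdot H (mul_e2 h) f = hdot H h (Sstar f)).
  exact: (@xgetPex _ _ [set T' | forall k, hset H k -> hset H (T' k) /\
    forall h, hset H h -> hdot H (mul_e2 h) k = hdot H h (T' k)] (ex_intro _ E EP)).
move=> hk; have [hS dS] := spec _ hk; have [hE dE] := EP _ hk; split=> //.
apply/(heq_L2 hS hE); apply: (heq_of_dot PH) => // h hh.
by rewrite (ph_dotJ PH hh hS) (ph_dotJ PH hh hE) -dS// -dE.
Qed.

Lemma L2_embed1 a : hset H1 a -> hset H (embed1 a : hvec H).
Proof.
case/L2P=> ma ia; apply/L2P; split; first exact: (cmeas_fst ma).
rewrite -(integral_marginal1 dis) in ia => //; first exact: measurable_cabs2.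
by move=> x; rewrite lee_fin sqr_ge0.
Qed.

Lemma L2_kmul (w : R[i]) f : cabs w < 1 -> hset H f ->
  hset H (kmul w f) /\ sqn H (kmul w f) <= (1 - cabs w)^-1 ^+ 2 * sqn H f.
Proof.
move=> w1; apply: L2_bounded_mul; first exact: (cmeas_snd (cmeas_cauchy_kernel w)).
by move=> z; exact: cabs_cauchy_kernel.
Qed.

Lemma resolvent_inverse (w : R[i]) : cabs w < 1 ->
  @inverse_operator _ H (fun f => f - w *: Sstar f) (kmul w).
Proof.
move=> w1; have hT f : hset H f -> hset H (f - w *: Sstar f).
  by move=> hf; apply: (hsetB PH) => //; apply: (hsetZ PH); exact: (adjoint_mul_e2 hf).1.
split; first split.
- by move=> f hf; exact: (L2_kmul w1 hf).1.
- move=> a f g hf hg; apply/heq_L2.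
  + by apply: (L2_kmul w1 _).1; exact: phL.
  + by apply: (phL PH); exact: (L2_kmul w1 _).1.
  apply: aeW => z; rewrite /kmul.
  change (cauchy_kernel w z.2 * (a * (f z : R[i]) + g z) = a * (cauchy_kernel w z.2 * (f z : R[i])) + cauchy_kernel w z.2 * g z).
  by ring.
- exists (1 - cabs w)^-1 => f hf; have [hk sk] := L2_kmul w1 hf.
  have v0 : 0 <= (1 - cabs w)^-1 by rewrite invr_ge0 subr_ge0 ltW.
  rewrite -(@ler_pXn2r _ 2)// ?nnegrE ?mulr_ge0 ?hnorm_ge0//.
  by rewrite exprMn !(hnorm_sqr PH).
move=> h hh; have [hk _] := L2_kmul w1 hh; have [hS eS] := adjoint_mul_e2 hh.
have [hSk eSk] := adjoint_mul_e2 hk.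
have kE z : cauchy_kernel w z * (1 - w * ebar z) = 1 by apply: mulVf; exact: cauchy_kernel_den.
split; apply/heq_L2 => //; try exact: hT.
- apply: filterS eSk => z e.
  change (kmul w h z - w * Sstar (kmul w h) z = h z :> R[i]).
  rewrite e /kmul -[RHS]mul1r -(kE z.2); ring.
- exact: (L2_kmul w1 (hT _ hh)).1.
- apply: filterS eS => z e.
  change (cauchy_kernel w z.2 * (h z - w * Sstar h z) = h z :> R[i]).
  rewrite e -[RHS]mul1r -(kE z.2); ring.
Qed.

Lemma cmeas_slice_mean (w : R[i]) : cmeas (fun x => C w x).
Proof. exact: (cmeas_slice_cintegral gamma (cmeas_snd (cmeas_cauchy_kernel w))). Qed.

Lemma cabs_slice_mean (w : R[i]) x : cabs w < 1 -> cabs (C w x) <= (1 - cabs w)^-1.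
Proof.
move=> w1; apply: (cabs_cintegral_le (gamma1 gamma x)); first exact: cmeas_cauchy_kernel.
by move=> y; exact: cabs_cauchy_kernel.
Qed.

Lemma L2_slice_mean (w : R[i]) a : cabs w < 1 -> hset H1 a ->
  hset H1 (fun x => C w x * (a x : R[i])).
Proof.
move=> w1 ha; exact: (L2_bounded_mul (cmeas_slice_mean w) (fun x => cabs_slice_mean x w1) ha).1.
Qed.

Lemma resolvent_dot (w : R[i]) a c : cabs w < 1 -> hset H1 a -> hset H1 c ->
  let u := operator_inv H (fun f => f - w *: Sstar f) (embed1 a) in
  hdot H (u + w *: Sstar u) (embed1 c) =
  2 * hdot H1 (fun x => C w x * (a x : R[i])) c - hdot H1 a c.
Proof.
move=> w1 ha hc u; have hea := L2_embed1 ha; have hec := L2_embed1 hc.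
have [[hU _ _] invU] : @inverse_operator _ H (fun f => f - w *: Sstar f)
    (operator_inv H (fun f => f - w *: Sstar f)).
  exact: (@xgetPex _ _ [set T' | @inverse_operator _ H (fun f => f - w *: Sstar f) T']
    (ex_intro _ _ (resolvent_inverse w1))).
have hu : hset H u by exact: hU.
have [hSu eS] := adjoint_mul_e2 hu; have [hk _] := L2_kmul w1 hea.
have hT : hset H (u - w *: Sstar u) by apply: (hsetB PH) => //; exact: hsetZ.
have /(heq_L2 hT hea) eT := (invU _ hea).1.
have hKa : hset H (2 *: kmul w (embed1 a) - embed1 a).
  by apply: (hsetB PH) => //; exact: hsetZ.
have hl : hset H (u + w *: Sstar u) by apply: (hsetD PH) => //; exact: hsetZ.
have e : @heq _ H (u + w *: Sstar u) (2 *: kmul w (embed1 a) - embed1 a).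
  apply/heq_L2 => //; apply: filterS2 eS eT => z e1 e2.
  change (u z + w * Sstar u z = 2 * (cauchy_kernel w z.2 * (embed1 a z : R[i])) - embed1 a z :> R[i]).
  have {}e2 : u z - w * Sstar u z = embed1 a z :> R[i] by exact: e2.
  have kE : cauchy_kernel w z.2 * (1 - w * ebar z.2) = 1 by apply: mulVf; exact: cauchy_kernel_den.
  rewrite -e2 e1; have -> : cauchy_kernel w z.2 * ((u z : R[i]) - w * ((ebar z.2 : R[i]) * u z)) = u z.
    by rewrite -[RHS]mul1r -kE; ring.
  by ring.
rewrite (heq_dotl PH hl hKa hec e) (hdotBl PH (hsetZ PH 2 hk) hea hec) (hdotZl PH 2 hk hec).
have hmean := L2_slice_mean w1 ha.
congr (2 * _ - _).
  rewrite L2_dotE L2_dotE (cintegral_slice dis (L2_mulJ hk hec)).2; congr cintegral; apply/funext => x.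
  rewrite -[RHS]mulrA [RHS]mulrC -cintegralZ.
    by congr cintegral; apply/funext => y; rewrite /kmul /embed1/= -mulrA mulrC.
  exact: (L2_cintg (gamma1 gamma x) (L2_cauchy_kernel (gamma1 gamma x) w1)).
rewrite L2_dotE L2_dotE (cintegral_slice dis (L2_mulJ hea hec)).2; congr cintegral; apply/funext => x.
exact: (cintegral_cst (gamma1 gamma x) ((a x : R[i]) * ((c x)^*)%C)).
Qed.

End adjoint_shift.

Section deBranges_coefficients.
Context {R : realType}.
Local Notation RB := (measurableTypeR R).
Local Notation RB2 := (RB * RB)%type.
Variables (mu : probability RB2 R) (gamma : R.-pker RB ~> RB).
Hypothesis dis : forall f : RB2 -> \bar R, measurable_fun setT f ->
  (forall x, (0 <= f x)%E) ->
  (\int[mu]_x f x = \int[marginal1 mu]_x1 \int[gamma x1]_x2 f (x1, x2))%E.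
Local Notation mu1 := (marginal1 mu).
Local Notation H1 := (L2 mu1).
Variable B : nat -> hvec H1 -> hvec H1.
Hypothesis deB : deBranges_operator mu B.
Let P1 : prehilbert H1 := prehilbert_L2 mu1.
Local Notation C w x := (cintegral (gamma x) (cauchy_kernel w)).

Let binner (w : R[i]) x : R[i] := 1 - (C w x)^-1.

Let cmeas_binner w : cmeas (binner w).
Proof.
by apply: cmeasB; [exact: cmeas_cst|apply: cmeasV; exact: cmeas_slice_mean].
Qed.

Let cabs_binner w x : cabs w < 1 -> cabs (binner w x) <= 3.
Proof.
move=> w1; apply: le_trans (le_normcD _ _) _; rewrite normcN normc1.
by have := cabs_kernel_meanV (gamma1 gamma x) w1; move: (cabs _) => u; lra.
Qed.

Let L2_binner w a : cabs w < 1 -> hset H1 a -> hset H1 (fun x => binner w x * (a x : R[i])).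
Proof.
by move=> w1 ha; exact: (L2_bounded_mul (cmeas_binner w) (fun x => cabs_binner x w1) ha).1.
Qed.

Definition slice_mul n (a : RB -> R[i]^o) : RB -> R[i]^o :=
  fun x => bcoef (gamma x) n * (a x : R[i]).

Lemma L2_slice_mul n a : hset H1 a -> hset H1 (slice_mul n a).
Proof.
move=> ha.
exact: (L2_bounded_mul (cmeas_slice_bcoef gamma n) (fun x => cabs_bcoef (gamma1 gamma x) n) ha).1.
Qed.

Let Bw_sum (w : R[i]) : cabs w < 1 -> operator_sum_to B w (operator_eval B w).
Proof.
rewrite -cabs_lt1 => w1; have [[_ hB] _] := deB.
exact: (@xgetPex _ _ [set T | operator_sum_to B w T] (hB _ w1)).
Qed.

(** With a' = a / C and v = (1 - B(w))^-1 a', the defining relation makes v + B(w) v equal to 2a -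
    a', while v - B(w) v = a'. Adding gives v = a, and then B(w) a = a - a / C. *)
Let Bw_dot (w : R[i]) a c : cabs w < 1 -> hset H1 a -> hset H1 c ->
  hdot H1 (operator_eval B w a) c = hdot H1 (fun x => binner w x * (a x : R[i])) c.
Proof.
move=> w1 ha hc; have [bBw _] := Bw_sum w1; have [hBw _ _] := bBw.
have [_ hdB] := deB; have [invw dotw] := hdB w ltac:(by rewrite cabs_lt1).
pose a' : RB -> R[i]^o := fun x => (C w x)^-1 * (a x : R[i]).
have mCV : cmeas (fun x => (C w x)^-1) by apply: cmeasV; exact: cmeas_slice_mean.
have ha' : hset H1 a'.
  exact: (L2_bounded_mul mCV (fun x => cabs_kernel_meanV (gamma1 gamma x) w1) ha).1.
have Ca' : (fun x => C w x * (a' x : R[i])) = a :> (RB -> R[i]^o).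
  apply/funext => x; rewrite /a' mulrA mulfV ?mul1r//.
  exact: (kernel_mean_neq0 (gamma1 gamma x) w1).
have [[hV _ _] invV] : @inverse_operator _ H1 (fun f => f - operator_eval B w f)
    (operator_inv H1 (fun f => f - operator_eval B w f)).
  exact: (@xgetPex _ _ [set T' | @inverse_operator _ H1 (fun f => f - operator_eval B w f) T'] invw).
pose v := operator_inv H1 (fun f => f - operator_eval B w f) a'.
have hv : hset H1 v by exact: hV.
have hBv := hBw _ hv; have hBa := hBw _ ha.
have e1 c' : hset H1 c' -> hdot H1 v c' - hdot H1 (operator_eval B w v) c' = hdot H1 a' c'.
  move=> hc'; rewrite -(hdotBl P1 hv hBv hc').
  exact: (heq_dotl P1 (hsetB P1 hv hBv) ha' hc' (invV _ ha').1).
have e2 c' : hset H1 c' -> hdot H1 v c' + hdot H1 (operator_eval B w v) c' =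
    2 * hdot H1 a c' - hdot H1 a' c'.
  move=> hc'; rewrite -(hdotDl P1 hv hBv hc') -Ca' -(resolvent_dot dis w1 ha' hc').
  by symmetry; exact: (dotw a' c' ha' hc').
have two0 : (2 : R[i]) != 0 by rewrite pnatr_eq0.
have e3 c' : hset H1 c' -> hdot H1 v c' = hdot H1 a c'.
  move=> hc'; apply: (mulfI two0); have h1 := e1 _ hc'; have h2 := e2 _ hc'.
  rewrite -[RHS](subrK (hdot H1 a' c')) -h2 -h1; ring.
have va : @heq _ H1 v a by apply: (heq_of_dot P1).
rewrite -(heq_dotl P1 hBv hBa hc (bounded_heq P1 P1 bBw hv ha va)).
have -> : (fun x => binner w x * (a x : R[i])) = (a - a' : hvec H1).
  by apply/funext => x; rewrite /binner mulrBl mul1r.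
by rewrite (hdotBl P1 ha ha' hc) -e3// -e1//; ring.
Qed.

(** Both sequences of inner products are Taylor coefficients of w |-> <B(w) a, c>: one by
    convergence in operator norm, the other by [bpoly_error], which is uniform over the slices. *)
Lemma deBranges_coefficientE n a : hset H1 a -> hset H1 (B n a) /\ @heq _ H1 (B n a) (slice_mul n a).
Proof.
move=> ha; have [[bB _] _] := deB.
have hB k : hset H1 (B k a) by have [hBk _ _] := bB k; exact: hBk.
have hm k : hset H1 (slice_mul k a) by exact: L2_slice_mul.
split=> //; apply: (heq_of_dot P1) => // c hc.
suff h : (fun k => hdot H1 (B k a) c) = (fun k => hdot H1 (slice_mul k a) c).
  exact: (congr1 (@^~ n) h).
apply: (@pseries_unique _ _ _ (fun w => hdot H1 (operator_eval B w a) c)) => w; rewrite cabs_lt1 => w1.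
- have [bBw sBw] := Bw_sum w1; have [hBw _ _] := bBw.
  have hS N : hset H1 (\sum_(k < N) w ^+ k *: B k a).
    by apply: (hset_sum P1) => k _; exact: hsetZ.
  apply/(@csum_toP _ (fun k => hdot H1 (B k a) c * w ^+ k)).
  have sE N : \sum_(k < N) hdot H1 (B k a) c * w ^+ k = hdot H1 (\sum_(k < N) w ^+ k *: B k a) c.
    rewrite (hdot_suml P1) => [|k _|//]; last exact: hsetZ.
    by apply: eq_bigr => k _; rewrite (hdotZl P1)// mulrC.
  pose K := @hnorm _ H1 a * @hnorm _ H1 c.
  have K0 : 0 <= K by rewrite mulr_ge0 ?hnorm_ge0.
  apply/cvgrPdist_le => e e0.
  have eK : 0 < e / (K + 1) by rewrite divr_gt0// ltr_wpDl.
  apply: filterS (sBw _ eK) => N hN; rewrite sub0r normrN ger0_norm ?cabs_ge0//.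
  rewrite sE -(hdotBl P1 (hS N) (hBw _ ha) hc).
  apply: le_trans (cauchy_schwarz_norm P1 (hsetB P1 (hS N) (hBw _ ha)) hc) _.
  apply: (@le_trans _ _ (e / (K + 1) * K)).
    by rewrite /K mulrA ler_wpM2r ?hnorm_ge0//; exact: hN.
  rewrite mulrAC ler_pdivrMr ?ltr_wpDl// ler_wpM2l ?(ltW e0)//.
  by rewrite lerDl.
- rewrite Bw_dot//; have hb := L2_binner w1 ha.
  have hS N : hset H1 (\sum_(k < N) w ^+ k *: slice_mul k a).
    by apply: (hset_sum P1) => k _; exact: hsetZ.
  apply/(@csum_toP _ (fun k => hdot H1 (slice_mul k a) c * w ^+ k)).
  have sE N : \sum_(k < N) hdot H1 (slice_mul k a) c * w ^+ k =
      hdot H1 (\sum_(k < N) w ^+ k *: slice_mul k a) c.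
    rewrite (hdot_suml P1) => [|k _|//]; last exact: hsetZ.
    by apply: eq_bigr => k _; rewrite (hdotZl P1)// mulrC.
  pose E N := 2 * (1 - cabs w)^-1 * cabs w ^+ N.
  have E0 : E @ \oo --> 0 by apply: cvg_geometric_le; [exact: cabs_ge0|].
  (* The sequence is shifted by one because [bpoly_error] is stated for N + 1 terms. *)
  suff h : ccvg (fun N => \sum_(k < N.+1) hdot H1 (slice_mul k a) c * w ^+ k)
      (hdot H1 (fun x => binner w x * (a x : R[i])) c).
    by rewrite /ccvg -cvg_shiftS.
  apply: (@ccvg_squeeze _ _ _ (fun N => E N.+1 * (@hnorm _ H1 a * @hnorm _ H1 c))); last first.
    rewrite -(mul0r (@hnorm _ H1 a * @hnorm _ H1 c)); apply: cvgM; last exact: cvg_cst.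
    by rewrite (cvg_shiftS E).
  move=> N; rewrite sE -(hdotBl P1 (hS _) hb hc).
  apply: le_trans (cauchy_schwarz_norm P1 (hsetB P1 (hS _) hb) hc) _.
  rewrite mulrA ler_wpM2r ?hnorm_ge0//.
  have EN0 : 0 <= E N.+1.
    apply: mulr_ge0; last by apply: exprn_ge0; exact: cabs_ge0.
    by apply: mulr_ge0 => //; rewrite invr_ge0 subr_ge0 ltW.
  have dE : \sum_(k < N.+1) w ^+ k *: slice_mul k a - (fun x => binner w x * (a x : R[i])) =
      (fun x => (\sum_(k < N.+1) bcoef (gamma x) k * w ^+ k - binner w x) * (a x : R[i])) :> (RB -> R[i]^o).
    apply/funext => x; rewrite mulrBl mulr_suml; congr (_ - _); rewrite fct_sumE.
    by apply: eq_bigr => k _; rewrite mulrAC mulrC.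
  have EA0 : 0 <= E N.+1 * @hnorm _ H1 a by rewrite (mulr_ge0 EN0)// hnorm_ge0.
  rewrite -(@ler_pXn2r _ 2)// ?nnegrE ?hnorm_ge0//.
  rewrite exprMn !(hnorm_sqr P1)//; last exact: hsetB.
  rewrite dE; apply: (L2_bounded_mul _ _ ha).2.
    apply: cmeasB; last exact: cmeas_binner.
    apply: cmeas_sum => k; apply: cmeasM; [exact: cmeas_slice_bcoef|exact: cmeas_cst].
  by move=> x; exact: (bpoly_error (gamma1 gamma x) N w1).
Qed.

End deBranges_coefficients.

(** * The image of the Normalized Cauchy Transform *)

Section V1_elements.
Context {R : realType}.
Local Notation RB := (measurableTypeR R).
Variable nu : {measure set RB -> \bar R}.
Hypothesis nu1 : nu setT = 1%E.
Local Notation H := (L2 nu).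
Let PH : prehilbert H := prehilbert_L2 nu.

Lemma V1_hdot f n : hset H f -> V1 nu f n = hdot H f (auxiliary nu n).
Proof. by move=> hf; rewrite V1E// hdot_auxiliary. Qed.

(** Coefficients are inner products, so [V1] turns equality up to null sets into equality of
    sequences. This is how operators known only up to [heq] yield an exact description of the
    image. *)
Lemma V1_heq f g : hset H f -> hset H g -> @heq _ H f g -> V1 nu f = V1 nu g.
Proof.
move=> hf hg fg; apply/funext => n; rewrite !V1_hdot//.
exact: (heq_dotl PH hf hg (L2_auxiliary nu1 n) fg).
Qed.

Lemma V1_sum n (f : 'I_n -> RB -> R[i]^o) : (forall i, hset H (f i)) ->
  V1 nu (\sum_(i < n) f i) = \sum_(i < n) V1 nu (f i).
Proof.
move=> hf; apply/funext => k.
have hs : hset H (\sum_(i < n) f i) by apply: (hset_sum PH).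
rewrite (V1_hdot _ hs) [RHS](_ : _ = \sum_(i < n) (V1 nu (f i) k : R[i])); last first.
  by elim/big_rec2: _ => // i _ y _ <-.
rewrite (hdot_suml PH _ (P := xpredT) (fun i _ => hf i) (L2_auxiliary nu1 k)).
by apply: eq_bigr => i _; rewrite V1_hdot.
Qed.

Hypothesis st : stable nu.

(** Choosing preimages under the isometric and surjective [V1] provides an adjoint; any adjoint is
    then a left inverse up to null sets. *)
Lemma adjoint_V1 l : hset H l -> let l' := adjoint H (Hb nu) (V1 nu) (V1 nu l) in
  hset H l' /\ @heq _ H l' l.
Proof.
move=> hl; have ex : exists T' : hvec (Hb nu) -> hvec H, forall k, hset (Hb nu) k ->
    hset H (T' k) /\ forall h, hset H h -> hdot (Hb nu) (V1 nu h) k = hdot H h (T' k).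
  have /choice [T' hT'] k : exists f, hset (Hb nu) k -> hset H f /\ V1 nu f = k.
    have [hk|nk] := pselect (hset (Hb nu) k); last by exists 0.
    by have [f hf fk] := V1_surj nu1 hk; exists f.
  exists T' => k hk; have [hT Tk] := hT' k hk; split=> // h hh.
  by rewrite -[in LHS]Tk; exact: (V1_dot nu1 st).
have [hA dA] := @xgetPex _ (fun=> 0) [set T' : hvec (Hb nu) -> hvec H | forall k, hset (Hb nu) k ->
    hset H (T' k) /\ forall h, hset H h -> hdot (Hb nu) (V1 nu h) k = hdot H h (T' k)] ex
  (V1 nu l) (V1_Hb nu1 st hl).
split=> //; apply: (heq_of_dot PH) => // h hh.
by rewrite (ph_dotJ PH hh hA) (ph_dotJ PH hh hl) -dA// -(V1_dot nu1 st).
Qed.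

Lemma power_V1 l : hset (power_space H) l -> hset (power_space (Hb nu)) (fun n => V1 nu (l n)).
Proof.
move=> [hl ly]; split=> [n|]; first exact: (V1_Hb nu1 st).
by under eq_eseriesr do rewrite (hnorm_V1 nu1 st)//.
Qed.

Lemma power_V1_surj k : hset (power_space (Hb nu)) k ->
  exists2 l, hset (power_space H) l & k = (fun n => V1 nu (l n)).
Proof.
move=> [hk ky].
have /choice [l hl] n : exists f, hset H f /\ V1 nu f = k n.
  by have [f hf fk] := V1_surj nu1 (hk n); exists f.
exists l; last by apply/funext => n; rewrite (hl n).2.
split=> [n|]; first exact: (hl n).1.
have <- : (\sum_(0 <= n <oo) ((@hnorm _ (Hb nu) (k n)) ^+ 2)%:E =
  \sum_(0 <= n <oo) ((@hnorm _ H (l n)) ^+ 2)%:E)%E.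
  by apply: eq_eseriesr => n _; rewrite -(hl n).2 (hnorm_V1 nu1 st)//; exact: (hl n).1.
exact: ky.
Qed.

Lemma power_V1_dot l y : (forall n, hset H (l n)) -> (forall n, hset H (y n)) ->
  hdot (power_space (Hb nu)) (fun n => V1 nu (l n)) (fun n => V1 nu (y n)) =
  hdot (power_space H) l y.
Proof.
move=> hl hy; congr csum; apply/funext => n; exact: (V1_dot nu1 st).
Qed.

End V1_elements.

Section image.
Context {R : realType}.
Local Notation RB := (measurableTypeR R).
Local Notation RB2 := (RB * RB)%type.
Variables (mu : probability RB2 R) (gamma : R.-pker RB ~> RB).
Variable B : nat -> hvec (L2 (marginal1 mu)) -> hvec (L2 (marginal1 mu)).
Hypothesis sq : on_unit_square mu.
Hypothesis sl : slice_measures mu gamma.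
Hypothesis ss : slice_singular mu gamma.
Hypothesis deB : deBranges_operator mu B.
Local Notation mu1 := (marginal1 mu).
Local Notation H1 := (L2 mu1).
Local Notation H := (L2 mu).
Let dis := sl.2.
Let P1 : prehilbert H1 := prehilbert_L2 mu1.
Let PH : prehilbert H := prehilbert_L2 mu.
Let m1 := marginal1_setT mu.
Let st := stable_marginal1 sq ss.

Lemma tildeE n l : hset H1 l -> tilde mu B n (V1 mu1 l) = V1 mu1 (slice_mul gamma n l).
Proof.
move=> hl; have [hl' ll'] := adjoint_V1 m1 st hl.
have [hB eB] := deBranges_coefficientE dis deB n hl'.
have hs := L2_slice_mul gamma n hl; have hs' := L2_slice_mul gamma n hl'.
rewrite /tilde (V1_heq m1 hB hs' eB); apply: (V1_heq m1 hs' hs).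
apply/(heq_L2 hs' hs); move/(heq_L2 hl' hl): ll'; apply: filterS => x e.
by rewrite /slice_mul e.
Qed.

Lemma operator_mul_tilde l : (forall n, hset H1 (l n)) ->
  operator_mul (tilde mu B) (fun n => V1 mu1 (l n)) = (fun n => V1 mu1 (slice_conv gamma l n)).
Proof.
move=> hl; apply/funext => n; rewrite /operator_mul.
have -> : slice_conv gamma l n = \sum_(k < n.+1) slice_mul gamma k (l (n - k)%N).
  by apply/funext => x; rewrite fct_sumE.
rewrite V1_sum//; last by move=> k; exact: L2_slice_mul.
by apply: eq_bigr => k _; rewrite tildeE.
Qed.

Lemma NCT_HBtilde f : hset H f -> HBtilde mu (tilde mu B) (NCT mu gamma f).
Proof.
move=> hf; have -> : NCT mu gamma f = (fun n => V1 mu1 (slice_coef gamma f n)).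
  by apply/funext => n; exact: (NCTE sl).
have hc := power_slice_coef sl hf; split; first exact: (power_V1 m1 st hc).
move=> _ [k0 hk0 <-]; have [l hl ->] := power_V1_surj m1 st hk0.
have hcl := power_slice_conv gamma hl.
rewrite operator_mul_tilde; last exact: hl.1.
rewrite (power_V1_dot m1 st hc.1 hcl.1); apply: csum_unique; apply/csum_toP.
exact: (slice_orthogonal sl ss hf hl).
Qed.

End image.

(** * The converse inclusion *)

Section converse.
Context {R : realType}.
Local Notation RB := (measurableTypeR R).
Local Notation RB2 := (RB * RB)%type.
Variables (mu : probability RB2 R) (gamma : R.-pker RB ~> RB).
Variable B : nat -> hvec (L2 (marginal1 mu)) -> hvec (L2 (marginal1 mu)).
Hypothesis sq : on_unit_square mu.
Hypothesis sl : slice_measures mu gamma.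
Hypothesis ss : slice_singular mu gamma.
Hypothesis deB : deBranges_operator mu B.
Local Notation mu1 := (marginal1 mu).
Local Notation H1 := (L2 mu1).
Local Notation H := (L2 mu).
Let dis := sl.2.
Let P1 : prehilbert H1 := prehilbert_L2 mu1.
Let PH : prehilbert H := prehilbert_L2 mu.
Let m1 := marginal1_setT mu.
Let st := stable_marginal1 sq ss.

Definition slice_monomial (l : nat -> RB -> R[i]^o) m : RB2 -> R[i]^o :=
  fun z => (auxiliary (gamma z.1) m z.2 : R[i]) * l m z.1.

Lemma L2_slice_monomial l m : hset H1 (l m) -> hset H (slice_monomial l m).
Proof.
move=> hl; have he := L2_embed1 dis hl.
exact: (L2_bounded_mul (cmeas_slice_auxiliary gamma m)
  (fun z => (cabs_auxiliary (gamma1 gamma z.1) m).2 z.2) he).1.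
Qed.

(** On each slice the values [l m x] are scalars, so [auxiliary_sum_sqn] applies there and is
    integrated over [x]. *)
Lemma sqn_slice_monomial l M N : (forall m, hset H1 (l m)) -> (M <= N)%N ->
  sqn H (\sum_(M <= m < N) slice_monomial l m) <= \sum_(M <= m < N) sqn H1 (l m).
Proof.
move=> hl MN; have hv m := L2_slice_monomial (hl m).
have hS : hset H (\sum_(M <= m < N) slice_monomial l m) by apply: (hset_sum PH).
have mS := measurable_cabs2 (L2_cmeas hS).
rewrite -lee_fin sqn_L2// dis//; last by move=> z; rewrite lee_fin sqr_ge0.
rewrite -sumEFin (eq_bigr _ (fun m _ => sqn_L2 (hl m))) -ge0_integral_sum//; first last.
- by move=> m x _; rewrite lee_fin sqr_ge0.
- by move=> m; apply: measurable_cabs2; exact: L2_cmeas (hl m).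
apply: ge0_le_integral => //.
- by move=> x _; apply: integral_ge0 => y _; rewrite lee_fin sqr_ge0.
- apply: (measurable_slice_integral gamma
    (p := fun z => cabs ((\sum_(M <= m < N) slice_monomial l m) z) ^+ 2)) => [|z]; last exact: sqr_ge0.
  exact/measurable_EFinP.
- by apply: emeasurable_sum => m; apply: measurable_cabs2; exact: L2_cmeas (hl m).
move=> x _; rewrite sumEFin.
have g1 := gamma1 gamma x; have PG := prehilbert_L2 (gamma x).
apply: le_trans (_ : _ <= (sqn (L2 (gamma x))
  (\sum_(M <= m < N) (l m x : R[i]) *: auxiliary (gamma x) m))%:E)%E _; last first.
  by rewrite lee_fin; exact: (auxiliary_sum_sqn g1 (fun m => l m x) MN).
rewrite sqn_L2; last by apply: (hset_sum PG) => m _; apply: (hsetZ PG); exact: L2_auxiliary.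
rewrite le_eqVlt; apply/orP; left; apply/eqP; apply: eq_integral => y _.
congr (cabs _ ^+ 2)%:E; rewrite !fct_sumE; apply: eq_bigr => m _.
by rewrite /slice_monomial mulrC.
Qed.

Let phi n2 n1 j : RB -> R[i]^o :=
  fun x => ((bcoef (gamma x) (n2 - j)%N)^*)%C * (auxiliary mu1 n1 x : R[i]).

Let L2_phi n2 n1 j : hset H1 (phi n2 n1 j).
Proof.
apply: (L2_bounded_mul (M := 1) (cmeasJ (cmeas_slice_bcoef gamma (n2 - j))) _ (L2_auxiliary m1 n1)).1.
by move=> x; rewrite cabsJ; exact: (cabs_bcoef (gamma1 gamma x)).
Qed.

(** The test series: [phi] as the only coefficient, at z_2^j. Its slice convolution is [phi] times
    column j of the slice Toeplitz matrix, and [phi] holds the other factor of the Gram entry,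
    conjugated because it stands in the second slot. *)
Let single n2 n1 j m : RB -> R[i]^o := fun x => (phi n2 n1 j x : R[i]) * delta j m.

Let power_single n2 n1 j : hset (power_space H1) (single n2 n1 j).
Proof.
have sE m : single n2 n1 j m = (delta j m : R[i]) *: phi n2 n1 j.
  by apply/funext => x; rewrite /single mulrC.
have hs m : hset H1 (single n2 n1 j m) by rewrite sE; apply: (hsetZ P1).
split=> //; apply: (@nneseries_bounded_lty _ _ (sqn H1 (phi n2 n1 j))) => [m|N]; first exact: sqr_ge0.
have s0 : 0 <= sqn H1 (phi n2 n1 j) by exact: (sqn_ge0 P1).
under eq_bigr => m _.
  rewrite (hnorm_sqr P1 (hs m)) sE (sqnZ P1)//.
  over.
by rewrite -mulr_suml ler_piMl// delta_sqr_le.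
Qed.

Let slice_conv_single n2 n1 j m x :
  slice_conv gamma (single n2 n1 j) m x = (phi n2 n1 j x : R[i]) * bshift (gamma x) j m.
Proof.
rewrite -conv_delta /slice_conv /conv mulr_sumr; apply: eq_bigr => k _.
by rewrite /single mulrCA.
Qed.

(** Integrating over the slice produces an entry of the slice Gram matrix. Its identity part gives
    the first term, and each product of two coefficients becomes a pairing with B~ applied to a test
    series, seen in L^2 of the marginal. *)
Let monomial_dot l m n2 n1 : (forall k, hset H1 (l k)) ->
  hdot H (slice_monomial l m)
    (fun z => (auxiliary (gamma z.1) n2 z.2 : R[i]) * auxiliary mu1 n1 z.1 : R[i]^o) =
  (m == n2)%:R * hdot H1 (l m) (auxiliary mu1 n1) -
  \sum_(j < n2.+1) hdot H1 (l m) (slice_conv gamma (single n2 n1 j) m).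
Proof.
move=> hl; have hv := L2_slice_monomial (hl m); have hG := L2_auxiliary_mul mu gamma n2 n1.
have i0 := L2_mulJ (hl m) (L2_auxiliary m1 n1).
have ij j := L2_mulJ (hl m) (L2_slice_conv gamma m (power_single n2 n1 j).1).
rewrite L2_dotE (cintegral_slice dis (L2_mulJ hv hG)).2 (L2_dotE mu1 (l m)) -cintegralZ//.
under [in RHS]eq_bigr do rewrite L2_dotE.
rewrite -cintegral_sum// -cintegralB; [|exact: cintgZ|exact: cintg_sum].
congr cintegral; apply/funext => x.
have ha k := L2_auxiliary (gamma1 gamma x) k.
transitivity ((l m x : R[i]) * ((auxiliary mu1 n1 x)^*)%C *
    hdot (L2 (gamma x)) (auxiliary (gamma x) m) (auxiliary (gamma x) n2)).
  rewrite L2_dotE -cintegralZ; last exact: (L2_mulJ (ha m) (ha n2)).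
  by congr cintegral; apply/funext => y; rewrite /slice_monomial cJM /=; ring.
rewrite (gram_bshift (gamma1 gamma x)) mulrBr; congr (_ - _); first by rewrite mulrC.
rewrite mulr_sumr; apply: eq_bigr => j _.
by rewrite slice_conv_single /phi !cJM conjcK; ring.
Qed.

(** The scheme of [V1_surj] over the slices. For each coefficient z_1^n1 z_2^n2 only the n2 + 1 test
    series [single n2 n1 j] are needed; orthogonality of [h] to B~ makes their pairings tend to 0,
    leaving the coefficient of [h]. *)
Lemma HBtilde_NCT h : HBtilde mu (tilde mu B) h -> exists2 f, hset H f & NCT mu gamma f = h.
Proof.
move=> [hh horth]; have [l hl hE] := power_V1_surj m1 st hh; rewrite {}hE in horth *.
have orth n2 n1 j : ccvg (fun N => \sum_(m < N)
    hdot H1 (l m) (slice_conv gamma (single n2 n1 j) m)) 0.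
  have hs := power_single n2 n1 j; have hc := power_slice_conv gamma hs.
  have := horth _ (ex_intro2 _ _ _ (power_V1 m1 st hs) erefl).
  rewrite (operator_mul_tilde sq sl ss deB hs.1) (power_V1_dot m1 st hl.1 hc.1) => e.
  rewrite -[X in ccvg _ X]e; exact: (power_dot_cvg P1 hl hc).
have hv m := L2_slice_monomial (hl.1 m).
have sy : (\sum_(0 <= m <oo) (sqn H1 (l m))%:E < +oo)%E.
  apply: le_lt_trans hl.2; rewrite le_eqVlt; apply/orP; left; apply/eqP.
  by apply: eq_eseriesr => m _; rewrite (hnorm_sqr P1)//; exact: hl.1.
have [f [hf fcvg]] := L2_series_cvg hv (fun m => sqn_ge0 P1 (hl.1 m))
  (fun M N MN => sqn_slice_monomial hl.1 MN) sy.
exists f => //; apply/funext => n2; apply/funext => n1.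
rewrite (V1_hdot m1 n1 (hl.1 n2)).
have hG := L2_auxiliary_mul mu gamma n2 n1.
have hS N : hset H (\sum_(m < N) slice_monomial l m) by apply: (hset_sum PH).
apply: (ccvg_unique (hdot_cvg PH hS hf hG fcvg)).
rewrite -[X in ccvg _ X]subr0.
have -> : (fun N => hdot H (\sum_(m < N) slice_monomial l m)
    (fun z => (auxiliary (gamma z.1) n2 z.2 : R[i]) * auxiliary mu1 n1 z.1 : R[i]^o)) =
  (fun N => \sum_(m < N) (m == n2 :> nat)%:R * hdot H1 (l m) (auxiliary mu1 n1) -
    \sum_(j < n2.+1) \sum_(m < N) hdot H1 (l m) (slice_conv gamma (single n2 n1 j) m)).
  apply/funext => N; rewrite exchange_big -sumrB.
  rewrite (hdot_suml PH _ (P := xpredT) (fun (m : 'I_N) _ => hv m) hG).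
  by apply: eq_bigr => m _; rewrite (monomial_dot _ _ _ hl.1).
apply: ccvgD; first exact: (@ccvg_sum_delta _ (fun m => hdot H1 (l m) (auxiliary mu1 n1))).
apply: ccvgN; have s0 : \sum_(j < n2.+1) 0 = 0 :> R[i] by rewrite big1.
rewrite -[X in ccvg _ X]s0; apply: (@ccvg_sum _ _ _ (fun (j : 'I_n2.+1) N => \sum_(m < N)
  hdot H1 (l m) (slice_conv gamma (single n2 n1 j) m)) (fun=> 0)) => j.
exact: orth.
Qed.

End converse.

Theorem theorem4p6 (R : realType)
    (mu : probability (measurableTypeR R * measurableTypeR R)%type R)
    (gamma : R.-pker measurableTypeR R ~> measurableTypeR R)
    (B : nat -> hvec (L2 (marginal1 mu)) -> hvec (L2 (marginal1 mu))) :
  on_unit_square mu ->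
  slice_measures mu gamma ->
  slice_singular mu gamma ->
  deBranges_operator mu B ->
  NCT mu gamma @` hset (L2 mu) = HBtilde mu (tilde mu B).
Proof.
move=> sq sl ss deB; apply/seteqP; split => [_ [f hf <-]|h hh].
  exact: NCT_HBtilde.
by have [f hf fh] := HBtilde_NCT sq sl ss deB hh; exists f.
Qed.
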